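(* Let $T>0$, $N\ge1$, $X=W^{1,2}(0,T;\mathbb{R}^N)$, and let $\delta_1,\delta_2\in\mathbb{R}$ satisfy $|\delta_i|<\frac{1}{2T}$ for $i=1,2$. Suppose $H:\mathbb{R}^N\times\mathbb{R}^N\to\mathbb{R}$ is a proper convex lower semi-continuous function that is $\beta$-subquadratic, where $\beta>0$ satisfies $$\beta<\frac14\min\left\{\frac{1-4T^2|\delta_1|^2}{\max(2T^2,1)-2\delta_1T^2},\ \frac{1-4T^2|\delta_2|^2}{\max(2T^2,1)-2\delta_2T^2}\right\}.$$ Let $\psi_1,\psi_2:\mathbb{R}^N\to\mathbb{R}$ be convex lower semi-continuous functions satisfying $$\liminf_{|p|\to+\infty}\frac{\psi_1(p)}{|p|^2}>\frac{T|\delta_2|^2}{\beta}+2T(1-\delta_2)\quad\text{and}\quad\liminf_{|p|\to+\infty}\frac{\psi_2(p)}{|p|^2}>\frac{T|\delta_1|^2}{\beta}-2T\delta_1.$$ Then the minimum over $X\times X$ of the functional $$I(p,q)=\int_0^T\big[H(p,q)+H^*(-\dot q-\delta_2p,\ \dot p-\delta_1q)+\delta_1|q|^2+\delta_2|p|^2+2\dot q\cdot p\big]\,dt+\psi_2(q(T))+\psi_2^*(-p(T))+\psi_1(p(0))+\psi_1^*(q(0))$$ is equal to zero and is attained at some $(p,q)\in X\times X$ which is a solution of $$\dot p(t)\in\partial_2H(p(t),q(t))+\delta_1q(t),\qquad-\dot q(t)\in\partial_1H(p(t),q(t))+\delta_2p(t)\qquad\text{for }t\in(0,T),$$ $$q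(0)\in\partial\psi_1(p(0)),\qquad-p(T)\in\partial\psi_2(q(T)).$$
   Context: $H$ is called $\beta$-subquadratic ($\beta>0$) if there are positive constants $\alpha,\gamma$ with $-\alpha\le H(p,q)\le\frac{\beta}{2}(|p|^2+|q|^2)+\gamma$ for all $(p,q)\in\mathbb{R}^{2N}$. $F^*$ denotes the Legendre-Fenchel conjugate, $F^*(y)=\sup_x\{x\cdot y-F(x)\}\in(-\infty,+\infty]$, with $(p,q)\cdot(r,s)=p\cdot r+q\cdot s$ on $\mathbb{R}^N\times\mathbb{R}^N$. $\partial$ is the convex subdifferential, and $\partial_1H$, $\partial_2H$ are the partial subdifferentials of $H$ with respect to its first and second $\mathbb{R}^N$-variable. Inclusions involving derivatives of Sobolev functions are understood for almost every $t$; values at $0$ and $T$ are those of the continuous representatives. $I$ takes values in $(-\infty,+\infty]$. *)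

(* Defs.v *)
(* MathComp-Analysis; vectors of R^N are row vectors 'rV[R]_N. *)
From HB Require Import structures.
From mathcomp Require Import all_boot all_order all_algebra.
From mathcomp Require Import all_classical all_reals all_analysis.

Set Implicit Arguments.
Unset Strict Implicit.
Unset Printing Implicit Defensive.

Import Order.TTheory GRing.Theory Num.Theory.
Import numFieldNormedType.Exports.

Local Open Scope classical_set_scope.
Local Open Scope ring_scope.

(* The library norm `|u| on 'rV[R]_N is the sup norm, hence [dotv] and
   [enorm] for the Euclidean structure. *)
Definition dotv (R : realType) (N : nat) (u v : 'rV[R]_N) : R :=
  \sum_(i < N) u 0 i * v 0 i.

Definition enorm (R : realType) (N : nat) (u : 'rV[R]_N) : R :=
  Num.sqrt (dotv u u).

Definition dotvv (R : realType) (N : nat) (u v : 'rV[R]_N * 'rV[R]_N) : R :=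
  dotv u.1 v.1 + dotv u.2 v.2.

(* Legendre-Fenchel conjugate of a real-valued F with respect to the inner
   product [dot] on V. *)
Definition conjugate (R : realType) (V : Type) (dot : V -> V -> R)
    (F : V -> R) (y : V) : \bar R :=
  ereal_sup [set (dot x y - F x)%:E | x in [set: V]].

Definition subdiff (R : realType) (N : nat) (F : 'rV[R]_N -> R)
    (x : 'rV[R]_N) : set 'rV[R]_N :=
  [set y | forall z, F x + dotv y (z - x) <= F z].

Definition subdiff1 (R : realType) (N : nat) (H : 'rV[R]_N * 'rV[R]_N -> R)
    (p q : 'rV[R]_N) : set 'rV[R]_N :=
  subdiff (fun p' => H (p', q)) p.

Definition subdiff2 (R : realType) (N : nat) (H : 'rV[R]_N * 'rV[R]_N -> R)
    (p q : 'rV[R]_N) : set 'rV[R]_N :=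
  subdiff (fun q' => H (p, q')) q.

Definition subquadratic (R : realType) (N : nat) (beta : R)
    (H : 'rV[R]_N * 'rV[R]_N -> R) : Prop :=
  0 < beta /\
  exists alpha gamma : R, [/\ 0 < alpha, 0 < gamma &
    forall p q : 'rV[R]_N,
      - alpha <= H (p, q) <=
        beta / 2 * (enorm p ^+ 2 + enorm q ^+ 2) + gamma].

(* The filter |p| -> +oo on R^N. *)
Definition enorm_infty (R : realType) (N : nat) : set (set 'rV[R]_N) :=
  [set A | exists M : R, forall p, M < enorm p -> A p].

Definition liminf_quadratic (R : realType) (N : nat)
    (psi : 'rV[R]_N -> R) : \bar R :=
  limf_einf (fun p : 'rV[R]_N => (psi p / enorm p ^+ 2)%:E)
    (@enorm_infty R N).

Definition L2 (R : realType) (T : R) (f : R -> R) : Prop :=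
  f \_ `]0, T[ \in Lfun (@lebesgue_measure R) 2%:E.

(* Test functions of class C^1 with compact support in ]0, T[. *)
Definition test_function (R : realType) (T : R) (phi : R -> R) : Prop :=
  let supp := closure [set t | phi t != 0] in
  [/\ forall t, derivable phi t 1,
      continuous (derive1 phi),
      compact supp &
      supp `<=` `]0, T[].

Definition weak_derivative (R : realType) (T : R) (f g : R -> R) : Prop :=
  forall phi : R -> R, test_function T phi ->
    \int[lebesgue_measure]_(t in `]0, T[) (f t * derive1 phi t) =
    - \int[lebesgue_measure]_(t in `]0, T[) (g t * phi t).

(* W^{1,2}(0, T; R^N): [w_fun] is the continuous representative on [0, T] and
   [w_der] any representative of its weak derivative; the values of [w_fun]
   outside [0, T] and of [w_der] outside ]0, T[ are irrelevant. *)
Record W12 (R : realType) (N : nat) (T : R) := {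
  w_fun :> R -> 'rV[R]_N ;
  w_der : R -> 'rV[R]_N ;
  w_fun_cont : {within `[0, T], continuous w_fun} ;
  w_fun_L2 : forall i, L2 T (fun t => w_fun t 0 i) ;
  w_der_L2 : forall i, L2 T (fun t => w_der t 0 i) ;
  w_derP : forall i,
    weak_derivative T (fun t => w_fun t 0 i) (fun t => w_der t 0 i)
}.

Definition functional_I (R : realType) (N : nat) (T delta1 delta2 : R)
    (H : 'rV[R]_N * 'rV[R]_N -> R) (psi1 psi2 : 'rV[R]_N -> R)
    (p q : W12 N T) : \bar R :=
  (\int[lebesgue_measure]_(t in `]0%R, T[)
     ((H (p t, q t))%:E
      + conjugate (@dotvv R N) H
          (- w_der q t - delta2 *: p t, w_der p t - delta1 *: q t)%R
      + (delta1 * enorm (q t) ^+ 2 + delta2 * enorm (p t) ^+ 2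
         + 2 * dotv (w_der q t) (p t))%:E)
   + (psi2 (q T))%:E + conjugate (@dotv R N) psi2 (- p T)%R
   + (psi1 (p 0%R))%:E + conjugate (@dotv R N) psi1 (q 0%R))%E.

Definition hamiltonian_solution (R : realType) (N : nat)
    (T delta1 delta2 : R) (H : 'rV[R]_N * 'rV[R]_N -> R)
    (psi1 psi2 : 'rV[R]_N -> R) (p q : W12 N T) : Prop :=
  [/\ {ae (@lebesgue_measure R), forall t, t \in `]0, T[ ->
        [set y + delta1 *: q t | y in subdiff2 H (p t) (q t)] (w_der p t) /\
        [set y + delta2 *: p t | y in subdiff1 H (p t) (q t)] (- w_der q t)},
      subdiff psi1 (p 0) (q 0) &
      subdiff psi2 (q T) (- p T)].

(* Main.v *)
(* Young-Fenchel bounds the integrand of I below by (p . q)' and the boundary terms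
   by p(0) . q(0) - p(T) . q(T), so I >= 0, with equality exactly at the solutions;
   it remains to construct a solution. Discretise the system by the semi-implicit
   Euler scheme. Rewriting the inclusions with proximal maps turns a discrete
   solution into a zero of a continuous map; a bound that is uniform along a
   homotopy and Brouwer's theorem give this zero. The bound is where the
   hypotheses enter: the growth of H, psi1 and psi2 and the condition on beta make
   the sum of the monotonicity pairings coercive, by discrete Poincare
   inequalities. As the bounds do not depend on the step and H is finite, the
   discrete solutions are uniformly Lipschitz; they converge along an ultrafilter,
   and the limit satisfies the inclusions wherever it is differentiable. *)

Require Import Defs.
From HB Require Import structures.
From mathcomp Require Import all_boot all_order all_algebra perm.
From mathcomp Require Import all_classical all_reals all_analysis.
From mathcomp Require Import measurable_realfun ring lra.

Set Implicit Arguments.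
Unset Strict Implicit.
Unset Printing Implicit Defensive.

Import Order.TTheory GRing.Theory Num.Theory.
Import numFieldNormedType.Exports.

Local Open Scope classical_set_scope.
Local Open Scope ring_scope.

(** * A combinatorial lemma on sign changes in a cube *)

(** A subgradient [u] of [H] at [z] satisfies [u . z >= B |u|^2 - C] with [B = 1 / (2 beta)]. In
    terms of [B] the growth thresholds of [psi1] and [psi2] are [2 T (B delta2^2 + 1 - delta2)] and
    [2 T (B delta1^2 - delta1)], and the condition on [beta] yields the matching bounds
    [2 T^2 (B delta2^2 + 1 - delta2) < B / 2] and [1 + 2 T^2 (B delta1^2 - delta1) < B / 2]; the
    factors 2 are those of a Poincare inequality from an end point. The obstacle is the term
    [2 q' . p], which has no sign. In the scheme [q] moves before [p] and the inclusion is taken at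
    [(p_k, q_(k+1))]: the product rule for [p . q] is then exact, the boundary products cancel
    without discretisation error, and what is left of this term is absorbed by the slopes, for which
    [5 / 3 < B] leaves room. The bounds [|delta_i| < 1 / (2 T)] have a second use: they make the
    final value [q_n], at which [psi2] acts, a legitimate unknown in place of [q_0]. The inclusions
    are averaged over short time intervals before the limit, so that only the pointwise convergence
    of the paths is used. *)

Section kuhn.
Variables (k : nat) (s : nat -> (nat -> nat) -> 'F_2).
Hypothesis s_lo : forall i v, v i = 0%N -> s i v = 0.
Hypothesis s_hi : forall i v, v i = k.+1 -> s i v = 1.

(* The simplex of Kuhn's triangulation attached to the cube x and the order tau
   has vertices v_0, ..., v_m; coordinate i is raised by one from v_(tau i) to
   v_(tau i + 1). Indices i >= m get the value k.+1, where s i is known. *)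
Definition kuhn_vertex m (y t : 'I_m -> nat) (j i : nat) : nat :=
  if insub i is Some i' then (y i' + (t i' < j))%N else k.+1.

Definition kpath m (x : {ffun 'I_m -> 'I_k.+1}) (tau : 'S_m) : nat -> nat -> nat :=
  kuhn_vertex (fun i => x i) (fun i => tau i).

Definition sign_change j (v w : nat -> nat) : 'F_2 := s j w + s j v.

(* The number modulo 2 of simplices along which every s j changes sign between
   v_j and v_(j+1): the cup product of the coboundaries of the s j. *)
Definition chain_sum m : 'F_2 :=
  \sum_(x : {ffun 'I_m -> 'I_k.+1}) \sum_(tau : 'S_m)
    \prod_(j < m) sign_change j (kpath x tau j) (kpath x tau j.+1).

Lemma F2_addrr (x : 'F_2) : x + x = 0.
Proof. by apply: addrr_pchar2; rewrite inE /=; apply/eqP/val_inj. Qed.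

Lemma F2_oppr (x : 'F_2) : - x = x.
Proof. by apply/eqP; rewrite eq_sym -addr_eq0 F2_addrr. Qed.

Lemma kuhn_vertexE m (y t : 'I_m -> nat) j (i : 'I_m) :
  kuhn_vertex y t j i = (y i + (t i < j))%N.
Proof. by rewrite /kuhn_vertex valK. Qed.

Lemma eq_kuhn_vertex m (y y' t t' : 'I_m -> nat) j j' :
    (forall i, y i + (t i < j) = y' i + (t' i < j'))%N ->
  kuhn_vertex y t j = kuhn_vertex y' t' j'.
Proof.
move=> e; apply/funext => i; rewrite /kuhn_vertex.
by case: insubP => // i' _ _; apply: e.
Qed.

(** Right multiplication by [u] exchanges the even and the odd permutations, so the sum is twice one
    half of itself, which is 0 in ['F_2]. *)
Lemma sum_perm_cancel m (u : 'S_m.+1) (F : 'S_m.+1 -> 'F_2) :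
    odd_perm u -> (forall tau, F (tau * u)%g = F tau) ->
  \sum_tau F tau = 0.
Proof.
move=> uo Fu; rewrite (bigID (@odd_perm _)) /=.
rewrite (reindex_inj (mulIg u)) /= -[RHS](F2_addrr (\sum_(i | ~~ odd_perm i) F i)).
by congr (_ + _); apply: eq_big => // tau; rewrite ?odd_permM ?uo ?addbT // Fu.
Qed.

Section step.
Variable m : nat.
Implicit Types (x : {ffun 'I_m.+1 -> 'I_k.+1}) (tau : 'S_m.+1).

(** The cup product of the coboundaries of [s 0], ..., [s (m - 1)] with the cochain [s m] itself, on
    an m-simplex. Its coboundary is the summand of [chain_sum m.+1]. *)
Definition face_term (w : nat -> nat -> nat) : 'F_2 :=
  (\prod_(j < m) sign_change j (w j) (w j.+1)) * s m (w m).

(* Replacing the factor of index l by its two halves interpolates between the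
   faces opposite to v_(m+1) and to v_0; the mismatch does not depend on v_(l+1)
   and hence cancels modulo 2 under the transposition of l and l+1. *)
Definition mixed_term (l : nat) (w : nat -> nat -> nat) : 'F_2 :=
  (\prod_(j < m) if (j < l)%N then sign_change j (w j) (w j.+1)
                 else sign_change j (w j.+1) (w j.+2)) * s m (w m.+1).

Lemma mixed_termS x l : (l < m)%N ->
  \sum_tau mixed_term l.+1 (kpath x tau) =
  \sum_tau mixed_term l (kpath x tau).
Proof.
move=> lm; apply/eqP; rewrite -subr_eq0 F2_oppr -big_split /=; apply/eqP.
have lm1 : (l < m.+1)%N by exact: ltnW.
pose a := Ordinal lm1; pose b := Ordinal (lm : (l.+1 < m.+1)%N).
pose u := tperm a b.
have ab : a != b by rewrite -val_eqE /= neq_ltn ltnSn.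
pose W tau := kpath x tau.
pose T (w : nat -> nat -> nat) : 'F_2 := \prod_(j < m | j != Ordinal lm) (if (j < l)%N
   then sign_change j (w j) (w j.+1) else sign_change j (w j.+1) (w j.+2)) *
   (s l (w l.+2) + s l (w l)) * s m (w m.+1).
have TE w : mixed_term l.+1 w + mixed_term l w = T w.
  rewrite /mixed_term -mulrDl /T; congr (_ * _).
  rewrite (bigD1 (Ordinal lm)) //= ltnSn.
  rewrite [X in _ + X](bigD1 (Ordinal lm)) //= ltnn.
  have -> : \prod_(i < m | i != Ordinal lm) (if (i < l.+1)%N
      then sign_change i (w i) (w i.+1) else sign_change i (w i.+1) (w i.+2)) =
      \prod_(i < m | i != Ordinal lm) (if (i < l)%N
      then sign_change i (w i) (w i.+1) else sign_change i (w i.+1) (w i.+2)).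
    apply: eq_bigr => i il; rewrite ltnS leq_eqVlt.
    by rewrite -val_eqE /= in il; rewrite (negbTE il).
  rewrite -mulrDl mulrC; congr (_ * _); rewrite /sign_change.
  by rewrite addrC addrA -(addrA _ _ (s l (w l.+1))) F2_addrr addr0.
rewrite (eq_bigr (fun tau => T (W tau))); last by move=> tau _; rewrite TE.
apply: (@sum_perm_cancel _ u); first by rewrite odd_tperm.
move=> tau.
have WE j : j != l.+1 -> W (tau * u)%g j = W tau j.
  move=> jl; apply: eq_kuhn_vertex => i; congr (_ + _)%N; rewrite permM.
  congr (nat_of_bool _); rewrite /u.
  case: tpermP => // [->|->] /=.
    by rewrite ltn_neqAle eq_sym (negbTE jl).
  by rewrite [RHS]ltn_neqAle eq_sym (negbTE jl).
rewrite /T !WE ?eqSS ?neq_ltn ?lm ?ltnSn ?orbT //.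
congr (_ * _ * _); apply: eq_bigr => j jl.
rewrite -val_eqE /= in jl.
case: ltnP => jl'.
  by rewrite !WE // neq_ltn ?ltnS ?jl' ?(ltnW jl').
by rewrite !WE // neq_ltn ?ltnS ?ltn_neqAle ?jl' ?(eq_sym l) ?jl ?orbT // ltnW ?orbT.
Qed.

(** Stokes' formula modulo 2 on one cube. Splitting the last factor leaves the face opposite to
    v_(m+1) and [mixed_term m], whose sum over [tau] is that of [mixed_term 0], the face opposite to
    v_0. *)
Lemma face_sums x :
  \sum_tau \prod_(j < m.+1)
     sign_change j (kpath x tau j) (kpath x tau j.+1) =
  \sum_tau face_term (fun j => kpath x tau j.+1) +
  \sum_tau face_term (kpath x tau).
Proof.
have H l : (l <= m)%N -> \sum_tau mixed_term l (kpath x tau) =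
    \sum_tau face_term (fun j => kpath x tau j.+1).
  elim: l => [_|l IH lm]; last by rewrite mixed_termS // IH // ltnW.
  by apply: eq_bigr => tau _; congr (_ * _).
rewrite -(H m (leqnn m)) -big_split /=; apply: eq_bigr => tau _.
rewrite big_ord_recr /= {1}/sign_change mulrDr; congr (_ * _ + _).
by apply: eq_bigr => j _; rewrite ltn_ord.
Qed.

Lemma eq_face_term (w w' : nat -> nat -> nat) :
  (forall j, (j <= m)%N -> w j = w' j) -> face_term w = face_term w'.
Proof.
move=> ww'; rewrite /face_term ww' //; congr (_ * _).
by apply: eq_bigr => j _; rewrite !ww' // ltnW.
Qed.

(** In a plane where [s c] is constant, factor [c] is a vanishing coboundary; for [c = m] there is
    no such factor, and only the value [s m = 0] on the lower plane kills the term. *)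
Lemma face_term_plane (w : nat -> nat -> nat) c a :
    (c <= m)%N -> (forall v, v c = a -> s c v = (a != 0%N)%:R) ->
    (forall j, (j <= m)%N -> w j c = a) -> (c != m) || (a == 0%N) ->
  face_term w = 0.
Proof.
move=> cm sa wa.
have [ecm|cNm] /= := eqVneq c m.
  move=> /eqP a0; have := sa (w m); rewrite {2}ecm a0 => smw.
  by rewrite /face_term smw ?mulr0 // -{1}ecm wa.
rewrite /face_term.
move=> _; have lcm : (c < m)%N by rewrite ltn_neqAle cNm.
by rewrite (bigD1 (Ordinal lcm)) //= /sign_change !sa ?wa ?F2_addrr ?mul0r // ltnW.
Qed.

Definition set_coord x (c : 'I_m.+1) (a : nat) : 'I_m.+1 -> nat :=
  fun i => if i == c then a else x i.

(* Each inner face belongs to two simplices; only the faces with x_c = k + 1 survive. *)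
Lemma shifted_faces tau : let c := (tau^-1)%g ord_max in
  \sum_(x : {ffun 'I_m.+1 -> 'I_k.+1}) face_term (fun j => kpath x (tau * perm (@ordS_inj m.+1)) j.+1)
  + \sum_(x : {ffun 'I_m.+1 -> 'I_k.+1}) face_term (kpath x tau) =
  \sum_(x : {ffun 'I_m.+1 -> 'I_k.+1} | (x c == ord_max) && (c == ord_max))
     face_term (kuhn_vertex (set_coord x c k.+1) (fun i => tau i)).
Proof.
move=> c.
have tauc : tau c = ord_max by rewrite permKV.
have tauE i : (tau i == ord_max) = (i == c) by rewrite -tauc (inj_eq perm_inj).
(* In the rotated order coordinate [c] is raised first, so the face of the cube [x] opposite to v_0
   is the face opposite to v_(m+1), in the order [tau], of the next cube in direction [c]. The
   cyclic shift [sh] pairs them; it fails to do so only in the last layer, where the planes of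
   height k + 1 and 0 remain. *)
pose sh (x : {ffun 'I_m.+1 -> 'I_k.+1}) :=
  [ffun i => if i == c then ordS (x c) else x i].
have sh_inj : injective sh.
  move=> x y xy; apply/ffunP => i; have /ffunP/(_ i) := xy; rewrite !ffunE.
  by case: eqP => // -> /ordS_inj.
rewrite [X in _ + X](reindex_inj sh_inj) -big_split /= [RHS]big_mkcond /=.
apply: eq_bigr => x _.
have -> : face_term (fun j => kpath x (tau * perm (@ordS_inj m.+1)) j.+1) =
    face_term (kuhn_vertex (set_coord x c (x c).+1) (fun i => tau i)).
  apply: eq_face_term => j jm; apply: eq_kuhn_vertex => i.
  rewrite permM permE /set_coord /=; have [->|ic] := eqVneq i c.
    by rewrite tauc /= modnn ltn0Sn ltnNge jm addn0 addn1.
  have tim : (tau i < m)%N.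
    rewrite ltn_neqAle -ltnS ltn_ord andbT.
    by apply: contra ic => /eqP h; rewrite -tauE; apply/eqP/val_inj.
  by rewrite modn_small ?ltnS.
have shE a : sh x c = a :> nat -> kpath (sh x) tau = kuhn_vertex (set_coord x c a) (fun i => tau i).
  move=> <-; apply/funext => j; apply: eq_kuhn_vertex => i; rewrite /set_coord !ffunE.
  by rewrite eqxx; case: eqP.
have planeE a j : (j <= m)%N -> kuhn_vertex (set_coord x c a) (fun i => tau i) j c = a.
  move=> jm; have := kuhn_vertexE (set_coord x c a) (fun i => tau i) j c.
  by rewrite /set_coord eqxx tauc /= ltnNge jm addn0.
have [xc|xc] /= := eqVneq (x c) ord_max; last first.
  rewrite (shE (x c).+1) ?F2_addrr // ffunE eqxx /= modn_small //.
  rewrite ltnS ltn_neqAle -ltnS ltn_ord andbT.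
  by apply: contra xc => /eqP h; apply/eqP/val_inj.
rewrite (shE 0%N) ?ffunE ?eqxx ?xc /= ?modnn //.
rewrite [X in _ + X](@face_term_plane _ c 0%N) ?eqxx ?orbT ?addr0 -1?ltnS //.
- have [//|cm] := eqVneq c ord_max.
  apply: (@face_term_plane _ c k.+1); rewrite -1?ltnS //.
  + by move=> v vc; rewrite s_hi.
  + by move=> j jm; rewrite planeE.
  + by rewrite -val_eqE /= in cm; rewrite cm.
- by move=> v vc; rewrite s_lo.
- by move=> j jm; rewrite planeE.
Qed.

End step.

Definition lift_ffun m (x : {ffun 'I_m -> 'I_k.+1}) : {ffun 'I_m.+1 -> 'I_k.+1} :=
  [ffun i => oapp x ord_max (unlift ord_max i)].

Lemma lift_ffun_bij m :
  {on [pred x : {ffun 'I_m.+1 -> 'I_k.+1} | x ord_max == ord_max], bijective (@lift_ffun m)}.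
Proof.
exists (fun x => [ffun i => x (lift ord_max i)]) => x.
  by move=> _; apply/ffunP => i; rewrite !ffunE liftK.
rewrite inE => /eqP xm; apply/ffunP => i; rewrite !ffunE.
by case: unliftP => [j|] -> //=; rewrite ffunE.
Qed.

Lemma lift_perm_bij m (i j : 'I_m.+1) :
  {on [pred tau : 'S_m.+1 | tau i == j], bijective (lift_perm i j)}.
Proof.
pose un (tau : 'S_m.+1) k' := odflt k' (unlift (tau i) (tau (lift i k'))).
have unK (tau : 'S_m.+1) k' : lift (tau i) (un tau k') = tau (lift i k').
  rewrite /un; have := neq_lift i k'.
  by rewrite -(can_eq (permK tau)) => /unlift_some[] ? ? ->.
have un_inj (tau : 'S_m.+1) : injective (un tau).
  move=> a b /(congr1 (lift (tau i))); rewrite !unK.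
  by move=> /perm_inj /lift_inj.
exists (fun tau => perm (un_inj tau)) => [tau _ | tau].
  by apply/permP => a; rewrite permE /un lift_perm_lift lift_perm_id liftK.
rewrite inE => /eqP tau_i; apply/permP => a.
case: (unliftP i a) => [b|] ->; rewrite ?lift_perm_id //.
by rewrite lift_perm_lift -tau_i permE unK.
Qed.

(** After summation over all cubes only the plane of height k + 1 in the last coordinate
    contributes. There [s m] is 1, and the simplices are those of Kuhn's triangulation in dimension
    m. *)
Lemma chain_sumS m : chain_sum m.+1 = chain_sum m.
Proof.
rewrite /chain_sum.
under eq_bigr do rewrite face_sums.
rewrite big_split /= exchange_big /=.
rewrite (reindex_inj (mulIg (perm (@ordS_inj m.+1)))) /=.
rewrite [X in _ + X]exchange_big -big_split /=.
under eq_bigr do rewrite shifted_faces.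
rewrite (bigID (fun tau : 'S_m.+1 => tau ord_max == ord_max)) /=.
rewrite [X in _ + X]big1 ?addr0; last first.
  move=> tau tm; rewrite big_pred0 // => x; apply/negbTE; apply: contra tm.
  by move=> /andP[_ /eqP {1}<-]; rewrite permKV.
rewrite (reindex _ (lift_perm_bij ord_max ord_max)) [RHS]exchange_big /=.
apply: eq_big => [tau|tau _]; first by rewrite lift_perm_id eqxx.
have cE : ((lift_perm ord_max ord_max tau)^-1)%g ord_max = ord_max.
  by rewrite lift_permV lift_perm_id.
rewrite cE eqxx; under eq_bigl do rewrite andbT.
rewrite (reindex _ (lift_ffun_bij m)) /=.
apply: eq_big => [x|x _]; first by rewrite ffunE unlift_none /= eqxx.
rewrite /face_term s_hi ?mulr1; last first.
  have := kuhn_vertexE (set_coord (lift_ffun x) ord_max k.+1) (fun i => lift_perm ord_max ord_max tau i) m ord_max.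
  by rewrite /set_coord eqxx lift_perm_id /= ltnn addn0.
(* The two sides agree as functions on all of [nat]: at index m the left one is k + 1 by [set_coord]
   and the right one by the default value of [kuhn_vertex]. *)
have E j : (j <= m)%N -> kuhn_vertex (set_coord (lift_ffun x) ord_max k.+1)
    (fun i => lift_perm ord_max ord_max tau i) j = kpath x tau j.
  move=> jm; apply/funext => i; rewrite /kpath.
  have [im|im] := ltnP i m.
    pose i' := Ordinal im; have ei : i = lift ord_max i' :> nat by rewrite /= /bump leqNgt im.
    rewrite -[in RHS](_ : i' = i :> nat) // [in RHS]kuhn_vertexE ei kuhn_vertexE.
    rewrite /set_coord eq_sym (negbTE (neq_lift _ _)) ffunE liftK /= lift_perm_lift /=.
    by rewrite /bump (leqNgt m (tau i')) ltn_ord add0n.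
  rewrite {2}/kuhn_vertex insubF; last by rewrite ltnNge im.
  move: im; rewrite leq_eqVlt => /orP[/eqP <-|im].
    have := kuhn_vertexE (set_coord (lift_ffun x) ord_max k.+1) (fun i => lift_perm ord_max ord_max tau i) j ord_max.
    by rewrite /set_coord eqxx lift_perm_id /= ltnNge jm addn0.
  by rewrite /kuhn_vertex insubF // ltnNge im.
by apply: eq_bigr => j _; rewrite !E // ltnW.
Qed.

Lemma chain_sum1 m : chain_sum m = 1.
Proof.
elim: m => [|m IH]; last by rewrite chain_sumS.
rewrite /chain_sum.
under eq_bigr do under eq_bigr do rewrite big_ord0.
rewrite sumr_const sumr_const card_ffun !card_ord expn0.
by have /= -> := card_Sn 0; rewrite mulr1n.
Qed.

(** As [chain_sum] is 1, some simplex has only nonzero factors, and its vertices lie in a single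
    cube: a discrete form of the Poincare-Miranda theorem. *)
Lemma sign_change_cube m : exists x : {ffun 'I_m -> 'I_k.+1},
  forall j : 'I_m, exists v w : nat -> nat,
    [/\ s j v != s j w,
        forall i : 'I_m, (x i <= v i <= (x i).+1)%N &
        forall i : 'I_m, (x i <= w i <= (x i).+1)%N].
Proof.
have [/existsP[x /existsP[tau xt]]|] := boolP [exists x : {ffun 'I_m -> 'I_k.+1}, [exists tau : 'S_m,
    \prod_(j < m) sign_change j (kpath x tau j) (kpath x tau j.+1) != 0]]; last first.
  move=> /existsPn H; have := chain_sum1 m; rewrite /chain_sum big1 => [/esym/eqP|x _].
    by rewrite oner_eq0.
  by rewrite big1 // => tau _; have := H x; rewrite negb_exists => /forallP /(_ tau); rewrite negbK => /eqP.
exists x => j; exists (kpath x tau j.+1), (kpath x tau j); split.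
- move/prodf_neq0: xt => /(_ j isT); apply: contra => /eqP e.
  by rewrite /sign_change e F2_addrr.
- by move=> i; rewrite /kpath kuhn_vertexE leq_addr /= -[X in (_ <= X)%N]addn1 leq_add2l leq_b1.
- by move=> i; rewrite /kpath kuhn_vertexE leq_addr /= -[X in (_ <= X)%N]addn1 leq_add2l leq_b1.
Qed.
End kuhn.

(** * Zeros of continuous maps *)

Lemma mx_norm_leP (R : realType) m n (x : 'M[R]_(m, n)) (e : R) : 0 <= e ->
  (`|x| <= e) <-> (forall i j, `|x i j| <= e).
Proof.
move=> e0; rewrite -[`|x|]/(mx_norm x) mx_normrE.
split=> [/bigmax_leP[_ H] i j|H]; first exact: (H (i, j) isT).
by apply/bigmax_leP; split=> // -[i j] _; exact: H.
Qed.

Lemma coord_le_mx_norm (R : realType) m n (x : 'M[R]_(m, n)) i j : `|x i j| <= `|x|.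
Proof. by move: i j; apply/mx_norm_leP. Qed.

Lemma closed_ball_rV_compact (R : realType) m (r : R) :
  compact [set x : 'rV[R]_m | `|x| <= r].
Proof.
apply: bounded_closed_compact.
  exists r; split; first exact: num_real.
  by move=> M rM x /= xr; apply: (le_trans xr); exact: ltW.
by apply: (@closed_comp _ _ (fun x : 'rV[R]_m => `|x|) [set t | t <= r]);
   [move=> x _; exact: norm_continuous|exact: closed_le].
Qed.

Section miranda.
Variables (R : realType) (m : nat) (r : R) (F : 'rV[R]_m -> 'rV[R]_m).
Hypotheses (r_gt0 : 0 < r) (Fc : continuous F).
Hypothesis F_lo : forall (x : 'rV[R]_m) i, `|x| <= r -> x 0 i = - r -> F x 0 i <= 0.
Hypothesis F_hi : forall (x : 'rV[R]_m) i, `|x| <= r -> x 0 i = r -> 0 <= F x 0 i.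

Let grid k (v : nat -> nat) : 'rV[R]_m :=
  \row_i (- r + 2 * r * ((v i)%:R / k.+1%:R)).

Let grid_norm k (v : nat -> nat) : (forall i : 'I_m, (v i <= k.+1)%N) -> `|grid k v| <= r.
Proof.
move=> vk; apply/mx_norm_leP; first exact: ltW.
move=> a i; rewrite mxE.
have h1 : 0 <= ((v i)%:R / k.+1%:R : R) by rewrite divr_ge0.
have h2 : ((v i)%:R / k.+1%:R : R) <= 1 by rewrite ler_pdivrMr ?mul1r ?ler_nat ?ltr0n.
set t := _ / _ in h1 h2 *.
have h3 := mulr_ge0 (ltW r_gt0) h1.
have h4 : r * t <= r by rewrite ler_piMr // ltW.
by rewrite ler_norml; apply/andP; split; lra.
Qed.

Let grid_dist k (v w : nat -> nat) : (forall i : 'I_m, (v i <= w i <= (v i).+1)%N) ->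
  `|grid k w - grid k v| <= 2 * r / k.+1%:R.
Proof.
have k0 : 0 < k.+1%:R :> R by rewrite ltr0n.
move=> vk; apply/mx_norm_leP; first by rewrite divr_ge0 ?mulr_ge0 ?ltW.
move=> a i; rewrite !mxE.
rewrite (_ : _ - _ = (2 * r / k.+1%:R) * ((w i)%:R - (v i)%:R)); last by field; rewrite gt_eqF.
rewrite normrM ger0_norm ?divr_ge0 ?mulr_ge0 ?(ltW r_gt0) ?(ltW k0) //.
have /andP[h1 h2] := vk i.
rewrite -natrB // ger0_norm // ler_piMr ?divr_ge0 ?mulr_ge0 ?(ltW r_gt0) ?(ltW k0) //.
by rewrite -[1]/(1%:R) ler_nat leq_subLR addn1.
Qed.

Lemma grid_sign_change k : exists x : 'rV[R]_m, `|x| <= r /\ forall j, exists a b,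
  [/\ F a 0 j <= 0, 0 <= F b 0 j, `|a - x| <= 2 * r / k.+1%:R & `|b - x| <= 2 * r / k.+1%:R].
Proof.
(* The labels 0 and 1 are imposed on the opposite faces of the grid, where [F] may vanish; [F_lo]
   and [F_hi] show that they still agree with the weak sign of [F]. Inside, the label is the strict
   sign. *)
pose s i (v : nat -> nat) : 'F_2 := if v i == 0%N then 0 else if v i == k.+1 then 1 else
   if insub i is Some j then (0 < F (grid k v) 0 j)%R%:R else 0.
have slo i v : v i = 0%N -> s i v = 0 by rewrite /s => ->.
have shi i v : v i = k.+1 -> s i v = 1 by rewrite /s => ->; rewrite eqxx.
have [x xP] := sign_change_cube slo shi m.
pose X i : nat := if insub i is Some j then x j else 0%N.
have XE (i : 'I_m) : X i = x i by rewrite /X valK.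
exists (grid k X); split; first by apply: grid_norm => i; rewrite XE ltnW.
move=> j; have [v [w [svw v1 w1]]] := xP j.
have sP (u : nat -> nat) : (forall i : 'I_m, (x i <= u i <= (x i).+1)%N) ->
    (s j u = 0 -> F (grid k u) 0 j <= 0) /\ (s j u <> 0 -> 0 <= F (grid k u) 0 j).
  move=> uP; have gr : `|grid k u| <= r.
    apply: grid_norm => i; have /andP[_ h] := uP i; apply: (leq_trans h).
    exact: ltn_ord.
  rewrite /s; case: eqP => [u0|_].
    split=> // _; apply: F_lo => //; rewrite mxE u0; ring.
  case: eqP => [u0|_].
    split=> [/eqP|_]; first by rewrite oner_eq0.
    by apply: F_hi => //; rewrite mxE u0 divff ?pnatr_eq0 //; ring.
  rewrite valK; case: ltP => //= h; split => // _.
  exact: ltW.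
have dX (u : nat -> nat) : (forall i : 'I_m, (x i <= u i <= (x i).+1)%N) ->
    `|grid k u - grid k X| <= 2 * r / k.+1%:R.
  by move=> uP; apply: grid_dist => i; rewrite XE.
have [v0 vn0] := sP _ v1; have [w0 wn0] := sP _ w1.
have [sv|sv] := eqVneq (s j v) 0.
  exists (grid k v), (grid k w); split; [exact: v0| |exact: dX|exact: dX].
  by apply: wn0; move=> sw; move: svw; rewrite sv sw eqxx.
exists (grid k w), (grid k v); split; [|by apply: vn0; apply/eqP|exact: dX|exact: dX].
apply: w0; move: sv svw.
by case: (s j v) => -[|[|[]]] //= ?; case: (s j w) => -[|[|[]]] //= ?; move=> *; apply/val_inj.
Qed.

(** The cubes with sign changes accumulate at a point of the compact cube. A nonzero coordinate of
    [F] there would keep its sign on a neighbourhood that contains points of both weak signs. *)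
Lemma poincare_miranda : exists2 x, `|x| <= r & F x = 0.
Proof.
have [X XP] := choice grid_sign_change.
have [z [/= zr zX]] : [set x | `|x| <= r] `&` cluster (X @ \oo) !=set0.
  apply: closed_ball_rV_compact; exists 0%N => // k _; exact: (XP k).1.
exists z => //; apply/rowP => j; rewrite mxE; apply/eqP.
have Fj : continuous (fun x => F x 0 j).
  by move=> x; apply: (@continuous_comp _ _ _ F (fun y : 'rV[R]_m => y 0 j)); [exact: Fc|exact: coord_continuous].
have key (P : set R) : open P -> P (F z 0 j) -> exists a b,
    [/\ P (F a 0 j), P (F b 0 j), F a 0 j <= 0 & 0 <= F b 0 j].
  move=> oP Pz.
  have /nbhs_ballP[e /= e0 eP] : nbhs z [set x | P (F x 0 j)].
    exact/Fj/open_nbhs_nbhs.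
  have [N _ NP] : \forall k \near \oo, 2 * r / k.+1%:R < e / 2.
    have : (2 * r) * (harmonic k) @[k --> \oo] --> (2 * r) * 0.
      by apply: cvgMr; exact: cvg_harmonic.
    rewrite mulr0 => /cvgrPdist_lt /(_ (e / 2)) h.
    have := h ltac:(lra); apply: filterS => k; rewrite sub0r normrN ger0_norm //.
    by rewrite divr_ge0 ?mulr_ge0 ?(ltW r_gt0).
  have [x [[k Nk <-]] zk] := zX (X @` [set k | (N <= k)%N]) (ball z (e / 2))
     ltac:(by exists N => // k Nk; exists k) ltac:(apply: nbhsx_ballx; lra).
  have [_ /(_ j)[a [b [a0 b0 ax bx]]]] := XP k; exists a, b.
  have H (u : 'rV[R]_m) : `|u - X k| <= 2 * r / k.+1%:R -> P (F u 0 j).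
    move=> ux; apply: eP; rewrite -ball_normE /ball_ /=.
    rewrite -ball_normE /ball_ /= in zk.
    rewrite -(subrK (X k) z) -addrA (le_lt_trans (ler_normD _ _)) //.
    rewrite (distrC (X k)); have h2 := NP _ Nk; have := ltrD zk (le_lt_trans ux h2); lra.
  by split=> //; exact: H.
rewrite eq_le; apply/andP; split; rewrite leNgt; apply/negP => h.
  have [a [b [/= pa _ a0 _]]] := key [set t | 0 < t] (@open_gt _ 0) h.
  by move: pa; rewrite ltNge a0.
have [a [b [_ /= pb _ b0]]] := key [set t | t < 0] (@open_lt _ 0) h.
by move: pb; rewrite ltNge b0.
Qed.

End miranda.

Lemma lipschitz_continuous_dist (R : realType) (V W : normedModType R) (f : V -> W) (L : R) :
  (forall x y, `|f x - f y| <= L * `|x - y|) -> continuous f.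
Proof.
move=> fL x; apply/cvgrPdist_le => e e0.
have L0 : 0 < `|L| + 1 by rewrite ltr_wpDl.
near=> y; apply: (le_trans (fL x y)).
have : `|x - y| <= e / (`|L| + 1).
  by near: y; apply: cvgr_dist_le; [exact: cvg_id|rewrite divr_gt0].
rewrite ler_pdivlMr // => h; apply: le_trans h; rewrite mulrC ler_wpM2l //.
by rewrite (le_trans (ler_norm L)) // lerDl.
Unshelve. all: by end_near. Qed.

Section brouwer.
Variables (R : realType) (r : R).
Hypothesis r_gt0 : 0 < r.

(* Poincare-Miranda applied to x - rho (x - F x), with rho the radial retraction
   of the space onto the cube of radius r. *)
Lemma brouwer_zero_rV m (F : 'rV[R]_m -> 'rV[R]_m) : continuous F ->
    (forall (x : 'rV[R]_m) (mu : R), `|x| = r -> 0 < mu -> F x <> - mu *: x) ->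
  exists2 x, `|x| <= r & F x = 0.
Proof.
move=> Fc Fr.
pose rho (y : 'rV[R]_m) := (r / Num.max r `|y|) *: y.
have max_gt0 (y : 'rV[R]_m) : 0 < Num.max r `|y| by rewrite lt_max r_gt0.
have rho_le y : `|rho y| <= r.
  have h : 0 <= r / Num.max r `|y| by rewrite divr_ge0 ?(ltW r_gt0) ?(ltW (max_gt0 _)).
  rewrite /rho normrZ (ger0_norm h) mulrAC ler_pdivrMr //.
  by rewrite ler_pM2l // le_max lexx orbT.
have sc : continuous (fun y : 'rV[R]_m => r / Num.max r `|y|).
  move=> y; apply: (@cvgM _ _ _ (nbhs_filter y)); first exact: cvg_cst.
  apply: (@cvgV _ _ _ (nbhs_filter y)); first by rewrite gt_eqF.
  apply: (@continuous_max _ _ (cst r) (fun y : 'rV[R]_m => `|y|)); first exact: cst_continuous.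
  exact: norm_continuous.
have rho_cont : continuous rho.
  by move=> y; apply: (cvgZ (sc y)); exact: cvg_id.
have rho_bd y i : - r <= rho y 0 i <= r by rewrite -ler_norml (le_trans _ (rho_le y)) ?coord_le_mx_norm.
pose G (x : 'rV[R]_m) := x - rho (x - F x).
have Gc1 : continuous (fun x : 'rV[R]_m => x - F x).
  by move=> x; apply: (@cvgB _ _ _ _ (nbhs_filter x)); [exact: cvg_id|exact: Fc].
have Gc2 : continuous (rho \o (fun x : 'rV[R]_m => x - F x)).
  by move=> x; apply: continuous_comp; [exact: Gc1|exact: rho_cont].
have Gc : continuous G.
  by move=> x; apply: (@cvgB _ _ _ _ (nbhs_filter x)); [exact: cvg_id|exact: Gc2].
have GE x i : G x 0 i = x 0 i - rho (x - F x) 0 i by rewrite /G 2!mxE.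
have [x i _ xi|x i _ xi|x xr Gx] := @poincare_miranda _ m r G r_gt0 Gc.
- by rewrite GE xi; have /andP[h _] := rho_bd (x - F x) i; lra.
- by rewrite GE xi; have /andP[_ h] := rho_bd (x - F x) i; lra.
exists x => //.
have {}Gx : x = rho (x - F x) by apply/eqP; rewrite -subr_eq0; apply/eqP.
have [yr|yr] := lerP `|x - F x| r.
  move: Gx; rewrite /rho max_l // divff ?gt_eqF // scale1r => /eqP.
  by rewrite eq_sym -subr_eq0 addrAC subrr add0r oppr_eq0 => /eqP.
(* If [x - F x] were outside the cube, its retraction [x] would lie on the boundary with
   [F x = - mu *: x] and [mu = |y| / r - 1 > 0], which [Fr] excludes. *)
exfalso; set y := x - F x in Gx yr.
have y0 : 0 < `|y| by exact: lt_trans yr.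
rewrite /rho max_r ?(ltW yr) // in Gx.
have Fy : F x = x - y by rewrite /y opprB addrC subrK.
apply: (Fr x (`|y| / r - 1)).
- by rewrite Gx normrZ ger0_norm ?divr_ge0 ?(ltW r_gt0) // divfK // gt_eqF.
- by rewrite subr_gt0 ltr_pdivlMr // mul1r.
have ye : y = (`|y| / r) *: x.
  by rewrite Gx scalerA mulrA divfK ?divff ?scale1r // gt_eqF.
by rewrite Fy {1}ye opprB scalerBl scale1r.
Qed.

Lemma mxvec_norm m n (A : 'M[R]_(m, n)) : `|mxvec A| = `|A|.
Proof.
apply/eqP; rewrite eq_le; apply/andP; split; apply/mx_norm_leP => // i j.
  by rewrite ord1; case/mxvec_indexP: j => i' j'; rewrite mxvecE coord_le_mx_norm.
by rewrite -mxvecE coord_le_mx_norm.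
Qed.

Lemma brouwer_zero m n (F : 'M[R]_(m, n) -> 'M[R]_(m, n)) : continuous F ->
    (forall (x : 'M[R]_(m, n)) (mu : R), `|x| = r -> 0 < mu -> F x <> - mu *: x) ->
  exists2 x, `|x| <= r & F x = 0.
Proof.
move=> Fc Fr.
have vec_cont : continuous (@vec_mx R m n).
  apply: (@lipschitz_continuous_dist _ _ _ _ 1) => x y.
  by rewrite mul1r -[in leRHS](vec_mxK (x - y)) mxvec_norm linearB.
have mxvec_cont : continuous (@mxvec R m n).
  apply: (@lipschitz_continuous_dist _ _ _ _ 1) => x y.
  by rewrite mul1r -(mxvec_norm (x - y)) linearB.
have Gc : continuous (mxvec \o (F \o @vec_mx R m n)).
  move=> x; apply: continuous_comp; last exact: mxvec_cont.
  by apply: continuous_comp; [exact: vec_cont|exact: Fc].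
have [|x xr Gx] := brouwer_zero_rV Gc.
  move=> x mu xr mu0 /(congr1 vec_mx); rewrite /= mxvecK linearZ /=.
  by apply: Fr mu0; rewrite -mxvec_norm vec_mxK.
exists (vec_mx x); first by rewrite -mxvec_norm vec_mxK.
by rewrite -(mxvecK (F _)) [mxvec _]Gx linear0.
Qed.

End brouwer.

(** * Convex functions on R^N *)

Section dot_product.
Variables (R : realType) (d : nat).
Implicit Types x y z : 'rV[R]_d.

Lemma dotvC x y : dotv x y = dotv y x.
Proof. by apply: eq_bigr => i _; rewrite mulrC. Qed.

Lemma dotvDl x y z : dotv (x + y) z = dotv x z + dotv y z.
Proof. by rewrite -big_split; apply: eq_bigr => i _; rewrite mxE mulrDl. Qed.

Lemma dotvZl a x z : dotv (a *: x) z = a * dotv x z.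
Proof. by rewrite mulr_sumr; apply: eq_bigr => i _; rewrite mxE mulrA. Qed.

Lemma dotvNl x z : dotv (- x) z = - dotv x z.
Proof. by rewrite -scaleN1r dotvZl mulN1r. Qed.

Lemma dotvBl x y z : dotv (x - y) z = dotv x z - dotv y z.
Proof. by rewrite dotvDl dotvNl. Qed.

Lemma dotvDr x y z : dotv x (y + z) = dotv x y + dotv x z.
Proof. by rewrite !(dotvC x) dotvDl. Qed.

Lemma dotvZr a x z : dotv x (a *: z) = a * dotv x z.
Proof. by rewrite !(dotvC x) dotvZl. Qed.

Lemma dotvNr x z : dotv x (- z) = - dotv x z.
Proof. by rewrite !(dotvC x) dotvNl. Qed.

Lemma dotvBr x y z : dotv x (y - z) = dotv x y - dotv x z.
Proof. by rewrite dotvDr dotvNr. Qed.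

Lemma dotv0l x : dotv 0 x = 0.
Proof. by rewrite -(scale0r 0) dotvZl mul0r. Qed.

Definition dotvE := (dotvDl, dotvBl, dotvNl, dotvZl, dotvDr, dotvBr, dotvNr, dotvZr).

Lemma dotv_ge0 x : 0 <= dotv x x.
Proof. by apply: sumr_ge0 => i _; rewrite -expr2 sqr_ge0. Qed.

Lemma enorm_sqr x : enorm x ^+ 2 = dotv x x.
Proof. by rewrite sqr_sqrtr ?dotv_ge0. Qed.

Lemma dotv_AMGM x y : 2 * dotv x y <= dotv x x + dotv y y.
Proof. by have := dotv_ge0 (x - y); rewrite !dotvE (dotvC y x); lra. Qed.

Lemma sqr_norm_le_dotv x : `|x| ^+ 2 <= dotv x x.
Proof.
have coord j : x 0 j ^+ 2 <= dotv x x.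
  rewrite /dotv (bigD1 j) //= -expr2 lerDl.
  by apply: sumr_ge0 => i _; rewrite -expr2 sqr_ge0.
rewrite -enorm_sqr ler_sqr ?nnegrE ?sqrtr_ge0 //.
apply/mx_norm_leP; first exact: sqrtr_ge0.
move=> i j; rewrite ord1 -ler_sqr ?nnegrE ?sqrtr_ge0 // -normrX ger0_norm ?sqr_ge0 //.
by rewrite enorm_sqr.
Qed.

Lemma dotv_le_norm x y : `|dotv x y| <= d%:R * (`|x| * `|y|).
Proof.
apply: (le_trans (ler_norm_sum _ _ _)).
rewrite -[X in X%:R * _](card_ord d) mulr_natl -sumr_const.
by apply: ler_sum => i _; rewrite normrM ler_pM // coord_le_mx_norm.
Qed.

Lemma cvg_dotv (T : Type) (G : set_system T) (FG : Filter G) (u v : T -> 'rV[R]_d) a b :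
  u @ G --> a -> v @ G --> b -> (fun t => dotv (u t) (v t)) @ G --> dotv a b.
Proof.
move=> ua vb.
have coord (w : T -> 'rV[R]_d) (c : 'rV[R]_d) j : w @ G --> c -> (fun t => w t 0 j) @ G --> c 0 j.
  by move=> wc; exact: (cvg_comp _ (fun y : 'rV[R]_d => y 0 j) wc (@coord_continuous R 1 d 0 j c)).
rewrite /dotv; elim: (index_enum _) => [|i s IH].
  rewrite big_nil; under eq_fun do rewrite big_nil; exact: cvg_cst.
rewrite big_cons; under eq_fun do rewrite big_cons.
by apply: cvgD; [apply: cvgM; exact: coord|exact: IH].
Qed.

Lemma dotv_cont (x0 : 'rV[R]_d) : continuous (fun x => dotv (x - x0) (x - x0)).
Proof.
move=> x; have h : (fun x : 'rV[R]_d => x - x0) @ x --> x - x0.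
  by apply: (@cvgB _ _ _ _ (nbhs_filter x)); [exact: cvg_id|exact: cvg_cst].
exact: (@cvg_dotv _ _ (nbhs_filter x)).
Qed.
End dot_product.

Definition convex_real (R : realType) (V : lmodType R) (F : V -> R) :=
  forall x y t, 0 <= t <= 1 -> F (t *: x + (1 - t) *: y) <= t * F x + (1 - t) * F y.

Lemma convex_functionE (R : realType) (V : lmodType R) (F : V -> R) :
  convex_function [set: V] F -> convex_real F.
Proof.
move=> cF x y t t01.
have := cF (Itv01 (proj1 (andP t01)) (proj2 (andP t01))) x y (in_setT _) (in_setT _).
by [].
Qed.

Lemma locally_lipschitz_continuous (R : realType) (V : normedModType R) (F : V -> R) x0 M :
  0 <= M -> (forall x, `|x - x0| <= 1 -> `|F x - F x0| <= M * `|x - x0|) ->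
  {for x0, continuous F}.
Proof.
move=> M0 MP; apply/cvgrPdist_le => e e0.
have d0 : 0 < Num.min 1 (e / (M + 1)) by rewrite lt_min ltr01 divr_gt0 // ltr_wpDl.
near=> x; have : `|x0 - x| <= Num.min 1 (e / (M + 1)).
  by near: x; apply: cvgr_dist_le d0; exact: cvg_id.
rewrite le_min distrC => /andP[x1 x2]; rewrite distrC (le_trans (MP x x1)) //.
rewrite ler_pdivlMr ?ltr_wpDl // in x2; rewrite (le_trans _ x2) // mulrC ler_wpM2l //.
by rewrite lerDl.
Unshelve. all: by end_near. Qed.

Section convex_rV.
Variables (R : realType) (d : nat) (F : 'rV[R]_d -> R).
Hypothesis F_convex : convex_real F.

(* Convexity in one coordinate at a time: F is dominated by its values at the
   vertices of the cube. *)
Lemma convex_bounded_cube k (x0 : 'rV[R]_d) : exists B, forall v : 'rV[R]_d,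
  (forall i, `|v 0 i| <= 1) -> (forall i : 'I_d, (k <= i)%N -> v 0 i = 0) -> F (x0 + v) <= B.
Proof.
elim: k x0 => [|k IH] x0.
  exists (F x0) => v _ v0; rewrite (_ : v = 0) ?addr0 //.
  by apply/rowP => i; rewrite v0 // mxE.
have [kd|kd] := ltnP k d; last first.
  have [B BP] := IH x0; exists B => v v1 v0; apply: BP => // i ki.
  by have := leq_trans kd ki; rewrite leqNgt ltn_ord.
pose i := Ordinal kd; pose e : 'rV[R]_d := \row_j (j == i)%:R.
have [B1 B1P] := IH (x0 + e); have [B2 B2P] := IH (x0 - e).
exists (Num.max B1 B2) => v v1 v0.
pose t := v 0 i; pose v' : 'rV[R]_d := v - t *: e.
have := v1 i; rewrite ler_norml -/t => /andP[t1 t2].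
have v'E j : v' 0 j = if j == i then 0 else v 0 j.
  rewrite !mxE; case: eqP => [->|_]; first by rewrite mulr1 subrr.
  by rewrite mulr0 subr0.
have v'1 j : `|v' 0 j| <= 1 by rewrite v'E; case: eqP => // _; rewrite normr0.
have v'0 (j : 'I_d) : (k <= j)%N -> v' 0 j = 0.
  rewrite leq_eqVlt v'E => /orP[/eqP kj|kj]; last by rewrite v0 // if_same.
  by case: eqP => // ji; case: ji; apply: val_inj.
have -> : x0 + v = ((1 + t) / 2) *: (x0 + e + v') + (1 - (1 + t) / 2) *: (x0 - e + v').
  by apply/rowP => j; rewrite !mxE; field.
apply: (le_trans (F_convex _ _ _)); first by apply/andP; split; lra.
have h1 := B1P _ v'1 v'0; have h2 := B2P _ v'1 v'0.
have {}h1 : F (x0 + e + v') <= Num.max B1 B2 by rewrite le_max h1.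
have {}h2 : F (x0 - e + v') <= Num.max B1 B2 by rewrite le_max h2 orbT.
by nra.
Qed.

(** An upper bound [B] on the unit ball controls the secants in both directions: the one from [x0]
    to [x0 + v / |v|] bounds [F (x0 + v)] above, the one from [x0 - v / |v|] through [x0] bounds it
    below. *)
Lemma convex_lipschitz_at (x0 : 'rV[R]_d) : exists2 M, 0 <= M &
  forall x, `|x - x0| <= 1 -> `|F x - F x0| <= M * `|x - x0|.
Proof.
have [B BP] := convex_bounded_cube d x0.
have {}BP v : `|v| <= 1 -> F (x0 + v) <= B.
  move=> v1; apply: BP => [i|i]; first by apply: le_trans v1; exact: coord_le_mx_norm.
  by rewrite leqNgt ltn_ord.
have B0 : F x0 <= B by rewrite -[x0]addr0 BP ?normr0.
exists (B - F x0); first by rewrite subr_ge0.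
move=> x; have -> : x = x0 + (x - x0) by rewrite addrC subrK.
move: (x - x0) => v; rewrite [x0 + v - _]addrAC subrr add0r.
have [->|v0] := eqVneq v 0; first by rewrite !addr0 subrr !normr0 mulr0.
have r0 : 0 < `|v| by rewrite normr_gt0.
set r := `|v| in r0 * => r1.
have h1 : F (x0 + r^-1 *: v) <= B.
  by apply: BP; rewrite normrZ ger0_norm ?invr_ge0 ?(ltW r0) // mulVf // gt_eqF.
have h2 : F (x0 - r^-1 *: v) <= B.
  by apply: BP; rewrite normrN normrZ ger0_norm ?invr_ge0 ?(ltW r0) // mulVf // gt_eqF.
have rn : r != 0 by rewrite gt_eqF.
have r01 : 0 <= r <= 1 by rewrite r1 ltW.
have := F_convex (x0 + r^-1 *: v) x0 r01.
rewrite (_ : r *: _ + _ = x0 + v); last first.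
  by apply/rowP => i; rewrite !mxE; field.
have s01 : 0 <= (1 + r)^-1 <= 1.
  by rewrite invr_ge0 addr_ge0 ?(ltW r0) // invf_le1 ?lerDl ?(ltW r0) // ltr_wpDl.
have := F_convex (x0 + v) (x0 - r^-1 *: v) s01.
rewrite (_ : _ *: _ + _ = x0); last first.
  by apply/rowP => i; rewrite !mxE; field; rewrite rn; rewrite gt_eqF // ltr_wpDl.
move=> h3 h4.
have {}h3 : (1 + r) * F x0 <= F (x0 + v) + r * F (x0 - r^-1 *: v).
  have r10 : 0 < 1 + r by rewrite addr_gt0.
  rewrite -(ler_pM2l r10) in h3; apply: (le_trans h3); rewrite le_eqVlt; apply/orP; left.
  by apply/eqP; field; rewrite gt_eqF.
by rewrite ler_norml; apply/andP; split; nra.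
Qed.

Lemma convex_continuous : continuous F.
Proof.
by move=> x0; have [M M0 MP] := convex_lipschitz_at x0; exact: locally_lipschitz_continuous MP.
Qed.

(** Outside the unit ball, convexity on the segment from 0 to [x] carries the lower bound from
    [x / |x|] to [x]. *)
Lemma convex_affine_lower : exists2 M, 0 <= M & forall x, F 0 - M * `|x| <= F x.
Proof.
have [M M0 MP] := convex_lipschitz_at 0; exists M => // x.
have [x1|x1] := lerP `|x| 1.
  by have := MP x; rewrite subr0 => /(_ x1); rewrite ler_norml => /andP[h _]; lra.
have x0 : 0 < `|x| by rewrite (lt_trans ltr01).
have t01 : 0 <= `|x|^-1 <= 1 by rewrite invr_ge0 ltW //= invf_le1 // ltW.
have := F_convex x 0 t01; rewrite scaler0 addr0.
have en : `|(`|x|^-1) *: x| = 1.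
  by rewrite normrZ ger0_norm ?invr_ge0 ?(ltW x0) // mulVf // gt_eqF.
have := MP (`|x|^-1 *: x); rewrite subr0 en => /(_ (lexx _)); rewrite ler_norml mulr1 => /andP[h _] h2.
have : F 0 - M <= `|x|^-1 * F x + (1 - `|x|^-1) * F 0 by lra.
rewrite -(ler_pM2l x0) [leRHS](_ : _ = F x + (`|x| - 1) * F 0); first by lra.
by field; rewrite gt_eqF.
Qed.

(** The point [y] minimises [F y + |y - x|^2 / 2], and the inclusion is the optimality condition. *)
Lemma proximal_exists (x : 'rV[R]_d) : exists y, subdiff F y (x - y).
Proof.
have [M M0 MP] := convex_affine_lower.
pose g y := F y + dotv (y - x) (y - x) / 2.
(* Beyond this radius the quadratic term outweighs the affine lower bound of [F], so a minimum over
   the ball is a global one. *)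
pose r := `|x| + 2 * M + 2 + 2 * (`|F x - F 0| + M * `|x|).
have r0 : 0 <= r by rewrite /r !(addr_ge0, mulr_ge0).
have gr y : r < `|y| -> g x < g y.
  move=> ry; rewrite /g subrr dotv0l mul0r addr0.
  have h1 := MP y; have h2 := sqr_norm_le_dotv (y - x).
  have h3 : `|y| - `|x| <= `|y - x| by exact: lerB_dist.
  have h4 := ler_norm (F x - F 0).
  have h5 : 0 <= M * `|x| by rewrite mulr_ge0.
  have h6 : 0 <= `|F x - F 0| by [].
  have h7 : 2 * M + 2 + 2 * (`|F x - F 0| + M * `|x|) < `|y| - `|x| by rewrite /r in ry; lra.
  set u := `|y| - `|x| in h3 h7.
  have h8 : u ^+ 2 <= `|y - x| ^+ 2 by rewrite ler_sqr ?nnegrE //; lra.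
  have h9 : u * (2 * M + 2) <= u ^+ 2.
    by rewrite expr2 ler_wpM2l //; lra.
  have e : `|y| = u + `|x| by rewrite /u subrK.
  by rewrite e in h1; lra.
have gc : {within [set y : 'rV[R]_d | `|y| <= r], continuous g}.
  apply: continuous_subspaceT => y.
  apply: (@cvgD _ _ _ _ (nbhs_filter y)); first exact: convex_continuous.
  by apply: (@cvgM _ _ _ (nbhs_filter y)); [exact: dotv_cont|exact: cvg_cst].
have [|y _ ymin] := EVT_min_rV _ (@closed_ball_rV_compact R d r) gc.
  by exists 0; rewrite /= normr0.
have {}ymin z : g y <= g z.
  have [zr|zr] := lerP `|z| r; first by apply: ymin; rewrite inE.
  apply: (le_trans (ymin x _)); last exact: ltW (gr _ zr).
  have h1 := normr_ge0 (F x - F 0); have h2 : 0 <= M * `|x| by rewrite mulr_ge0.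
  by rewrite inE /= /r; lra.
exists y => z.
apply/ler_addgt0Pr => e e0.
pose a := dotv (z - y) (z - y).
have a0 : 0 <= a by exact: dotv_ge0.
(* Minimality at [t z + (1 - t) y], divided by [t], is the inclusion up to the error [t * a / 2],
   which this [t] makes smaller than [e]. *)
pose t := Num.min 1 (e / (a + 1)).
have t0 : 0 < t by rewrite lt_min ltr01 divr_gt0 // ltr_wpDl.
have t1 : t <= 1 by rewrite ge_min lexx.
have te : t * (a + 1) <= e by rewrite -ler_pdivlMr ?ltr_wpDl // ge_min lexx orbT.
have t01 : 0 <= t <= 1 by rewrite t1 ltW.
have := ymin (t *: z + (1 - t) *: y); have := F_convex z y t01; rewrite /g.
have -> : t *: z + (1 - t) *: y - x = (y - x) + t *: (z - y).
  by apply/rowP => i; rewrite !mxE; ring.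
rewrite (dotvDl (y - x)) !(dotvDr _ (y - x)) !dotvZl !dotvZr -/a (dotvC (z - y) (y - x)).
have -> : dotv (x - y) (z - y) = - dotv (y - x) (z - y) by rewrite -dotvNl opprB.
set b := dotv (y - x) (z - y) => h1 h2.
have h3 : t * (F y - b) <= t * (F z + e).
  have : t * (t * a) <= t * e by rewrite ler_pM2l //; nra.
  by have := mulr_ge0 (ltW t0) (ltW e0); lra.
by rewrite ler_pM2l // in h3.
Qed.

(** Monotonicity of the subdifferential gives the constant 1 for the Euclidean norm; [d%:R + 1] is
    the price of the sup norm. *)
Lemma proximal_nonexpansive x x' y y' : subdiff F y (x - y) -> subdiff F y' (x' - y') ->
  `|y - y'| <= (d%:R + 1) * `|x - x'|.
Proof.
move=> /(_ y') h1 /(_ y) h2.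
have h3 : dotv (y - y') (y - y') <= dotv (x - x') (y - y').
  move: h1 h2; rewrite !dotvE (dotvC y' y) (dotvC x y) (dotvC x' y) (dotvC x y') (dotvC x' y'); lra.
have h4 := dotv_AMGM (x - x') (y - y').
have h5 : `|y - y'| ^+ 2 <= d%:R * `|x - x'| ^+ 2.
  apply: (le_trans (sqr_norm_le_dotv _)); apply: le_trans (_ : dotv (x - x') (x - x') <= _); first lra.
  by rewrite expr2 (le_trans (ler_norm _)) // dotv_le_norm.
have h6 : 0 <= d%:R :> R by [].
rewrite -ler_sqr ?nnegrE ?mulr_ge0 ?addr_ge0 // (le_trans h5) // exprMn ler_wpM2r ?sqr_ge0 //.
by nra.
Qed.

End convex_rV.

(** * Discrete Poincare inequalities *)

Section poincare.
Variables (R : realFieldType) (n : nat) (h T : R).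
Hypotheses (h_gt0 : 0 < h) (hT : h * n%:R = T).

Lemma sqr_sum_le k (d : nat -> R) : (\sum_(j < k) d j) ^+ 2 <= k%:R * \sum_(j < k) d j ^+ 2.
Proof.
rewrite expr2 big_distrlr /=.
apply: (le_trans (_ : _ <= \sum_(i < k) \sum_(j < k) (d i ^+ 2 / 2 + d j ^+ 2 / 2))).
  apply: ler_sum => i _; apply: ler_sum => j _.
  by have := sqr_ge0 (d i - d j); nra.
rewrite (eq_bigr (fun i : 'I_k => k%:R * (d i ^+ 2 / 2) + \sum_(j < k) d j ^+ 2 / 2)); last first.
  by move=> i _; rewrite big_split /= sumr_const card_ord mulr_natl.
rewrite big_split /= sumr_const card_ord -mulr_sumr -!mulr_suml -mulr_natl.
by rewrite le_eqVlt; apply/orP; left; apply/eqP; field.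
Qed.

Lemma sum_nat_le_half : h * \sum_(k < n) (h * k%:R) <= T ^+ 2 / 2.
Proof.
have H m : \sum_(k < m) (h * k%:R) <= h * m%:R ^+ 2 / 2.
  elim: m => [|m IH]; first by rewrite big_ord0 expr0n /= mulr0 mul0r.
  rewrite big_ord_recr /= -(natr1 m); apply: (le_trans (lerD IH (lexx _))).
  by have := ltW h_gt0; set x : R := m%:R; lra.
rewrite -hT; apply: (le_trans (_ : _ <= h * (h * n%:R ^+ 2 / 2))); first by rewrite ler_pM2l.
by rewrite le_eqVlt; apply/orP; left; apply/eqP; ring.
Qed.

Section forward.
Variables (p a : nat -> R).
Hypothesis p_step : forall k, (k < n)%N -> p k.+1 = p k + h * a k.

Lemma forward_sum k : (k <= n)%N -> p k = p 0%N + h * \sum_(j < k) a j.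
Proof.
elim: k => [|k IH] kn; first by rewrite big_ord0 mulr0 addr0.
by rewrite p_step // IH ?(ltnW kn) // big_ord_recr /=; ring.
Qed.

(** Cauchy-Schwarz, keeping the elapsed time [h * k%:R] instead of [T]: its sum over [k] then
    contributes [T^2 / 2] rather than [T^2]. *)
Lemma forward_dist k : (k <= n)%N ->
  (p k - p 0%N) ^+ 2 <= h * k%:R * (h * \sum_(j < n) a j ^+ 2).
Proof.
move=> kn; rewrite (forward_sum kn) [p 0%N + _]addrC addrK exprMn.
have H : \sum_(j < k) a j ^+ 2 <= \sum_(j < n) a j ^+ 2.
  rewrite -!(big_mkord xpredT (fun j => a j ^+ 2)).
  by rewrite (big_cat_nat (n := k) _ kn) //= lerDl sumr_ge0 // => j _; exact: sqr_ge0.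
rewrite (_ : _ * (h * _) = h ^+ 2 * (k%:R * \sum_(j < n) a j ^+ 2)); last by ring.
rewrite ler_wpM2l ?sqr_ge0 // (le_trans (sqr_sum_le k a)) // ler_wpM2l //.
Qed.

(** From [p_k^2 <= 8/5 p_0^2 + 8/3 (p_k - p_0)^2]. The weights keep both constants, 8/5 and 4/3,
    below 2; the margin later pays for Young's inequality in [energy_termwise]. *)
Lemma forward_poincare : h * \sum_(k < n) p k ^+ 2 <=
  8 / 5 * T * p 0%N ^+ 2 + 4 / 3 * T ^+ 2 * (h * \sum_(j < n) a j ^+ 2).
Proof.
set Sa := h * \sum_(j < n) a j ^+ 2.
have Sa0 : 0 <= Sa by rewrite mulr_ge0 ?(ltW h_gt0) // sumr_ge0 // => j _; exact: sqr_ge0.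
have H : \sum_(k < n) p k ^+ 2 <= \sum_(k < n) (8 / 5 * p 0%N ^+ 2 + 8 / 3 * Sa * (h * k%:R)).
  apply: ler_sum => k _; have := forward_dist (ltnW (ltn_ord k)); rewrite -/Sa.
  set x := p k; set y := p 0%N => h1.
  by have := sqr_ge0 (3 / 5 * y - (x - y)); nra.
rewrite -(ler_pM2l h_gt0) in H; apply: (le_trans H).
rewrite big_split /= sumr_const card_ord -mulr_sumr mulrDr.
have := sum_nat_le_half; set s := \sum_(k < n) _ => hs.
rewrite -[_ *+ n]mulr_natl.
have -> : h * (n%:R * (8 / 5 * p 0%N ^+ 2)) = 8 / 5 * T * p 0%N ^+ 2 by rewrite -hT; ring.
by rewrite lerD2l; have := ler_wpM2l Sa0 hs; lra.
Qed.
End forward.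

Section backward.
Variables (q b : nat -> R).
Hypothesis q_step : forall k, (k < n)%N -> q k = q k.+1 + h * b k.

Lemma backward_dist k : (k <= n)%N ->
  (q k - q n) ^+ 2 <= T * (h * \sum_(j < n) b j ^+ 2).
Proof.
move=> kn.
have := @forward_dist (fun j => q (n - j)%N) (fun j => b (n - j.+1)%N) _ (n - k)%N.
rewrite subKn // subn0 => H; apply: le_trans (H _ _) _; last 1 first.
- rewrite (reindex_inj rev_ord_inj) /=.
  under eq_bigr => j _ do rewrite subnSK // subKn ?(ltnW (ltn_ord j)) //.
  rewrite ler_wpM2r //.
    by rewrite mulr_ge0 ?(ltW h_gt0) // sumr_ge0 // => j _; exact: sqr_ge0.
  by rewrite -hT ler_pM2l // ler_nat leq_subr.
- by move=> j jn; rewrite (q_step (k := (n - j.+1)%N)) ?subnSK // leq_subr.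
- exact: leq_subr.
Qed.

Lemma backward_poincare : h * \sum_(k < n) q k.+1 ^+ 2 <=
  2 * T * q n ^+ 2 + 2 * T ^+ 2 * (h * \sum_(j < n) b j ^+ 2).
Proof.
set Sb := h * \sum_(j < n) b j ^+ 2.
have H : \sum_(k < n) q k.+1 ^+ 2 <= \sum_(k < n) (2 * q n ^+ 2 + 2 * T * Sb).
  apply: ler_sum => k _; have := backward_dist (ltn_ord k); rewrite -/Sb.
  set x := q k.+1; set y := q n => h1.
  by have := sqr_ge0 (y - (x - y)); nra.
rewrite -(ler_pM2l h_gt0) in H; apply: (le_trans H).
by rewrite sumr_const card_ord -[_ *+ n]mulr_natl -hT le_eqVlt; apply/orP; left; apply/eqP; ring.
Qed.

(** The converse estimate, of the end value by the mean square. It serves when the sum of the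
    [q_k^2] enters the energy with a favourable sign. *)
Lemma backward_poincare_end :
  T * q n ^+ 2 <= 2 * (h * \sum_(k < n) q k.+1 ^+ 2) + 2 * T ^+ 2 * (h * \sum_(j < n) b j ^+ 2).
Proof.
set Sb := h * \sum_(j < n) b j ^+ 2.
have H : \sum_(k < n) q n ^+ 2 <= \sum_(k < n) (2 * q k.+1 ^+ 2 + 2 * T * Sb).
  apply: ler_sum => k _; have := backward_dist (ltn_ord k); rewrite -/Sb.
  set x := q k.+1; set y := q n => h1.
  by have := sqr_ge0 (x + (x - y)); nra.
rewrite -(ler_pM2l h_gt0) in H.
rewrite (_ : T * _ = h * \sum_(k < n) q n ^+ 2); last first.
  by rewrite sumr_const card_ord -[_ *+ n]mulr_natl -hT; ring.
apply: (le_trans H).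
rewrite big_split /= sumr_const card_ord -[_ *+ n]mulr_natl -mulr_sumr mulrDr.
by rewrite -hT le_eqVlt; apply/orP; left; apply/eqP; ring.
Qed.
End backward.
End poincare.

(** * Coercivity of the discrete energy *)

Section energy.
Variable R : realFieldType.
Variables (T d1 d2 B : R).

(* The lower bound for the sum of all the monotonicity pairings of a discrete
   solution: the growth constants B, k1, k2 of H, psi1, psi2 bound the squared
   terms, and the last line is what remains after telescoping p_k q_k. *)
Definition energy (k1 k2 : R) (n : nat) (h : R) (p q a b : nat -> R) : R :=
  B * (h * \sum_(k < n) ((b k - d2 * p k) ^+ 2 + (a k - d1 * q k.+1) ^+ 2))
  + k1 * p 0%N ^+ 2 + k2 * q n ^+ 2
  + (- 2 * (h * \sum_(k < n) b k * p k)
     + d2 * (h * \sum_(k < n) p k ^+ 2) + d1 * (h * \sum_(k < n) q k.+1 ^+ 2)).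

(** A squared discrete W^{1,2} norm, with [p] measured at time 0 and [q] at time [T], the ends at
    which [psi1] and [psi2] act. *)
Definition energy_norm (n : nat) (h : R) (p q a b : nat -> R) : R :=
  p 0%N ^+ 2 + q n ^+ 2 + h * \sum_(k < n) a k ^+ 2 + h * \sum_(k < n) b k ^+ 2.

(* Young's inequality with weights 1/2 on the slopes and 5/6 on -2 b p; the
   latter leaves room in 5/3 < B. *)
Lemma energy_termwise (k1 k2 : R) n h (p q a b : nat -> R) : 0 < h -> 0 <= B ->
  B / 2 * (h * \sum_(k < n) a k ^+ 2) + (B / 2 - 5 / 6) * (h * \sum_(k < n) b k ^+ 2)
  - (B * d2 ^+ 2 + 6 / 5 - d2) * (h * \sum_(k < n) p k ^+ 2)
  - (B * d1 ^+ 2 - d1) * (h * \sum_(k < n) q k.+1 ^+ 2)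
  + k1 * p 0%N ^+ 2 + k2 * q n ^+ 2 <= energy k1 k2 n h p q a b.
Proof.
move=> h0 B0; rewrite /energy.
have H : \sum_(k < n) (B / 2 * a k ^+ 2 + (B / 2 - 5 / 6) * b k ^+ 2
     - (B * d2 ^+ 2 + 6 / 5) * p k ^+ 2 - B * d1 ^+ 2 * q k.+1 ^+ 2)
  <= \sum_(k < n) (B * ((b k - d2 * p k) ^+ 2 + (a k - d1 * q k.+1) ^+ 2) - 2 * (b k * p k)).
  apply: ler_sum => k _.
  set x := a k; set y := b k; set u := p k; set v := q k.+1.
  have e1 : 0 <= B * ((y / 2 - d2 * u) ^+ 2 * 2 + (x / 2 - d1 * v) ^+ 2 * 2).
    by rewrite mulr_ge0 // addr_ge0 // mulr_ge0 ?sqr_ge0.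
  have e2 := sqr_ge0 (5 / 6 * y - u).
  by nra.
rewrite -(ler_pM2l h0) in H.
move: H; rewrite !big_split /= !sumrN -!mulr_sumr !big_split /=; lra.
Qed.

Hypothesis T_gt0 : 0 < T.

(** The left-hand side is the squared norm of the unknowns of the fixed point problem, the end
    values and the slopes [u_k]. It is compared with the norm in which coercivity holds by
    [(x - y)^2 <= 2 x^2 + 2 y^2] and the Poincare inequalities. *)
Lemma energy_norm_control : exists2 K, 0 < K & forall n h (p q a b : nat -> R),
  0 < h -> h * n%:R = T ->
  (forall k, (k < n)%N -> p k.+1 = p k + h * a k) ->
  (forall k, (k < n)%N -> q k = q k.+1 + h * b k) ->
  p 0%N ^+ 2 + q n ^+ 2 +
    h * \sum_(k < n) ((b k - d2 * p k) ^+ 2 + (a k - d1 * q k.+1) ^+ 2)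
  <= K * energy_norm n h p q a b.
Proof.
have T0 := ltW T_gt0.
pose K := 3 + 2 * d2 ^+ 2 * (8 / 5 * T + 4 / 3 * T ^+ 2) + 2 * d1 ^+ 2 * (2 * T + 2 * T ^+ 2).
have X1 : 0 <= d2 ^+ 2 * T by rewrite mulr_ge0 // sqr_ge0.
have X2 : 0 <= d1 ^+ 2 * T by rewrite mulr_ge0 // sqr_ge0.
have X3 : 0 <= d2 ^+ 2 * T ^+ 2 by rewrite mulr_ge0 // sqr_ge0.
have X4 : 0 <= d1 ^+ 2 * T ^+ 2 by rewrite mulr_ge0 // sqr_ge0.
exists K; first by rewrite /K; lra.
move=> n h p q a b h0 hT ps qs.
have H : \sum_(k < n) ((b k - d2 * p k) ^+ 2 + (a k - d1 * q k.+1) ^+ 2) <=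
    \sum_(k < n) (2 * b k ^+ 2 + 2 * d2 ^+ 2 * p k ^+ 2 + 2 * a k ^+ 2 + 2 * d1 ^+ 2 * q k.+1 ^+ 2).
  apply: ler_sum => k _; have := sqr_ge0 (b k + d2 * p k).
  by have := sqr_ge0 (a k + d1 * q k.+1); lra.
rewrite -(ler_pM2l h0) in H; apply: (le_trans (lerD (lexx _) H)).
rewrite !big_split /= -!mulr_sumr.
have := ler_wpM2l (sqr_ge0 d2) (forward_poincare h0 hT ps).
have := ler_wpM2l (sqr_ge0 d1) (backward_poincare h0 hT qs).
have Sa0 : 0 <= h * \sum_(j < n) a j ^+ 2.
  by rewrite mulr_ge0 ?(ltW h0) // sumr_ge0 // => j _; exact: sqr_ge0.
have Sb0 : 0 <= h * \sum_(j < n) b j ^+ 2.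
  by rewrite mulr_ge0 ?(ltW h0) // sumr_ge0 // => j _; exact: sqr_ge0.
have p0 := sqr_ge0 (p 0%N); have q0 := sqr_ge0 (q n).
rewrite /energy_norm /K.
move: (p 0%N ^+ 2) p0 (q n ^+ 2) q0 => P p0 Q q0.
set sa := \sum_(j < n) a j ^+ 2 in Sa0 *; set sb := \sum_(j < n) b j ^+ 2 in Sb0 *.
have mono c : 0 <= c -> 0 <= c * P /\ 0 <= c * Q /\ 0 <= c * (h * sa) /\ 0 <= c * (h * sb).
  by move=> c0; do !split; exact: mulr_ge0.
have [? [? [? ?]]] := mono _ X1; have [? [? [? ?]]] := mono _ X2.
have [? [? [? ?]]] := mono _ X3; have [? [? [? ?]]] := mono _ X4.
by lra.
Qed.

Hypothesis B_gt : 5 / 3 < B.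
Hypothesis Hp : 2 * T ^+ 2 * (B * d2 ^+ 2 + 1 - d2) < B / 2.
Hypothesis Hq : 1 + 2 * T ^+ 2 * (B * d1 ^+ 2 - d1) < B / 2.

(* When B d1^2 - d1 < 0 the q-part of the energy is positive, so that psi2 may
   even decrease quadratically (k2 < 0); otherwise k2 is the growth rate of psi2. *)
Lemma energy_coercive k1 kappa :
    2 * T * (B * d2 ^+ 2 + 1 - d2) < k1 ->
    (0 <= B * d1 ^+ 2 - d1 -> 2 * T * (B * d1 ^+ 2 - d1) < kappa) ->
  exists k2 c : R, [/\ 0 < c, - (1 / 2) <= k2,
    (0 <= B * d1 ^+ 2 - d1 /\ k2 = kappa) \/ (B * d1 ^+ 2 - d1 < 0 /\ k2 < 0) &
    forall n h (p q a b : nat -> R), 0 < h -> h * n%:R = T ->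
      (forall k, (k < n)%N -> p k.+1 = p k + h * a k) ->
      (forall k, (k < n)%N -> q k = q k.+1 + h * b k) ->
      c * energy_norm n h p q a b <= energy k1 k2 n h p q a b].
Proof.
have hB := B_gt; set c2 := B * d2 ^+ 2 + 1 - d2; set c1 := B * d1 ^+ 2 - d1 => hk1 hk2.
(* 17/20 is the minimum of [5/3 x^2 + 1 - x], attained at [x = 3/10]. *)
have c2_ge : 17 / 20 <= c2.
  have : (5 / 3) * d2 ^+ 2 <= B * d2 ^+ 2 by rewrite ler_wpM2r ?sqr_ge0 // ltW.
  by have := sqr_ge0 (5 / 3 * d2 - 1 / 2); rewrite /c2; nra.
have T2 : 0 < T ^+ 2 by rewrite exprn_gt0.
have hpE : B * d2 ^+ 2 + 6 / 5 - d2 = c2 + 1 / 5 by rewrite /c2; field.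
(* The sum of the [p_k^2], with coefficient [c2 + 1/5], is removed by [forward_poincare]. The costs
   [8/5 (c2 + 1/5)] and [4/3 (c2 + 1/5)] are at most [2 c2] because [c2] is at least 4/5 and 2/5
   respectively. *)
have P_part n h (p q a b : nat -> R) (k2 : R) : 0 < h -> h * n%:R = T ->
    (forall k, (k < n)%N -> p k.+1 = p k + h * a k) ->
    (B / 2 - 2 * T ^+ 2 * c2) * (h * \sum_(k < n) a k ^+ 2) + (k1 - 2 * T * c2) * p 0%N ^+ 2
    + (B / 2 - 5 / 6) * (h * \sum_(k < n) b k ^+ 2)
    - c1 * (h * \sum_(k < n) q k.+1 ^+ 2) + k2 * q n ^+ 2 <= energy k1 k2 n h p q a b.
  move=> h0 hT ps; have B0 : 0 <= B by apply: ltW; apply: lt_trans B_gt; lra.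
  apply: le_trans (energy_termwise k1 k2 n p q a b h0 B0).
  have := forward_poincare h0 hT ps; rewrite hpE -/c1.
  have Sa0 : 0 <= h * \sum_(j < n) a j ^+ 2.
    by rewrite mulr_ge0 ?(ltW h0) // sumr_ge0 // => j _; exact: sqr_ge0.
  set Sa := h * \sum_(j < n) a j ^+ 2 in Sa0 *; set Sp := h * \sum_(k < n) p k ^+ 2.
  set p0 := p 0%N; move=> hSp.
  have e : 0 <= c2 + 1 / 5 by lra.
  have {}hSp := ler_wpM2l e hSp.
  have e1 : 0 <= T * p0 ^+ 2 * (c2 - 4 / 5).
    by apply: mulr_ge0; [apply: mulr_ge0; [exact: ltW|exact: sqr_ge0]|lra].
  have e2 : 0 <= T ^+ 2 * Sa * (c2 - 2 / 5).
    by apply: mulr_ge0; [apply: mulr_ge0; [exact: ltW|]|lra].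
  by lra.
have T0 := ltW T_gt0.
have Hp' : 2 * T ^+ 2 * c2 < B / 2 by [].
have Hq' : 1 + 2 * T ^+ 2 * c1 < B / 2 by [].
have [c1_ge0|c1_lt0] := leP 0 c1.
  have {}hk2 := hk2 c1_ge0.
  have kap0 : 0 < kappa by apply: le_lt_trans hk2; rewrite !mulr_ge0.
  pose c := Num.min (Num.min (B / 2 - 2 * T ^+ 2 * c2) (k1 - 2 * T * c2))
    (Num.min (B / 2 - 1 - 2 * T ^+ 2 * c1) (kappa - 2 * T * c1)).
  exists kappa, c; split.
  - by rewrite !lt_min; apply/andP; split; apply/andP; split; lra.
  - lra.
  - by left.
  move=> n h p q a b h0 hT ps qs.
  apply: le_trans (P_part n h p q a b kappa h0 hT ps).
  have := backward_poincare h0 hT qs.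
  have Sa0 : 0 <= h * \sum_(j < n) a j ^+ 2.
    by rewrite mulr_ge0 ?(ltW h0) // sumr_ge0 // => j _; exact: sqr_ge0.
  have Sb0 : 0 <= h * \sum_(j < n) b j ^+ 2.
    by rewrite mulr_ge0 ?(ltW h0) // sumr_ge0 // => j _; exact: sqr_ge0.
  rewrite /energy_norm.
  set Sa := h * \sum_(j < n) a j ^+ 2 in Sa0 *; set Sb := h * \sum_(j < n) b j ^+ 2 in Sb0 *.
  set Sq := h * \sum_(k < n) q k.+1 ^+ 2 => /(ler_wpM2l c1_ge0) hSq.
  have p0 := sqr_ge0 (p 0%N); have q0 := sqr_ge0 (q n).
  have m1 : c <= B / 2 - 2 * T ^+ 2 * c2 by rewrite /c !ge_min lexx.
  have m2 : c <= k1 - 2 * T * c2 by rewrite /c !ge_min lexx orbT.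
  have m3 : c <= B / 2 - 1 - 2 * T ^+ 2 * c1 by rewrite /c !ge_min lexx !orbT.
  have m4 : c <= kappa - 2 * T * c1 by rewrite /c !ge_min lexx !orbT.
  have := ler_wpM2r Sa0 m1; have := ler_wpM2r p0 m2.
  have := ler_wpM2r Sb0 m3; have := ler_wpM2r q0 m4.
  by lra.
(* Here [- c1] times the sum of the [q_k^2] is a gain. By [backward_poincare_end], the share [m] of
   it yields [m T q_n^2 / 2] at the cost of [m T^2] times the sum of the [b_k^2], for which half of
   the coefficient [B / 2 - 5/6] pays. Then [k2 = - m T / 4] takes one half of the gain in [q_n^2]
   and the other half remains. *)
pose m := Num.min (- c1) (Num.min (1 / T) ((B / 2 - 5 / 6) / (2 * T ^+ 2))).
have m0 : 0 < m.
  rewrite !lt_min oppr_gt0 c1_lt0 divr_gt0 //=; apply: divr_gt0; first lra.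
  by rewrite mulr_gt0.
have mc1 : m <= - c1 by rewrite /m ge_min lexx.
have mT : m * T <= 1 by rewrite -ler_pdivlMr // /m !ge_min lexx !orbT.
have mB : m * (2 * T ^+ 2) <= B / 2 - 5 / 6.
  by rewrite -ler_pdivlMr ?mulr_gt0 // /m !ge_min lexx !orbT.
have mT0 : 0 < m * T by rewrite mulr_gt0.
pose c := Num.min (Num.min (B / 2 - 2 * T ^+ 2 * c2) (k1 - 2 * T * c2))
    (Num.min ((B / 2 - 5 / 6) / 2) (m * T / 4)).
exists (- (m * T / 4)), c; split.
- by rewrite !lt_min; apply/andP; split; apply/andP; split; lra.
- lra.
- by right; split=> //; lra.
move=> n h p q a b h0 hT ps qs.
apply: le_trans (P_part n h p q a b _ h0 hT ps).
have := backward_poincare_end h0 hT qs.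
have Sa0 : 0 <= h * \sum_(j < n) a j ^+ 2.
  by rewrite mulr_ge0 ?(ltW h0) // sumr_ge0 // => j _; exact: sqr_ge0.
have Sb0 : 0 <= h * \sum_(j < n) b j ^+ 2.
  by rewrite mulr_ge0 ?(ltW h0) // sumr_ge0 // => j _; exact: sqr_ge0.
have Sq0 : 0 <= h * \sum_(k < n) q k.+1 ^+ 2.
  by rewrite mulr_ge0 ?(ltW h0) // sumr_ge0 // => j _; exact: sqr_ge0.
rewrite /energy_norm.
set Sa := h * \sum_(j < n) a j ^+ 2 in Sa0 *; set Sb := h * \sum_(j < n) b j ^+ 2 in Sb0 *.
set Sq := h * \sum_(k < n) q k.+1 ^+ 2 in Sq0 * => /(ler_wpM2l (ltW m0)) hSq.
have p0 := sqr_ge0 (p 0%N); have q0 := sqr_ge0 (q n).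
have m1 : c <= B / 2 - 2 * T ^+ 2 * c2 by rewrite /c !ge_min lexx.
have m2 : c <= k1 - 2 * T * c2 by rewrite /c !ge_min lexx orbT.
have m3 : c <= (B / 2 - 5 / 6) / 2 by rewrite /c !ge_min lexx !orbT.
have m4 : c <= m * T / 4 by rewrite /c !ge_min lexx !orbT.
have := ler_wpM2r Sa0 m1; have := ler_wpM2r p0 m2.
have := ler_wpM2r Sb0 m3; have := ler_wpM2r q0 m4.
have := ler_wpM2r Sq0 mc1; have := ler_wpM2r Sb0 mB.
by lra.
Qed.
End energy.

Lemma denominator_gt0 (R : realFieldType) (T d : R) : 0 < T -> `|d| < 1 / (2 * T) ->
  0 < Num.max (2 * T ^+ 2) 1 - 2 * d * T ^+ 2.
Proof.
move=> T0; rewrite ltr_pdivlMr ?mulr_gt0 // => hd.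
have h1 : 2 * T ^+ 2 <= Num.max (2 * T ^+ 2) 1 by rewrite le_max lexx.
have h2 : 1 <= Num.max (2 * T ^+ 2) 1 by rewrite le_max lexx orbT.
have h3 : d * (2 * T) < 1 by apply: le_lt_trans hd; rewrite ler_wpM2r ?ler_norm // mulr_ge0 // ltW.
have h4 : d * (2 * T) * T < T by rewrite -[ltRHS]mul1r ltr_pM2r.
have [T1|T1] := leP T 1; first by nra.
by nra.
Qed.

(** The first two bounds replace the maximum [M] by each of its entries. The third one means
    [5 / 3 < 1 / (2 beta)]: with [e = 2 T d], the convex combinations [M >= T^2 / 4 + 7/8] and
    [M >= T^2 / 2 + 3/4] give [M - e T >= 7/8 - e^2] and [M - e T >= 3/4 - e^2 / 2]. Both right-hand
    sides, times 6/5, equal [1 - e^2] at [e = 1/2], hence the case distinction. *)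
Lemma beta_conditions (R : realFieldType) (T d beta : R) : 0 < T -> 0 < beta ->
    `|d| < 1 / (2 * T) ->
    beta < 1 / 4 * ((1 - 4 * T ^+ 2 * `|d| ^+ 2) / (Num.max (2 * T ^+ 2) 1 - 2 * d * T ^+ 2)) ->
  [/\ 4 * beta * (2 * T ^+ 2 - 2 * d * T ^+ 2) < 1 - 4 * T ^+ 2 * d ^+ 2,
      4 * beta * (1 - 2 * d * T ^+ 2) < 1 - 4 * T ^+ 2 * d ^+ 2 &
      0 <= d -> 4 * beta < 6 / 5].
Proof.
move=> T0 b0 hd; have D0 := denominator_gt0 T0 hd.
have h1 : 2 * T ^+ 2 <= Num.max (2 * T ^+ 2) 1 by rewrite le_max lexx.
have h2 : 1 <= Num.max (2 * T ^+ 2) 1 by rewrite le_max lexx orbT.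
set M := Num.max _ _ in D0 h1 h2 *.
rewrite real_normK ?num_real // mulrA ltr_pdivlMr // => hb.
have {}hb : 4 * beta * (M - 2 * d * T ^+ 2) < 1 - 4 * T ^+ 2 * d ^+ 2 by lra.
split; [nra|nra|move=> d0].
pose e := 2 * T * d.
have e0 : 0 <= e by rewrite /e !mulr_ge0 // ltW.
have e1 : e < 1.
  by move: hd; rewrite ltr_pdivlMr ?mulr_gt0 // ger0_norm // /e; lra.
have {}hb : 4 * beta * (M - e * T) < 1 - e ^+ 2 by rewrite /e; lra.
have [e2|e2] := leP e (1 / 2).
  have X : 7 / 8 - e ^+ 2 <= M - e * T by have := sqr_ge0 (T / 2 - e); nra.
  have X0 : 0 < 7 / 8 - e ^+ 2 by nra.
  have : 4 * beta * (7 / 8 - e ^+ 2) < 6 / 5 * (7 / 8 - e ^+ 2).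
    apply: (le_lt_trans (_ : _ <= 4 * beta * (M - e * T))); first by rewrite ler_pM2l // mulr_gt0.
    by apply: (lt_le_trans hb); nra.
  by rewrite ltr_pM2r.
have X : 3 / 4 - e ^+ 2 / 2 <= M - e * T by have := sqr_ge0 (T - e); nra.
have X0 : 0 < 3 / 4 - e ^+ 2 / 2 by nra.
have : 4 * beta * (3 / 4 - e ^+ 2 / 2) < 6 / 5 * (3 / 4 - e ^+ 2 / 2).
  apply: (le_lt_trans (_ : _ <= 4 * beta * (M - e * T))); first by rewrite ler_pM2l // mulr_gt0.
  by apply: (lt_le_trans hb); nra.
by rewrite ltr_pM2r.
Qed.

(** * Lipschitz maps between normed spaces *)

Section lipschitz.
Variable R : realType.
Implicit Types V W : normedModType R.

Definition lip V W (f : V -> W) := exists2 L, 0 <= L & forall x y, `|f x - f y| <= L * `|x - y|.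

Lemma lip_continuous V W (f : V -> W) : lip f -> continuous f.
Proof. by move=> [L _ fL]; exact: lipschitz_continuous_dist fL. Qed.

Lemma lip_cst V W (c : W) : lip (fun _ : V => c).
Proof. by exists 0 => // x y; rewrite subrr normr0 mul0r. Qed.

Lemma lip_add V W (f g : V -> W) : lip f -> lip g -> lip (fun x => f x + g x).
Proof.
move=> [L L0 fL] [M M0 gM]; exists (L + M); first exact: addr_ge0.
move=> x y; rewrite opprD addrACA mulrDl; apply: (le_trans (ler_normD _ _)).
exact: lerD.
Qed.

Lemma lip_scale V W (f : V -> W) (c : R) : lip f -> lip (fun x => c *: f x).
Proof.
move=> [L L0 fL]; exists (`|c| * L); first exact: mulr_ge0.
by move=> x y; rewrite -scalerBr normrZ -mulrA ler_wpM2l.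
Qed.

Lemma lip_opp V W (f : V -> W) : lip f -> lip (fun x => - f x).
Proof. by move=> [L L0 fL]; exists L => // x y; rewrite -opprD normrN. Qed.

Lemma lip_sub V W (f g : V -> W) : lip f -> lip g -> lip (fun x => f x - g x).
Proof. by move=> lf lg; apply: lip_add => //; exact: lip_opp. Qed.

Lemma lip_comp V W (Z : normedModType R) (f : V -> W) (g : W -> Z) :
  lip f -> lip g -> lip (fun x => g (f x)).
Proof.
move=> [L L0 fL] [M M0 gM]; exists (M * L); first exact: mulr_ge0.
by move=> x y; apply: (le_trans (gM _ _)); rewrite -mulrA ler_wpM2l.
Qed.

Lemma lip_row m n (i : 'I_m) : lip (fun w : 'M[R]_(m, n) => row i w).
Proof.
exists 1 => // x y; rewrite mul1r -linearB /=.
by apply/mx_norm_leP => // j k; rewrite mxE coord_le_mx_norm.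
Qed.

Lemma lip_lsubmx m n1 n2 : lip (@lsubmx R m n1 n2).
Proof.
exists 1 => // x y; rewrite mul1r -linearB /=.
by apply/mx_norm_leP => // j k; rewrite mxE coord_le_mx_norm.
Qed.

Lemma lip_rsubmx m n1 n2 : lip (@rsubmx R m n1 n2).
Proof.
exists 1 => // x y; rewrite mul1r -linearB /=.
by apply/mx_norm_leP => // j k; rewrite mxE coord_le_mx_norm.
Qed.

Lemma lip_row_mx V m n1 n2 (f : V -> 'M[R]_(m, n1)) (g : V -> 'M[R]_(m, n2)) :
  lip f -> lip g -> lip (fun x => row_mx (f x) (g x)).
Proof.
move=> [L L0 fL] [M M0 gM]; exists (L + M); first exact: addr_ge0.
move=> x y; rewrite opp_row_mx add_row_mx mulrDl.
have h1 : 0 <= L * `|x - y| by rewrite mulr_ge0.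
have h2 : 0 <= M * `|x - y| by rewrite mulr_ge0.
apply/mx_norm_leP; first by rewrite addr_ge0.
move=> i j; rewrite mxE; case: splitP => k _.
  by rewrite (le_trans (coord_le_mx_norm _ _ _)) // (le_trans (fL x y)) // lerDl.
by rewrite (le_trans (coord_le_mx_norm _ _ _)) // (le_trans (gM x y)) // lerDr.
Qed.

Lemma lip_rows V m n (f : V -> 'M[R]_(m, n)) : (forall i, lip (fun x => row i (f x))) -> lip f.
Proof.
move=> H; have {}H i : exists L, 0 <= L /\ forall x y, `|row i (f x) - row i (f y)| <= L * `|x - y|.
  by have [L L0 LP] := H i; exists L.
have [L LP] := choice H.
have L0 : 0 <= \sum_i L i by apply: sumr_ge0 => i _; exact: (LP i).1.
exists (\sum_i L i) => // x y; apply/mx_norm_leP; first by rewrite mulr_ge0.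
move=> i j; have := coord_le_mx_norm (row i (f x) - row i (f y)) 0 j.
rewrite !mxE => h; apply: (le_trans h); apply: (le_trans ((LP i).2 x y)).
rewrite ler_wpM2r // (bigD1 i) //= lerDl.
by apply: sumr_ge0 => i' _; exact: (LP i').1.
Qed.
End lipschitz.

(** * Block vectors and the energy of vector-valued paths *)

Section dotv_block.
Variables (R : realType) (N : nat).

Lemma dotv_row_mx (a b c d : 'rV[R]_N) :
  dotv (row_mx a b) (row_mx c d) = dotv a c + dotv b d.
Proof.
rewrite /dotv big_split_ord /=; congr (_ + _); apply: eq_bigr => i _.
  by rewrite !row_mxEl.
by rewrite !row_mxEr.
Qed.

Lemma sub_row_mx m n1 n2 (a c : 'M[R]_(m, n1)) (b d : 'M[R]_(m, n2)) :
  row_mx a b - row_mx c d = row_mx (a - c) (b - d).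
Proof. by rewrite opp_row_mx add_row_mx. Qed.
End dotv_block.

Section energy_vector.
Variables (R : realType) (N : nat) (T d1 d2 B k1 k2 : R).
Variables (n : nat) (h : R) (p q a b : nat -> 'rV[R]_N).

Definition slope_sqr (k : nat) : R :=
  dotv (b k - d2 *: p k) (b k - d2 *: p k) + dotv (a k - d1 *: q k.+1) (a k - d1 *: q k.+1).

Let coord (f : nat -> 'rV[R]_N) i := fun k => f k 0 i.

(** The energy is a quadratic form that does not couple the coordinates, so the scalar estimates
    carry over by summation. *)
Lemma sum_coord_energy :
  \sum_i energy d1 d2 B k1 k2 n h (coord p i) (coord q i) (coord a i) (coord b i) =
  B * (h * \sum_(k < n) slope_sqr k) + k1 * dotv (p 0%N) (p 0%N) + k2 * dotv (q n) (q n)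
  + (- 2 * (h * \sum_(k < n) dotv (b k) (p k))
     + d2 * (h * \sum_(k < n) dotv (p k) (p k))
     + d1 * (h * \sum_(k < n) dotv (q k.+1) (q k.+1))).
Proof.
rewrite /energy !big_split /= -!mulr_sumr; congr (_ + _ + _ + (_ + _ + _)).
- congr (_ * (_ * _)); rewrite exchange_big /= -big_split; apply: eq_bigr => k _.
  by rewrite /dotv -big_split; apply: eq_bigr => i _; rewrite /coord !mxE !expr2.
- by congr (_ * (_ * _)); rewrite exchange_big; apply: eq_bigr => k _; apply: eq_bigr.
- congr (_ * (_ * _)); rewrite exchange_big /=; apply: eq_bigr => k _.
  by apply: eq_bigr => i _; rewrite expr2.
- congr (_ * (_ * _)); rewrite exchange_big /=; apply: eq_bigr => k _.
  by apply: eq_bigr => i _; rewrite expr2.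
Qed.

Lemma sum_coord_energy_norm :
  \sum_i energy_norm n h (coord p i) (coord q i) (coord a i) (coord b i) =
  dotv (p 0%N) (p 0%N) + dotv (q n) (q n) + h * \sum_(k < n) dotv (a k) (a k)
  + h * \sum_(k < n) dotv (b k) (b k).
Proof.
rewrite /energy_norm !big_split /= -!mulr_sumr; congr (_ + _ + _ + _).
- congr (_ * _); rewrite exchange_big /=; apply: eq_bigr => k _.
  by apply: eq_bigr => i _; rewrite expr2.
- congr (_ * _); rewrite exchange_big /=; apply: eq_bigr => k _.
  by apply: eq_bigr => i _; rewrite expr2.
Qed.

Hypothesis h_gt0 : 0 < h.
Hypothesis hT : h * n%:R = T.
Hypothesis p_step : forall k, (k < n)%N -> p k.+1 = p k + h *: a k.
Hypothesis q_step : forall k, (k < n)%N -> q k = q k.+1 + h *: b k.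

Let p_stepi i k : (k < n)%N -> coord p i k.+1 = coord p i k + h * coord a i k.
Proof. by move=> kn; rewrite /coord p_step // !mxE. Qed.

Let q_stepi i k : (k < n)%N -> coord q i k = coord q i k.+1 + h * coord b i k.
Proof. by move=> kn; rewrite /coord q_step // !mxE. Qed.

Definition path_sqr := dotv (p 0%N) (p 0%N) + dotv (q n) (q n) + h * \sum_(k < n) dotv (a k) (a k)
  + h * \sum_(k < n) dotv (b k) (b k).

Definition slope_total := dotv (p 0%N) (p 0%N) + dotv (q n) (q n) + h * \sum_(k < n) slope_sqr k.

Lemma slope_total_le K : 0 < K -> (forall n h (p q a b : nat -> R),
  0 < h -> h * n%:R = T ->
  (forall k, (k < n)%N -> p k.+1 = p k + h * a k) ->
  (forall k, (k < n)%N -> q k = q k.+1 + h * b k) ->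
  p 0%N ^+ 2 + q n ^+ 2 +
    h * \sum_(k < n) ((b k - d2 * p k) ^+ 2 + (a k - d1 * q k.+1) ^+ 2)
  <= K * energy_norm n h p q a b) -> slope_total <= K * path_sqr.
Proof.
move=> K0 KP; rewrite /path_sqr -sum_coord_energy_norm mulr_sumr.
have -> : slope_total = \sum_i (coord p i 0%N ^+ 2 + coord q i n ^+ 2 +
    h * \sum_(k < n) ((coord b i k - d2 * coord p i k) ^+ 2 + (coord a i k - d1 * coord q i k.+1) ^+ 2)).
  rewrite !big_split /= -mulr_sumr; congr (_ + _ + _ * _).
  rewrite [RHS]exchange_big /=; apply: eq_bigr => k _.
  by rewrite /slope_sqr /dotv -big_split; apply: eq_bigr => i _; rewrite /coord !mxE !expr2.
by apply: ler_sum => i _; apply: KP => // k kn; [exact: p_stepi|exact: q_stepi].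
Qed.

Lemma path_sqr_le c : (forall n h (p q a b : nat -> R), 0 < h -> h * n%:R = T ->
      (forall k, (k < n)%N -> p k.+1 = p k + h * a k) ->
      (forall k, (k < n)%N -> q k = q k.+1 + h * b k) ->
      c * energy_norm n h p q a b <= energy d1 d2 B k1 k2 n h p q a b) ->
  c * path_sqr <= B * (h * \sum_(k < n) slope_sqr k) + k1 * dotv (p 0%N) (p 0%N) + k2 * dotv (q n) (q n)
  + (- 2 * (h * \sum_(k < n) dotv (b k) (p k))
     + d2 * (h * \sum_(k < n) dotv (p k) (p k))
     + d1 * (h * \sum_(k < n) dotv (q k.+1) (q k.+1))).
Proof.
move=> cP; rewrite /path_sqr -sum_coord_energy_norm -sum_coord_energy mulr_sumr.
by apply: ler_sum => i _; apply: cP => // k kn; [exact: p_stepi|exact: q_stepi].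
Qed.

(** With [q] at index [k + 1] and [p] at index [k], the product rule [p_(k+1) . q_(k+1) - p_k . q_k
    = h (a_k . q_(k+1) - b_k . p_k)] has no error term. *)
Lemma telescope_dotv : dotv (p n) (q n) - dotv (p 0%N) (q 0%N) =
  h * \sum_(k < n) (dotv (a k) (q k.+1) - dotv (b k) (p k)).
Proof.
have H m : (m <= n)%N -> dotv (p m) (q m) - dotv (p 0%N) (q 0%N) =
    h * \sum_(k < m) (dotv (a k) (q k.+1) - dotv (b k) (p k)).
  elim: m => [|m IH] mn; first by rewrite big_ord0 mulr0 subrr.
  rewrite big_ord_recr /= mulrDr -IH ?(ltnW mn) // p_step // (q_step mn) !dotvE.
  by rewrite (dotvC (b m)); ring.
exact: H.
Qed.

(** In the sum of all pairings the boundary products cancel against the telescoped ones, and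
    coercivity, used with weight [theta], takes care of the rest. The share [1 - theta] carries the
    full [slope_total]; one half of it absorbs [k2 >= - 1/2], the other half is the gain. *)
Lemma a_priori theta c C0 C1 C2 : 0 <= theta <= 1 -> 0 <= B -> 0 <= k1 -> - (1 / 2) <= k2 ->
  c * path_sqr <= B * (h * \sum_(k < n) slope_sqr k) + k1 * dotv (p 0%N) (p 0%N) + k2 * dotv (q n) (q n)
  + (- 2 * (h * \sum_(k < n) dotv (b k) (p k))
     + d2 * (h * \sum_(k < n) dotv (p k) (p k))
     + d1 * (h * \sum_(k < n) dotv (q k.+1) (q k.+1))) ->
  (forall k, (k < n)%N -> B * slope_sqr k - C0 <=
     theta * (dotv (b k - d2 *: p k) (p k) + dotv (a k - d1 *: q k.+1) (q k.+1))
       - (1 - theta) * slope_sqr k) ->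
  k1 * dotv (p 0%N) (p 0%N) - C1 <= theta * dotv (q 0%N) (p 0%N) - (1 - theta) * dotv (p 0%N) (p 0%N) ->
  k2 * dotv (q n) (q n) - C2 <= - theta * dotv (p n) (q n) - (1 - theta) * dotv (q n) (q n) ->
  theta * (c * path_sqr) + (1 - theta) * (slope_total / 2) <= T * C0 + C1 + C2.
Proof.
move=> /andP[th0 th1] B0 k10 k2h hc hu h1 h2.
have hs : \sum_(k < n) (B * slope_sqr k - C0) <= \sum_(k < n) (theta * (dotv (b k - d2 *: p k) (p k) + dotv (a k - d1 *: q k.+1) (q k.+1))
       - (1 - theta) * slope_sqr k) by apply: ler_sum => k _; exact: hu.
rewrite -(ler_pM2l h_gt0) in hs.
have e : h * \sum_(k < n) (dotv (b k - d2 *: p k) (p k) + dotv (a k - d1 *: q k.+1) (q k.+1)) =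
   dotv (p n) (q n) - dotv (p 0%N) (q 0%N) + 2 * (h * \sum_(k < n) dotv (b k) (p k))
     - d2 * (h * \sum_(k < n) dotv (p k) (p k))
     - d1 * (h * \sum_(k < n) dotv (q k.+1) (q k.+1)).
  rewrite telescope_dotv.
  have -> : \sum_(k < n) (dotv (b k - d2 *: p k) (p k) + dotv (a k - d1 *: q k.+1) (q k.+1)) =
     \sum_(k < n) (dotv (a k) (q k.+1) - dotv (b k) (p k) + 2 * dotv (b k) (p k)
        - d2 * dotv (p k) (p k) - d1 * dotv (q k.+1) (q k.+1)).
    by apply: eq_bigr => k _; rewrite !dotvE; ring.
  by rewrite !big_split /= !sumrN -!mulr_sumr; ring.
move: hs; rewrite sumrB sumr_const card_ord sumrB -!mulr_sumr.
rewrite (mulrBr h (theta * _)) (mulrCA h theta) e.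
rewrite -[C0 *+ n]mulr_natl mulrBr [h * (n%:R * C0)]mulrA hT.
have U0 : 0 <= h * \sum_(k < n) slope_sqr k.
  rewrite mulr_ge0 ?(ltW h_gt0) // sumr_ge0 // => k _.
  by rewrite /slope_sqr addr_ge0 // dotv_ge0.
have P0 := dotv_ge0 (p 0%N); have Q0 := dotv_ge0 (q n).
move: hc h1 h2; rewrite /slope_total (dotvC (q 0%N)) (mulrCA h B) (mulrCA h (1 - theta)).
set V := c * path_sqr.
set U := h * \sum_(k < n) slope_sqr k in U0 *.
set P := dotv (p 0%N) (p 0%N) in P0 *; set Q := dotv (q n) (q n) in Q0 *.
set X := h * \sum_(k < n) dotv (b k) (p k).
set Y := h * \sum_(k < n) dotv (p k) (p k); set Z := h * \sum_(k < n) dotv (q k.+1) (q k.+1).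
set pq := dotv (p n) (q n); set pq0 := dotv (p 0%N) (q 0%N).
move=> hc h1 h2 h3.
have hc' := ler_wpM2l th0 hc.
have th1' : 0 <= 1 - theta by rewrite subr_ge0.
have e1 : 0 <= (1 - theta) * (B * U + k1 * P + (k2 + 1 / 2) * Q + (P + Q + U) / 2 - (P + Q + U) / 2 + P / 2 + U / 2).
  rewrite mulr_ge0 //.
  have : 0 <= B * U by rewrite mulr_ge0.
  have : 0 <= k1 * P by rewrite mulr_ge0.
  have : 0 <= (k2 + 1 / 2) * Q by rewrite mulr_ge0 //; lra.
  lra.
by lra.
Qed.
End energy_vector.

(** * The implicit Euler scheme *)

Section flow.
Variables (R : realType) (N : nat) (d1 d2 h : R).

(** Once the slopes [u k] are taken as unknowns the scheme is explicit, and [p] and [q] depend on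
    them in a Lipschitz way. *)
Fixpoint flow (u : nat -> 'rV[R]_(N + N)) (p0 q0 : 'rV[R]_N) (k : nat) : 'rV[R]_N * 'rV[R]_N :=
  if k is k'.+1 then
    let z := flow u p0 q0 k' in
    let q := z.2 - h *: (lsubmx (u k') + d2 *: z.1) in
    (z.1 + h *: (rsubmx (u k') + d1 *: q), q)
  else (p0, q0).

(* The flow is affine in q0 and flow0 is its linear part; flow0_bound makes it
   possible to prescribe the final value q_n instead of q0. *)
Fixpoint flow0 (k : nat) : R * R :=
  if k is k'.+1 then
    let z := flow0 k' in
    let q := z.2 - h * (d2 * z.1) in (z.1 + h * (d1 * q), q)
  else (0, 1).

Lemma flow_linear u p0 q0 k : flow u p0 q0 k =
  ((flow u p0 0 k).1 + (flow0 k).1 *: q0, (flow u p0 0 k).2 + (flow0 k).2 *: q0).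
Proof.
elim: k => [|k IH] /=; first by rewrite scale0r scale1r addr0 add0r.
by rewrite IH /=; congr (_, _); apply/rowP => i; rewrite !mxE; ring.
Qed.

(** Here [|d1|] and [|d2|] below [1 / (2 T)] keep the linear part near the identity: by induction
    the first component stays below 3/4 in absolute value and the second one within 3/8 of 1. *)
Lemma flow0_bound T n : 0 < h -> h * n%:R = T -> `|d1| < 1 / (2 * T) -> `|d2| < 1 / (2 * T) ->
  1 / 2 <= (flow0 n).2.
Proof.
move=> h0 hT hd1 hd2.
case: n hT => [|n'] hT; first by rewrite /=; lra.
set n := n'.+1 in hT *.
have T0 : 0 < T by rewrite -hT mulr_gt0 // ltr0n.
rewrite ltr_pdivlMr ?mulr_gt0 // in hd1; rewrite ltr_pdivlMr ?mulr_gt0 // in hd2.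
have a1 := normr_ge0 d1; have a2 := normr_ge0 d2.
have H k : (k <= n)%N -> `|(flow0 k).1| <= 3 / 2 * `|d1| * (h * k%:R) /\
    `|(flow0 k).2 - 1| <= 3 / 4 * `|d2| * (h * k%:R).
  elim: k => [|k IH] kn; first by rewrite /= subrr !normr0 !mulr0.
  have [h1 h2] := IH (ltnW kn).
  have kT : h * k.+1%:R <= T by rewrite -hT ler_pM2l // ler_nat.
  have kT' : h * k%:R <= T by rewrite -hT ler_pM2l // ler_nat ltnW.
  have k0 : 0 <= h * k%:R by rewrite mulr_ge0 // ltW.
  have e : h * k.+1%:R = h * k%:R + h by rewrite -natr1 mulrDr mulr1.
  have b1 : `|d1| * (h * k%:R) <= 1 / 2.
    by have := ler_wpM2l a1 kT'; lra.
  have b2 : `|d2| * (h * k.+1%:R) <= 1 / 2.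
    by have := ler_wpM2l a2 kT; lra.
  have h3 : `|(flow0 k.+1).2 - 1| <= 3 / 4 * `|d2| * (h * k.+1%:R).
    rewrite /= addrAC (le_trans (ler_normB _ _)) // !normrM (gtr0_norm h0).
    have : h * (`|d2| * `|(flow0 k).1|) <= h * (`|d2| * (3 / 4)).
      by rewrite ler_pM2l // ler_wpM2l //; lra.
    by rewrite e; lra.
  split=> //; rewrite /= in h3 *.
  set q := (flow0 k).2 - _ in h3 *.
  have h4 : `|q| <= 3 / 2.
    have := ler_normD (q - 1) 1; rewrite subrK normr1.
    by lra.
  rewrite (le_trans (ler_normD _ _)) // !normrM (gtr0_norm h0).
  have : h * (`|d1| * `|q|) <= h * (`|d1| * (3 / 2)) by rewrite ler_pM2l // ler_wpM2l.
  by rewrite e; lra.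
have [_] := H n (leqnn n); rewrite hT ler_norml => /andP[h1 _].
by lra.
Qed.

Lemma lip_flow (V : normedModType R) (u : V -> nat -> 'rV[R]_(N + N)) (p0 q0 : V -> 'rV[R]_N) k :
  (forall k, lip (fun w => u w k)) -> lip p0 -> lip q0 ->
  lip (fun w => (flow (u w) (p0 w) (q0 w) k).1) /\ lip (fun w => (flow (u w) (p0 w) (q0 w) k).2).
Proof.
move=> lu lp lq; elim: k => [//|k [IH1 IH2]].
have l2 : lip (fun w => (flow (u w) (p0 w) (q0 w) k.+1).2).
  apply: lip_sub => //; apply: lip_scale; apply: lip_add; last exact: lip_scale.
  by apply: (lip_comp (lu k)); exact: lip_lsubmx.
split=> //; apply: lip_add => //; apply: lip_scale; apply: lip_add; last exact: lip_scale.
by apply: (lip_comp (lu k)); exact: lip_rsubmx.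
Qed.

End flow.

Section discrete.
Variables (R : realType) (N : nat) (T d1 d2 B k1 k2 C0 C1 C2 : R).
Variables (Hr : 'rV[R]_(N + N) -> R) (psi1 psi2 : 'rV[R]_N -> R).
Hypotheses (T_gt0 : 0 < T) (B_ge0 : 0 <= B) (k1_ge0 : 0 <= k1) (k2_ge : - (1 / 2) <= k2).
Hypotheses (hd1 : `|d1| < 1 / (2 * T)) (hd2 : `|d2| < 1 / (2 * T)).
Hypotheses (Hr_convex : convex_real Hr).
Hypotheses (psi1_convex : convex_real psi1) (psi2_convex : convex_real psi2).
Hypothesis Hr_growth : forall z u, subdiff Hr z u -> B * dotv u u - C0 <= dotv u z.
Hypothesis psi1_growth : forall y, k1 * dotv y y - C1 <= psi1 y - psi1 0.
Hypothesis psi2_growth : forall y, k2 * dotv y y - C2 <= psi2 y - psi2 0.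
Variable c : R.
Hypothesis c_gt0 : 0 < c.
Hypothesis coercive : forall n h (p q a b : nat -> R), 0 < h -> h * n%:R = T ->
      (forall k, (k < n)%N -> p k.+1 = p k + h * a k) ->
      (forall k, (k < n)%N -> q k = q k.+1 + h * b k) ->
      c * energy_norm n h p q a b <= energy d1 d2 B k1 k2 n h p q a b.

Let growth_pairing F k (CF : R) (x y : 'rV[R]_N) :
  (forall y, k * dotv y y - CF <= F y - F 0) -> subdiff F x y -> k * dotv x x - CF <= dotv y x.
Proof.
by move=> hF /(_ 0) h; have := hF x; move: h; rewrite sub0r dotvNr; lra.
Qed.

Let C := T * C0 + C1 + C2.

Section fixed_step.
Variables (n : nat) (h : R).
Hypotheses (h_gt0 : 0 < h) (hT : h * n%:R = T).

(* The bound along the homotopy theta, where the inclusions for theta are those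
   met by the zeros of G + mu id in discrete_solution_exists, theta = 1/(1 + mu). *)
Lemma discrete_a_priori theta (p q a b : nat -> 'rV[R]_N) : 0 <= theta <= 1 ->
  (forall k, (k < n)%N -> p k.+1 = p k + h *: a k) ->
  (forall k, (k < n)%N -> q k = q k.+1 + h *: b k) ->
  (forall k, (k < n)%N ->
     subdiff Hr (theta *: row_mx (p k) (q k.+1)
        - (1 - theta) *: row_mx (b k - d2 *: p k) (a k - d1 *: q k.+1))
       (row_mx (b k - d2 *: p k) (a k - d1 *: q k.+1))) ->
  subdiff psi1 (p 0%N) (theta *: q 0%N - (1 - theta) *: p 0%N) ->
  subdiff psi2 (q n) (- theta *: p n - (1 - theta) *: q n) ->
  theta * (c * path_sqr n h p q a b) + (1 - theta) * (slope_total d1 d2 n h p q a b / 2) <= C.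
Proof.
move=> th ps qs hu h1 h2.
apply: (@a_priori _ _ T d1 d2 B k1 k2) => //.
- exact: (path_sqr_le h_gt0 hT ps qs coercive).
- move=> k kn; have hg := Hr_growth (hu k kn).
  by rewrite dotvBr !dotvZr !dotv_row_mx in hg.
- by have hg := growth_pairing psi1_growth h1; rewrite dotvBl !dotvZl in hg.
- by have hg := growth_pairing psi2_growth h2; rewrite dotvBl !dotvZl in hg.
Qed.

(* The unknown is a matrix w: row 0 is (p_0, q_n) and row k+1 is the slope u_k
   in the k-th inclusion. An inclusion y in dF(x) is equivalent to
   x = prox_F (x + y), so that the system becomes G w = 0 with G continuous. *)
Lemma discrete_solution_exists : exists p q a b : nat -> 'rV[R]_N,
  [/\ forall k, (k < n)%N -> p k.+1 = p k + h *: a k,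
      forall k, (k < n)%N -> q k = q k.+1 + h *: b k,
      forall k, (k < n)%N -> subdiff Hr (row_mx (p k) (q k.+1))
         (row_mx (b k - d2 *: p k) (a k - d1 *: q k.+1)),
      subdiff psi1 (p 0%N) (q 0%N) & subdiff psi2 (q n) (- p n)].
Proof.
(* Both boundary conditions become one inclusion for the pair [(p_0, q_n)], hence a single proximal
   map. *)
pose Psi (z : 'rV[R]_(N + N)) := psi1 (lsubmx z) + psi2 (rsubmx z).
have Psi_convex : convex_real Psi.
  move=> x y t t01; rewrite /Psi !linearD /= !linearZ /=.
  have := psi1_convex (lsubmx x) (lsubmx y) t01.
  by have := psi2_convex (rsubmx x) (rsubmx y) t01; lra.
have PsiP z x y : subdiff Psi z (row_mx x y) -> subdiff psi1 (lsubmx z) x /\ subdiff psi2 (rsubmx z) y.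
  move=> hz; split=> v.
    have := hz (row_mx v (rsubmx z)); rewrite /Psi row_mxKl row_mxKr.
    by rewrite -[X in dotv _ (_ - X)]hsubmxK sub_row_mx dotv_row_mx subrr (dotvC y) dotv0l; lra.
  have := hz (row_mx (lsubmx z) v); rewrite /Psi row_mxKl row_mxKr.
  by rewrite -[X in dotv _ (_ - X)]hsubmxK sub_row_mx dotv_row_mx subrr (dotvC x) dotv0l; lra.
have [P0 P0P] := choice (proximal_exists Psi_convex).
have [PH PHP] := choice (proximal_exists Hr_convex).
have lipP0 : lip P0.
  by exists ((N + N)%:R + 1) => [|x y]; [rewrite addr_ge0|exact: proximal_nonexpansive].
have lipPH : lip PH.
  by exists ((N + N)%:R + 1) => [|x y]; [rewrite addr_ge0|exact: proximal_nonexpansive].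
pose al := (flow0 d1 d2 h n).2.
have al0 : al != 0.
  by rewrite gt_eqF // (lt_le_trans _ (flow0_bound h_gt0 hT hd1 hd2)) // divr_gt0.
pose u (w : 'M[R]_(n.+1, N + N)) k : 'rV[R]_(N + N) := row (inord k.+1) w.
pose p0 (w : 'M[R]_(n.+1, N + N)) := lsubmx (row ord0 w).
pose y0 (w : 'M[R]_(n.+1, N + N)) := rsubmx (row ord0 w).
pose q0 w := al^-1 *: (y0 w - (flow d1 d2 h (u w) (p0 w) 0 n).2).
pose p w k := (flow d1 d2 h (u w) (p0 w) (q0 w) k).1.
pose q w k := (flow d1 d2 h (u w) (p0 w) (q0 w) k).2.
have qn w : q w n = y0 w.
  by rewrite /q flow_linear /= -/al /q0 scalerA mulfV // scale1r addrC subrK.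
have lipu k : lip (fun w => u w k) by exact: lip_row.
have lipp0 : lip p0 by exact: (lip_comp (@lip_row R _ _ ord0) (@lip_lsubmx R _ _ _)).
have lipy0 : lip y0 by exact: (lip_comp (@lip_row R _ _ ord0) (@lip_rsubmx R _ _ _)).
have lipq0 : lip q0.
  apply: lip_scale; apply: lip_sub => //.
  exact: (lip_flow d1 d2 h n lipu lipp0 (lip_cst _ _)).2.
have lipp k : lip (fun w => p w k) by exact: (lip_flow d1 d2 h k lipu lipp0 lipq0).1.
have lipq k : lip (fun w => q w k) by exact: (lip_flow d1 d2 h k lipu lipp0 lipq0).2.
pose z w k := row_mx (p w k) (q w k.+1).
have lipz k : lip (fun w => z w k) by exact: lip_row_mx.
pose Gr w (i : nat) : 'rV[R]_(N + N) :=
  if i is k.+1 then PH (u w k + z w k) - z w k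
  else row ord0 w - P0 (row ord0 w + row_mx (q0 w) (- p w n)).
pose G w : 'M[R]_(n.+1, N + N) := \matrix_(i, j) Gr w i 0 j.
have GrE w (i : 'I_n.+1) : row i (G w) = Gr w i by apply/rowP => j; rewrite !mxE.
have Gc : continuous G.
  apply: lip_continuous; apply: lip_rows => i; under eq_fun do rewrite GrE.
  rewrite /Gr; case: (nat_of_ord i) => [|k].
    apply: lip_sub; first exact: lip_row.
    apply: (lip_comp _ lipP0); apply: lip_add; first exact: lip_row.
    by apply: lip_row_mx => //; exact: lip_opp.
  by apply: lip_sub => //; apply: (lip_comp _ lipPH); exact: lip_add.
pose a w k := rsubmx (u w k) + d1 *: q w k.+1.
pose b w k := lsubmx (u w k) + d2 *: p w k.
have ps w k : p w k.+1 = p w k + h *: a w k by [].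
have qs w k : q w k = q w k.+1 + h *: b w k by rewrite /q /= subrK.
have uE w k : row_mx (b w k - d2 *: p w k) (a w k - d1 *: q w k.+1) = u w k.
  by rewrite /a /b !addrK hsubmxK.
have [K K0 KP] := energy_norm_control d1 d2 T_gt0.
(* On the sphere of radius [r] the a priori bound would give [m * (l * r^2) <= m * W <= C], and [r]
   is chosen to contradict this. The radius may depend on the step through [l]; the bound [C] does
   not. *)
pose m := Num.min (c / K) (1 / 2).
have m0 : 0 < m by rewrite lt_min !divr_gt0.
pose l := Num.min 1 h.
have l0 : 0 < l by rewrite lt_min ltr01.
have ml0 : 0 < m * l by rewrite mulr_gt0.
pose r := 1 + `|C| / (m * l).
have r1 : 1 <= r by rewrite lerDl divr_ge0 // ltW.
have r0 : 0 < r by rewrite (lt_le_trans ltr01).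
have [w mu wr mu0 Gw|w _ Gw] := brouwer_zero r0 Gc.
  (* From [G w = - mu w] the proximal identity reads [la u_k] in the subdifferential of [Hr] at
     [z_k - mu u_k]. Multiplying the path by [la] brings this to the form treated by
     [discrete_a_priori], with [theta = 1 / la]. *)
  pose la := 1 + mu; pose th := la^-1.
  have la1 : 1 <= la by rewrite lerDl ltW.
  have la0 : 0 < la by rewrite (lt_le_trans ltr01).
  have th1 : 0 <= th <= 1 by rewrite invr_ge0 ltW //= invf_le1.
  have thla : th * la = 1 by rewrite mulVf // gt_eqF.
  have thmu : (1 - th) * la = mu by rewrite mulrBl thla /la; ring.
  have rowG i : Gr w (nat_of_ord i) = - mu *: row i w by rewrite -GrE Gw linearZ.
  pose p' k := la *: p w k; pose q' k := la *: q w k.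
  pose a' k := la *: a w k; pose b' k := la *: b w k.
  have uE' k : row_mx (b' k - d2 *: p' k) (a' k - d1 *: q' k.+1) = la *: u w k.
    rewrite -uE scale_row_mx /b' /a' /p' /q' !scalerBr !scalerA.
    by rewrite (mulrC d2) (mulrC d1).
  have hH k : (k < n)%N -> subdiff Hr (th *: row_mx (p' k) (q' k.+1)
      - (1 - th) *: row_mx (b' k - d2 *: p' k) (a' k - d1 *: q' k.+1))
      (row_mx (b' k - d2 *: p' k) (a' k - d1 *: q' k.+1)).
    move=> kn; have := rowG (inord k.+1); rewrite inordK // => e.
    have {}e : PH (u w k + z w k) = z w k - mu *: u w k.
      by rewrite -[LHS](subrK (z w k)) -/(Gr w k.+1) e scaleNr addrC.
    have := PHP (u w k + z w k); rewrite e uE' -scale_row_mx !scalerA thla thmu scale1r.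
    rewrite (_ : u w k + z w k - _ = la *: u w k) //.
    by apply/rowP => j; rewrite !mxE /la; ring.
  have [hp1 hp2] : subdiff psi1 (p' 0%N) (th *: q' 0%N - (1 - th) *: p' 0%N) /\
      subdiff psi2 (q' n) (- th *: p' n - (1 - th) *: q' n).
    have e : P0 (row ord0 w + row_mx (q0 w) (- p w n)) = la *: row ord0 w.
      have := rowG ord0; rewrite /= => e; rewrite -[LHS](subKr (row ord0 w)) e.
      by rewrite scaleNr opprK /la scalerDl scale1r.
    have := P0P (row ord0 w + row_mx (q0 w) (- p w n)); rewrite e => hP.
    have e2 : row ord0 w + row_mx (q0 w) (- p w n) - la *: row ord0 w =
        row_mx (q w 0%N - mu *: p0 w) (- p w n - mu *: y0 w).
      rewrite -sub_row_mx -scale_row_mx hsubmxK /la scalerDl scale1r opprD.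
      by rewrite addrACA [row_mx _ _ - _]addrC addrA subrr add0r addrC.
    have s1 (x : 'rV[R]_N) : th *: (la *: x) = x by rewrite scalerA thla scale1r.
    have s2 (x : 'rV[R]_N) : (1 - th) *: (la *: x) = mu *: x by rewrite scalerA thmu.
    have l1 : lsubmx (la *: row ord0 w) = la *: p0 w by rewrite linearZ.
    have l2 : rsubmx (la *: row ord0 w) = la *: q w n by rewrite qn linearZ.
    rewrite e2 in hP; have [] := PsiP _ _ _ hP; rewrite l1 l2 -qn.
    by rewrite /p' /q' scaleNr !s1 !s2 => h1 h2; split.
  have ps' k : (k < n)%N -> p' k.+1 = p' k + h *: a' k.
    by move=> _; rewrite /p' ps scalerDr /a' !scalerA mulrC.
  have qs' k : (k < n)%N -> q' k = q' k.+1 + h *: b' k.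
    by move=> _; rewrite {1}/q' qs scalerDr /b' !scalerA mulrC.
  have hV := discrete_a_priori th1 ps' qs' hH hp1 hp2.
  have hW := slope_total_le h_gt0 hT ps' qs' K0 KP.
  set V := path_sqr _ _ _ _ _ _ in hV hW; set W := slope_total _ _ _ _ _ _ _ _ in hV hW.
  have WE : W = la ^+ 2 * (dotv (row ord0 w) (row ord0 w) + h * \sum_(k < n) dotv (u w k) (u w k)).
    have e0 : dotv (row ord0 w) (row ord0 w) = dotv (p w 0%N) (p w 0%N) + dotv (q w n) (q w n).
      by rewrite -[row ord0 w]hsubmxK dotv_row_mx qn.
    have eu : \sum_(k < n) slope_sqr d1 d2 p' q' a' b' k = la ^+ 2 * \sum_(k < n) dotv (u w k) (u w k).
      rewrite mulr_sumr; apply: eq_bigr => k _.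
      by rewrite /slope_sqr -dotv_row_mx uE' dotvZl dotvZr mulrA -expr2.
    by rewrite /W /slope_total eu e0 /p' /q' !dotvZl !dotvZr; ring.
  (* In [W] row 0 has weight 1 and the other rows have weight [h], up to the factor [la^2 >= 1];
     hence [l = min 1 h], and some row has the norm [r] of [w]. *)
  have W_ge : l * r ^+ 2 <= W.
    have l1 : l <= 1 by rewrite ge_min lexx.
    have lh : l <= h by rewrite ge_min lexx orbT.
    have D0 := dotv_ge0 (row ord0 w).
    have S0 : 0 <= \sum_(k < n) dotv (u w k) (u w k) by apply: sumr_ge0 => k _; exact: dotv_ge0.
    have rows (i : 'I_n.+1) : l * `|row i w| ^+ 2 <= W.
      apply: (le_trans (ler_wpM2l (ltW l0) (sqr_norm_le_dotv _))); rewrite WE.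
      have la2 : 1 <= la ^+ 2 by rewrite exprn_ege1.
      set X := _ + _; have X0 : 0 <= X by rewrite addr_ge0 // mulr_ge0 // ltW.
      apply: le_trans (_ : X <= _); last by rewrite ler_peMl.
      have [->|i0] := eqVneq i ord0.
        apply: le_trans (_ : dotv (row ord0 w) (row ord0 w) <= _); first by rewrite ler_piMl.
        by rewrite /X lerDl mulr_ge0 // ltW.
      have i1 : (i.-1 < n)%N by rewrite -ltnS prednK ?lt0n.
      have -> : row i w = u w (Ordinal i1).
        by congr row; apply: val_inj; rewrite /= inordK prednK ?lt0n.
      apply: le_trans (ler_wpM2r (dotv_ge0 _) lh) _; rewrite /X.
      have : h * dotv (u w (Ordinal i1)) (u w (Ordinal i1)) <= h * \sum_(k < n) dotv (u w k) (u w k).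
        rewrite ler_pM2l // (bigD1 (Ordinal i1)) //= lerDl.
        by apply: sumr_ge0 => k _; exact: dotv_ge0.
      by move=> /le_trans; apply; rewrite lerDr.
    have W0 : 0 <= W by apply: le_trans (rows ord0); rewrite mulr_ge0 ?sqr_ge0 // ltW.
    have hr : r <= Num.sqrt (W / l).
      rewrite -wr; apply/mx_norm_leP; first exact: sqrtr_ge0.
      move=> i j; have := coord_le_mx_norm (row i w) 0 j; rewrite mxE => /le_trans; apply.
      rewrite -ler_sqr ?nnegrE ?sqrtr_ge0 // sqr_sqrtr ?divr_ge0 // ?(ltW l0) //.
      by rewrite ler_pdivlMr // mulrC.
    rewrite -ler_sqr ?nnegrE ?sqrtr_ge0 ?(ltW r0) // sqr_sqrtr ?divr_ge0 // ?(ltW l0) // in hr.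
    by rewrite ler_pdivlMr // mulrC in hr.
  have W0 : 0 <= W by apply: le_trans W_ge; rewrite mulr_ge0 ?sqr_ge0 // ltW.
  have mW : m * W <= C.
    apply: le_trans hV; have /andP[th0 th1'] := th1.
    have e1 : m * W <= c * V.
      have m1 : m <= c / K by rewrite ge_min lexx.
      apply: le_trans (ler_wpM2r W0 m1) _.
      have := ler_wpM2l (ltW (divr_gt0 c_gt0 K0)) hW.
      by rewrite [c / K * (K * V)]mulrA divfK // gt_eqF.
    have e2 : m * W <= W / 2.
      have m1 : m <= 1 / 2 by rewrite ge_min lexx orbT.
      by have := ler_wpM2r W0 m1; lra.
    have th2 : 0 <= 1 - th by rewrite subr_ge0.
    by have := ler_wpM2l th0 e1; have := ler_wpM2l th2 e2; lra.
  have : C < m * W.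
    apply: lt_le_trans (_ : m * (l * r ^+ 2) <= _); last by rewrite ler_pM2l.
    rewrite mulrA; apply: lt_le_trans (_ : m * l * r <= _); last first.
      by rewrite ler_pM2l // expr2 ler_peMr // ltW.
    rewrite /r mulrDr mulr1 [m * l * (_ / _)]mulrC divfK ?gt_eqF //.
    by have := ler_norm C; lra.
  by rewrite ltNge mW.
have hH k : (k < n)%N -> subdiff Hr (row_mx (p w k) (q w k.+1)) (u w k).
  move=> kn; have := GrE w (inord k.+1); rewrite Gw linear0 inordK //= => /esym e.
  have := PHP (u w k + z w k); rewrite -[PH _](subrK (z w k)) e add0r addrK.
  by [].
have hP : subdiff Psi (row ord0 w) (row_mx (q w 0%N) (- p w n)).
  have e : row ord0 w = P0 (row ord0 w + row_mx (q0 w) (- p w n)).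
    by have := GrE w ord0; rewrite Gw linear0 /= => /esym/eqP; rewrite subr_eq0 => /eqP.
  have := P0P (row ord0 w + row_mx (q0 w) (- p w n)); rewrite -e.
  by rewrite addrAC subrr add0r.
exists (p w), (q w), (a w), (b w); split => //.
- by move=> k kn; rewrite uE; exact: hH.
- exact: (PsiP _ _ _ hP).1.
- by rewrite qn; exact: (PsiP _ _ _ hP).2.
Qed.

End fixed_step.

(** For [theta = 1] the estimate bounds [path_sqr] by [|C| / c], free of [n]. Every node then
    follows from [p_0], respectively [q_n], by [|x + y|^2 <= 2 |x|^2 + 2 |y|^2] and
    Cauchy-Schwarz. *)
Lemma discrete_solution_bounded : exists C5, forall n, (0 < n)%N -> exists p q : nat -> 'rV[R]_N,
  let h := T / n%:R in
  [/\ forall k, (k < n)%N -> subdiff Hr (row_mx (p k) (q k.+1))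
         (row_mx (h^-1 *: (q k - q k.+1) - d2 *: p k) (h^-1 *: (p k.+1 - p k) - d1 *: q k.+1)),
      subdiff psi1 (p 0%N) (q 0%N), subdiff psi2 (q n) (- p n) &
      forall k, (k <= n)%N -> dotv (p k) (p k) <= C5 /\ dotv (q k) (q k) <= C5].
Proof.
pose C3 := `|C| / c.
exists (2 * (C3 + T * C3)) => n n0.
pose h := T / n%:R.
have nn : n%:R != 0 :> R by rewrite pnatr_eq0 -lt0n.
have h0 : 0 < h by rewrite divr_gt0 // ltr0n.
have hT : h * n%:R = T by rewrite divfK.
have [p [q [a [b [ps qs hu h1 h2]]]]] := discrete_solution_exists h0 hT.
exists p, q; have th1 : 0 <= (1 : R) <= 1 by rewrite ler01 lexx.
split => //.
  move=> k kn; have := hu k kn.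
  rewrite (ps k kn) [q k](qs k kn) -/h.
  by rewrite [_ + h *: b k]addrC [p k + _]addrC !addrK !scalerA mulVf ?gt_eqF // !scale1r.
have V_le : path_sqr n h p q a b <= C3.
  have := @discrete_a_priori n h h0 hT 1 p q a b th1 ps qs.
  rewrite subrr !scale1r !scale0r !subr0 scaleN1r mul1r mul0r addr0 => H.
  rewrite /C3 ler_pdivlMr // mulrC; apply: le_trans (H _ h1 h2) (ler_norm C).
  by move=> k kn; rewrite scale1r scale0r subr0; exact: hu.
have sums (f : nat -> 'rV[R]_N) : h * \sum_(k < n) dotv (f k) (f k) =
    \sum_i (h * \sum_(k < n) f k 0 i ^+ 2).
  by rewrite -mulr_sumr exchange_big.
have P0 := dotv_ge0 (p 0%N); have Q0 := dotv_ge0 (q n).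
have A0 : 0 <= h * \sum_(k < n) dotv (a k) (a k).
  by rewrite mulr_ge0 ?(ltW h0) // sumr_ge0 // => k _; exact: dotv_ge0.
have B0 : 0 <= h * \sum_(k < n) dotv (b k) (b k).
  by rewrite mulr_ge0 ?(ltW h0) // sumr_ge0 // => k _; exact: dotv_ge0.
rewrite /path_sqr in V_le.
have T0 := ltW T_gt0.
move=> k kn; split.
  have : dotv (p k - p 0%N) (p k - p 0%N) <= T * (h * \sum_(k < n) dotv (a k) (a k)).
    rewrite sums mulr_sumr; apply: ler_sum => i _; rewrite !mxE -expr2.
    have psi k' : (k' < n)%N -> p k'.+1 0 i = p k' 0 i + h * a k' 0 i.
      by move=> /ps ->; rewrite !mxE.
    apply: le_trans (@forward_dist R n h (fun k => p k 0 i) (fun k => a k 0 i) psi k kn) _.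
    rewrite ler_wpM2r //.
      by rewrite mulr_ge0 ?(ltW h0) // sumr_ge0 // => j _; exact: sqr_ge0.
    by rewrite -hT ler_pM2l // ler_nat.
  have := dotv_AMGM (p k - p 0%N) (p 0%N).
  have e : dotv (p k) (p k) = dotv (p k - p 0%N) (p k - p 0%N) + 2 * dotv (p k - p 0%N) (p 0%N) + dotv (p 0%N) (p 0%N).
    by rewrite !dotvE (dotvC (p 0%N)); ring.
  have : T * (h * \sum_(k < n) dotv (a k) (a k)) <= T * C3 by rewrite ler_wpM2l //; lra.
  by lra.
have : dotv (q k - q n) (q k - q n) <= T * (h * \sum_(k < n) dotv (b k) (b k)).
  rewrite sums mulr_sumr; apply: ler_sum => i _; rewrite !mxE -expr2.
  have qsi k' : (k' < n)%N -> q k' 0 i = q k'.+1 0 i + h * b k' 0 i.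
    by move=> /qs {1}->; rewrite !mxE.
  exact: (@backward_dist R n h T h0 hT (fun k => q k 0 i) (fun k => b k 0 i) qsi k kn).
have := dotv_AMGM (q k - q n) (q n).
have e : dotv (q k) (q k) = dotv (q k - q n) (q k - q n) + 2 * dotv (q k - q n) (q n) + dotv (q n) (q n).
  by rewrite !dotvE (dotvC (q n)); ring.
have : T * (h * \sum_(k < n) dotv (b k) (b k)) <= T * C3 by rewrite ler_wpM2l //; lra.
by lra.
Qed.
End discrete.

(** * Limit of the scheme *)

Lemma ultra_cvg_compact (I : Type) (T : topologicalType) (U : set_system I) (A : set T) (f : I -> T) :
  UltraFilter U -> compact A -> U (f @^-1` A) -> exists2 x, A x & f @ U --> x.
Proof.
move=> UU cA UA.
have [x [Ax xA]] : A `&` cluster (f @ U) !=set0 by apply: cA => //; exact: fmap_proper_filter.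
exists x => // V xV.
have [//|UV] := in_ultra_setVsetC (f @^-1` V) UU.
by have [y [/= ? ?]] := xA (~` V) V UV xV.
Qed.

Lemma uniform_lip_dotv (R : realType) N (M : R) (u z z' : 'rV[R]_N) :
  `|u| <= M -> dotv u (z - z') <= N%:R * M * `|z - z'|.
Proof.
move=> uM; apply: (le_trans (ler_norm _)); apply: (le_trans (dotv_le_norm _ _)).
by rewrite -mulrA ler_wpM2l // ler_wpM2r.
Qed.

Lemma cvg_convex (R : realType) d (F : 'rV[R]_d -> R) (I : Type) (G : set_system I) (FG : Filter G)
    (u : I -> 'rV[R]_d) a : convex_real F -> u @ G --> a -> F (u t) @[t --> G] --> F a.
Proof. by move=> cF ua; exact: (cvg_comp u F ua (convex_continuous cF (x := a))). Qed.

Section limit.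
Variables (R : realType) (N : nat) (T d1 d2 M L : R).
Variables (Hr : 'rV[R]_(N + N) -> R) (psi1 psi2 : 'rV[R]_N -> R).
Hypotheses (T_gt0 : 0 < T) (M_ge0 : 0 <= M) (L_ge0 : 0 <= L).
Hypotheses (Hr_convex : convex_real Hr).
Hypotheses (psi1_convex : convex_real psi1) (psi2_convex : convex_real psi2).
Variables (p q a b : nat -> nat -> 'rV[R]_N).
Let h n : R := T / n.+1%:R.
Let zz n k := row_mx (p n k) (q n k.+1).
Let uu n k := row_mx (b n k - d2 *: p n k) (a n k - d1 *: q n k.+1).
Hypothesis p_step : forall n k, (k < n.+1)%N -> p n k.+1 = p n k + h n *: a n k.
Hypothesis q_step : forall n k, (k < n.+1)%N -> q n k = q n k.+1 + h n *: b n k.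
Hypothesis sub_H : forall n k, (k < n.+1)%N -> subdiff Hr (zz n k) (uu n k).
Hypothesis sub_1 : forall n, subdiff psi1 (p n 0%N) (q n 0%N).
Hypothesis sub_2 : forall n, subdiff psi2 (q n n.+1) (- p n n.+1).
Hypothesis p_bound : forall n k, (k <= n.+1)%N -> `|p n k| <= M.
Hypothesis q_bound : forall n k, (k <= n.+1)%N -> `|q n k| <= M.
Hypothesis a_bound : forall n k, (k < n.+1)%N -> `|a n k| <= L.
Hypothesis b_bound : forall n k, (k < n.+1)%N -> `|b n k| <= L.

Let h_gt0 n : 0 < h n. Proof. by rewrite divr_gt0 // ltr0n. Qed.
Let hT n : h n * n.+1%:R = T. Proof. by rewrite divfK // pnatr_eq0. Qed.

Let p_dist n k m : (k <= m <= n.+1)%N -> `|p n m - p n k| <= L * (h n * (m%:R - k%:R)).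
Proof.
elim: m => [|m IH]; first by rewrite leqn0 => /andP[/eqP -> _]; rewrite !subrr mulr0 normr0 mulr0.
move=> /andP[]; rewrite leq_eqVlt => /orP[/eqP -> _|km mn].
  by rewrite !subrr mulr0 normr0 mulr0.
rewrite p_step // addrAC (le_trans (ler_normD _ _)) //.
have := IH; rewrite -ltnS km ltnW // => /(_ isT) h1.
rewrite normrZ (gtr0_norm (h_gt0 n)).
have := ler_wpM2l (ltW (h_gt0 n)) (a_bound mn).
by rewrite -natr1; lra.
Qed.

Let q_dist n k m : (k <= m <= n.+1)%N -> `|q n m - q n k| <= L * (h n * (m%:R - k%:R)).
Proof.
elim: m => [|m IH]; first by rewrite leqn0 => /andP[/eqP -> _]; rewrite !subrr mulr0 normr0 mulr0.
move=> /andP[]; rewrite leq_eqVlt => /orP[/eqP -> _|km mn].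
  by rewrite !subrr mulr0 normr0 mulr0.
have -> : q n m.+1 - q n k = (q n m - q n k) - h n *: b n m.
  by rewrite (q_step mn); apply/rowP => i; rewrite !mxE; ring.
rewrite (le_trans (ler_normB _ _)) //.
have := IH; rewrite -ltnS km ltnW // => /(_ isT) h1.
rewrite normrZ (gtr0_norm (h_gt0 n)).
have := ler_wpM2l (ltW (h_gt0 n)) (b_bound mn).
by rewrite -natr1; lra.
Qed.

(** The last node at or before [t] on [[0, T]]; the cap keeps the index in range for [t > T], so
    that the limit paths are defined on the whole line. *)
Definition step_index n (t : R) : nat := minn (Num.truncn (t / h n)) n.+1.

Let idx_le n t : (step_index n t <= n.+1)%N. Proof. exact: geq_minr. Qed.

Let idx0 n : step_index n 0 = 0%N.
Proof. by rewrite /step_index mul0r truncn0 min0n. Qed.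

Let idxT n : step_index n T = n.+1.
Proof.
rewrite /step_index (_ : T / h n = n.+1%:R) ?natrK ?minnn //.
by rewrite -(hT n) mulrAC divff ?mul1r // gt_eqF.
Qed.

Let idx_itv n t : 0 <= t <= T -> h n * (step_index n t)%:R <= t < h n * (step_index n t)%:R + h n.
Proof.
move=> /andP[t0 tT].
have th0 : 0 <= t / h n by rewrite divr_ge0 // ltW.
have -> : step_index n t = Num.truncn (t / h n).
  apply/minn_idPl; rewrite truncn_le_nat ltr_pdivrMr // mulrC.
  by rewrite (le_lt_trans tT) // -[ltLHS](hT n) ltr_pM2l // ltr_nat.
have /andP[] := truncn_itv th0; rewrite ler_pdivlMr // ltr_pdivrMr // mulrC => -> /=.
by rewrite -natr1 mulrDl mul1r (mulrC _ (h n)).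
Qed.

Let idx_mono n s t : s <= t -> (step_index n s <= step_index n t)%N.
Proof.
move=> st; rewrite /step_index leq_min geq_minr andbT geq_min; apply/orP; left.
by apply: le_truncn; rewrite ler_pM2r // invr_gt0.
Qed.

Let idx_diff n s t : 0 <= s -> s <= t -> t <= T ->
  `|h n * ((step_index n t)%:R - (step_index n s)%:R) - (t - s)| <= h n.
Proof.
move=> s0 st tT.
have /andP[h1 h2] : h n * (step_index n t)%:R <= t < h n * (step_index n t)%:R + h n.
  by apply: idx_itv; rewrite tT (le_trans s0).
have /andP[h3 h4] : h n * (step_index n s)%:R <= s < h n * (step_index n s)%:R + h n.
  by apply: idx_itv; rewrite s0 (le_trans st).
by rewrite ler_norml; apply/andP; split; lra.
Qed.

(** Along an ultrafilter every bounded family converges, hence the paths converge at all [t] at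
    once, without a diagonal extraction. *)
Lemma step_limits : exists (U : set_system nat) (P Q : R -> 'rV[R]_N),
  [/\ ProperFilter U, h n @[n --> U] --> 0,
    forall t, p n (step_index n t) @[n --> U] --> P t &
    forall t, q n (step_index n t) @[n --> U] --> Q t].
Proof.
have [U [UU oU]] := ultraFilterLemma eventually_filter.
have lim (f : nat -> nat -> 'rV[R]_N) :
    (forall n k, (k <= n.+1)%N -> `|f n k| <= M) ->
    exists P : R -> 'rV[R]_N, forall t, f n (step_index n t) @[n --> U] --> P t.
  move=> fM; have H t : exists x : 'rV[R]_N, f n (step_index n t) @[n --> U] --> x.
    have [|x _ fx] := @ultra_cvg_compact _ _ U _ (fun n => f n (step_index n t)) UU (@closed_ball_rV_compact R N M).
      by apply: filterS filterT => n _ /=; exact: fM.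
    by exists x.
  by have [P PP] := choice H; exists P.
have [P PP] := lim p p_bound; have [Q QQ] := lim q q_bound.
exists U, P, Q; split => //; first exact: ultra_proper.
have h0 : h n @[n --> \oo] --> 0.
  rewrite -[X in _ --> X](mulr0 T); apply: cvgM; first exact: cvg_cst.
  exact: cvg_harmonic.
by move=> V /h0; exact: oU.
Qed.

Section limit_properties.
Variables (U : set_system nat) (P Q : R -> 'rV[R]_N).
Context {UF : ProperFilter U}.
Hypothesis h0 : h n @[n --> U] --> 0.
Hypothesis pP : forall t, p n (step_index n t) @[n --> U] --> P t.
Hypothesis qQ : forall t, q n (step_index n t) @[n --> U] --> Q t.

Let lim_lipschitz (f : nat -> nat -> 'rV[R]_N) (F : R -> 'rV[R]_N) :
  (forall n k m, (k <= m <= n.+1)%N -> `|f n m - f n k| <= L * (h n * (m%:R - k%:R))) ->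
  (forall t, f n (step_index n t) @[n --> U] --> F t) ->
  forall s t, 0 <= s -> s <= t -> t <= T -> `|F t - F s| <= L * (t - s).
Proof.
move=> fL fF s t s0 st tT.
have c1 : `|f n (step_index n t) - f n (step_index n s)| @[n --> U] --> `|F t - F s|.
  by apply: cvg_norm; exact: cvgB (fF t) (fF s).
have c2 : L * (t - s + h n) @[n --> U] --> L * (t - s).
  rewrite -[X in _ --> L * X]addr0; apply: cvgM; first exact: cvg_cst.
  by apply: cvgD => //; exact: cvg_cst.
apply: (ler_cvg_to c1 c2); apply: filterS filterT => n _.
have ik : (step_index n s <= step_index n t <= n.+1)%N by rewrite idx_mono //= idx_le.
apply: (le_trans (fL n _ _ ik)); rewrite ler_wpM2l //.
by have := idx_diff n s0 st tT; rewrite ler_norml => /andP[_]; lra.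
Qed.

Lemma limit_lipschitz s t : 0 <= s -> s <= t -> t <= T ->
  `|P t - P s| <= L * (t - s) /\ `|Q t - Q s| <= L * (t - s).
Proof.
by move=> s0 st tT; split; [exact: (lim_lipschitz p_dist pP)|exact: (lim_lipschitz q_dist qQ)].
Qed.

(** The times 0 and [T] correspond exactly to the nodes 0 and n + 1, and finite convex functions are
    continuous, so the inclusions pass to the limit. *)
Lemma limit_boundary : subdiff psi1 (P 0) (Q 0) /\ subdiff psi2 (Q T) (- P T).
Proof.
split=> z.
  have c1 : psi1 (p n (step_index n 0)) + dotv (q n (step_index n 0)) (z - p n (step_index n 0))
      @[n --> U] --> psi1 (P 0) + dotv (Q 0) (z - P 0).
    apply: cvgD; first by apply: cvg_convex => //; exact: pP.
    by apply: cvg_dotv; [exact: qQ|apply: cvgB; [exact: cvg_cst|exact: pP]].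
  apply: (ler_cvg_to c1 (cvg_cst (psi1 z))); apply: filterS filterT => n _.
  by rewrite idx0; exact: sub_1.
have c1 : psi2 (q n (step_index n T)) + dotv (- p n (step_index n T)) (z - q n (step_index n T))
    @[n --> U] --> psi2 (Q T) + dotv (- P T) (z - Q T).
  apply: cvgD; first by apply: cvg_convex => //; exact: qQ.
  by apply: cvg_dotv; [apply: cvgN; exact: pP|apply: cvgB; [exact: cvg_cst|exact: qQ]].
apply: (ler_cvg_to c1 (cvg_cst (psi2 z))); apply: filterS filterT => n _.
by rewrite idxT; exact: sub_2.
Qed.

Let D := `|d1| + `|d2|.
Let Mu := L + D * M.

Let uu_bound n k : (k < n.+1)%N -> `|uu n k| <= Mu.
Proof.
move=> kn; have D1 : `|d1| * M <= D * M by rewrite ler_wpM2r // lerDl.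
have D2 : `|d2| * M <= D * M by rewrite ler_wpM2r // lerDr.
apply/mx_norm_leP; first by rewrite addr_ge0 // mulr_ge0 // addr_ge0.
move=> i j; rewrite mxE; case: splitP => j' _; apply: (le_trans (coord_le_mx_norm _ _ _)).
  rewrite (le_trans (ler_normB _ _)) // normrZ lerD ?b_bound //.
  by apply: le_trans D2; rewrite ler_wpM2l // p_bound // ltnW.
rewrite (le_trans (ler_normB _ _)) // normrZ lerD ?a_bound //.
by apply: le_trans D1; rewrite ler_wpM2l // q_bound.
Qed.

Lemma row_mx_norm_le (u v : 'rV[R]_N) c : `|u| <= c -> `|v| <= c -> `|row_mx u v| <= c.
Proof.
move=> uc vc; apply/mx_norm_leP; first by apply: le_trans uc.
move=> i j; rewrite mxE; case: splitP => j' _.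
  exact: le_trans (coord_le_mx_norm _ _ _) uc.
exact: le_trans (coord_le_mx_norm _ _ _) vc.
Qed.

(* Average of the discrete inclusions over the steps between t and t + e. *)
Lemma limit_difference_quotient t : 0 <= t -> exists2 K, 0 <= K &
  forall e x, 0 < e -> t + e <= T -> L * e < 1 -> let z := row_mx (P t) (Q t) in
  dotv (row_mx (Q t - Q (t + e) - e *: (d2 *: P t)) (P (t + e) - P t - e *: (d1 *: Q t))) (x - z)
  <= e * (Hr x - Hr z + K * (L * e) * (1 + `|x - z|)).
Proof.
move=> t0; set z := row_mx (P t) (Q t).
have [K1 K10 K1P] := convex_lipschitz_at Hr_convex z.
have D0 : 0 <= D by rewrite addr_ge0.
have Mu0 : 0 <= Mu by rewrite addr_ge0 // mulr_ge0.
(* The three errors made by freezing the time at [t]: in the value of [Hr], in the base point paired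
   with the bounded slope [uu n k], and in the terms with [d1] and [d2]. *)
pose K := K1 + (N + N)%:R * Mu + (N + N)%:R * D.
exists K; first by rewrite !addr_ge0 // mulr_ge0.
move=> e x e0 teT Le1 /=; pose v := x - z.
have tT : t <= T by apply: le_trans teT; rewrite lerDl ltW.
have tte : t <= t + e by rewrite lerDl ltW.
(* A common bound for the distance of [p n k] to [P t] and of [q n k] to [Q t] at all nodes between
   [t] and [t + e]; it tends to [L * e]. *)
pose rho n := L * (e + h n) + (`|p n (step_index n t) - P t| + `|q n (step_index n t) - Q t|).
have rho_cvg : rho n @[n --> U] --> L * e.
  have cn (f : nat -> 'rV[R]_N) (l : 'rV[R]_N) : f @ U --> l -> `|f n - l| @[n --> U] --> 0.
    move=> fl; rewrite -(normr0 'rV[R]_N) -(subrr l); apply: cvg_norm.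
    by apply: cvgB => //; exact: cvg_cst.
  rewrite -[X in _ --> X]addr0 -[X in _ --> _ + X]addr0; apply: cvgD; last first.
    by apply: cvgD; apply: cn; [exact: pP|exact: qQ].
  rewrite -[X in _ --> L * X]addr0; apply: cvgM; first exact: cvg_cst.
  by apply: cvgD => //; exact: cvg_cst.
pose s n : R := h n * ((step_index n (t + e))%:R - (step_index n t)%:R).
have s_cvg : s n @[n --> U] --> e.
  apply/cvgrPdist_le => d d_gt0.
  move/cvgrPdist_le : h0 => /(_ d d_gt0); apply: filterS => n.
  rewrite sub0r normrN (gtr0_norm (h_gt0 n)); apply: le_trans.
  by have := idx_diff n t0 tte teT; rewrite (addrAC t) subrr add0r distrC.
have key n : rho n <= 1 ->
  dotv (row_mx (q n (step_index n t) - q n (step_index n (t + e)) - s n *: (d2 *: P t))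
     (p n (step_index n (t + e)) - p n (step_index n t) - s n *: (d1 *: Q t))) v
  <= s n * (Hr x - Hr z + K * rho n * (1 + `|v|)).
  move=> rho1; set k0 := step_index n t; set k1 := step_index n (t + e).
  have k01 : (k0 <= k1)%N by exact: idx_mono.
  have k1n : (k1 <= n.+1)%N by exact: idx_le.
  have s_le : s n <= e + h n.
    by have := idx_diff n t0 tte teT; rewrite -/(s n) ler_norml => /andP[_]; lra.
  have rho0 : 0 <= rho n.
    by rewrite !addr_ge0 // mulr_ge0 // addr_ge0 // ltW.
  have pd k : (k0 <= k <= k1)%N -> `|p n k - P t| <= rho n /\ `|q n k - Q t| <= rho n.
    move=> /andP[kk0 kk1].
    have hk : L * (h n * (k%:R - k0%:R)) <= L * (e + h n).
      rewrite ler_wpM2l //; apply: le_trans s_le; rewrite /s ler_pM2l // lerB // ler_nat //.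
    have kk : (k0 <= k <= n.+1)%N by rewrite kk0 (leq_trans kk1).
    have hp := p_dist kk; have hq := q_dist kk.
    have n1 := normr_ge0 (p n k0 - P t); have n2 := normr_ge0 (q n k0 - Q t).
    rewrite /rho -/k0; split.
      have := ler_normD (p n k - p n k0) (p n k0 - P t); rewrite addrA subrK; lra.
    have := ler_normD (q n k - q n k0) (q n k0 - Q t); rewrite addrA subrK; lra.
  have one k : (k0 <= k < k1)%N ->
      dotv (row_mx (b n k - d2 *: P t) (a n k - d1 *: Q t)) v
      <= Hr x - Hr z + K * rho n * (1 + `|v|).
    move=> /andP[kk0 kk1]; have kn : (k < n.+1)%N by exact: leq_trans kk1 k1n.
    have [p1 _] : `|p n k - P t| <= rho n /\ `|q n k - Q t| <= rho n by apply: pd; rewrite kk0 ltnW.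
    have [_ q1] : `|p n k.+1 - P t| <= rho n /\ `|q n k.+1 - Q t| <= rho n by apply: pd; rewrite (leq_trans kk0).
    have zd : `|zz n k - z| <= rho n by rewrite sub_row_mx row_mx_norm_le.
    have h1 := sub_H kn x.
    have h2 := K1P (zz n k) (le_trans zd rho1); rewrite ler_norml in h2.
    have h3 := uniform_lip_dotv (zz n k) z (uu_bound kn).
    have NN : 0 <= (N + N)%:R :> R by [].
    have h4 : (N + N)%:R * Mu * `|zz n k - z| <= (N + N)%:R * Mu * rho n.
      by rewrite ler_wpM2l // mulr_ge0.
    have h5 : K1 * `|zz n k - z| <= K1 * rho n by rewrite ler_wpM2l.
    have e1 : row_mx (b n k - d2 *: P t) (a n k - d1 *: Q t) =
        uu n k + row_mx (d2 *: (p n k - P t)) (d1 *: (q n k.+1 - Q t)).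
      by rewrite /uu add_row_mx !scalerBr !addrA !subrK.
    have h6 : `|row_mx (d2 *: (p n k - P t)) (d1 *: (q n k.+1 - Q t))| <= D * rho n.
      apply: row_mx_norm_le; rewrite normrZ ler_pM // ?lerDl ?lerDr //.
    have h7 : dotv (row_mx (d2 *: (p n k - P t)) (d1 *: (q n k.+1 - Q t))) v
        <= (N + N)%:R * (D * rho n * `|v|).
      apply: (le_trans (ler_norm _)); apply: (le_trans (dotv_le_norm _ _)).
      by rewrite ler_wpM2l // ler_wpM2r.
    rewrite e1 dotvDl.
    have e2 : dotv (uu n k) v = dotv (uu n k) (x - zz n k) + dotv (uu n k) (zz n k - z).
      by rewrite -dotvDr /v addrA subrK.
    have v0 := normr_ge0 v.
    have m1 : 0 <= K1 * rho n * `|v| by rewrite !mulr_ge0.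
    have m2 : 0 <= (N + N)%:R * Mu * rho n * `|v| by rewrite !mulr_ge0.
    have m3 : 0 <= (N + N)%:R * D * rho n by rewrite !mulr_ge0.
    move/andP: h2 => [h2 _].
    by rewrite e2 /K; lra.
  have ind j : (k0 + j <= k1)%N ->
     dotv (row_mx (q n k0 - q n (k0 + j)%N - (h n * j%:R) *: (d2 *: P t))
       (p n (k0 + j)%N - p n k0 - (h n * j%:R) *: (d1 *: Q t))) v
     <= (h n * j%:R) * (Hr x - Hr z + K * rho n * (1 + `|v|)).
    elim: j => [|j IH] jk.
      by rewrite addn0 mulr0 !subrr !scale0r !subr0 row_mx0 dotv0l mul0r.
    rewrite addnS in jk *.
    have kn : (k0 + j < n.+1)%N by exact: leq_trans jk k1n.
    have := IH (ltnW jk).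
    have := one (k0 + j)%N; rewrite leq_addr jk => /(_ isT).
    move=> /(ler_wpM2l (ltW (h_gt0 n))); rewrite -dotvZl => hA hB.
    have := lerD hA hB; rewrite -dotvDl scale_row_mx add_row_mx -mulrDl.
    rewrite (_ : h n + h n * j%:R = h n * j.+1%:R); last by rewrite -natr1; ring.
    congr (dotv (row_mx _ _) _ <= _).
      by rewrite (q_step kn); apply/rowP => i; rewrite !mxE -natr1; ring.
    by rewrite (p_step kn); apply/rowP => i; rewrite !mxE -natr1; ring.
  have := ind (k1 - k0)%N; rewrite subnKC // => /(_ (leqnn _)).
  by rewrite natrB.
have c1 : dotv (row_mx (q n (step_index n t) - q n (step_index n (t + e)) - s n *: (d2 *: P t))
     (p n (step_index n (t + e)) - p n (step_index n t) - s n *: (d1 *: Q t))) v @[n --> U] -->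
   dotv (row_mx (Q t - Q (t + e) - e *: (d2 *: P t)) (P (t + e) - P t - e *: (d1 *: Q t))) v.
  rewrite -[v]hsubmxK dotv_row_mx; under eq_fun do rewrite dotv_row_mx.
  apply: cvgD; apply: cvg_dotv; do ?exact: cvg_cst.
    apply: cvgB; first by apply: cvgB; exact: qQ.
    by apply: cvgZr_tmp.
  apply: cvgB; first by apply: cvgB; exact: pP.
  by apply: cvgZr_tmp.
have c2 : s n * (Hr x - Hr z + K * rho n * (1 + `|v|)) @[n --> U] -->
    e * (Hr x - Hr z + K * (L * e) * (1 + `|v|)).
  apply: cvgM => //; apply: cvgD; first exact: cvg_cst.
  by apply: cvgM; [apply: cvgM; [exact: cvg_cst|]|exact: cvg_cst].
apply: (ler_cvg_to c1 c2).
have rho_near : \forall n \near U, rho n < 1 by apply: (cvgr_lt _ rho_cvg).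
by apply: filterS rho_near => n /ltW; exact: key.
Qed.

End limit_properties.
End limit.

(** * Absolutely continuous functions *)

Section stieltjes_density.
Variables (R : realType).
Notation mu := (@lebesgue_measure R).

(** A null set is covered by half-open intervals of total length below [e / K], and each of them has
    [phi]-length at most [K] times its length. *)
Lemma stieltjes_dominated (phi : cumulative R R) (K : R) : 0 < K ->
    (forall s t, s <= t -> phi t - phi s <= K * (t - s)) ->
  lebesgue_stieltjes_measure phi `<< mu.
Proof.
move=> K0 phiK; apply/null_content_dominatesP => A mA muA.
apply/eqP; rewrite eq_le measure_ge0 andbT.
apply/lee_addgt0Pr => e e0; rewrite add0e.
have eK : 0 < e / K by rewrite divr_gt0.
have fin : mu A \is a fin_num by rewrite muA.
have [x [B [mB AB] <-]] := lb_ereal_inf_adherent eK fin.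
rewrite -[ereal_inf _]/(mu A) muA add0e => Be.
apply: (@le_trans _ _ (\sum_(k <oo) wlength phi (B k))%E).
  by apply: ereal_inf_lbound; exists B.
apply: (@le_trans _ _ (K%:E * (\sum_(k <oo) wlength idfun (B k)))%E); last first.
  have eE : e = K * (e / K) by rewrite mulrC divfK // gt_eqF.
  by rewrite [X in (_ <= X%:E)%E]eE EFinM lee_pmul2l ?lte_fin // ltW.
rewrite -nneseriesZl; last by move=> k _; exact: wlength_ge0.
apply: lee_nneseries => [k _ _|k _]; first exact: wlength_ge0.
have [->|[[a b] /= ab ->]] := (ocitvP (B k)).1 (mB k).
  by rewrite !wlength0 mule0.
by rewrite !wlength_itv_bnd ?(ltW ab) //= -EFinM lee_fin; exact: phiK (ltW ab).
Qed.

(* Radon-Nikodym derivative of the Lebesgue-Stieltjes measure of phi; the values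
   0 and 1 at the ends make it a probability, hence a finite measure. *)
Lemma cumulative_density (phi : R -> R) (K T : R) : 0 < K -> 0 < T ->
    (forall s t, s <= t -> 0 <= phi t - phi s <= K * (t - s)) ->
    (forall t, t <= 0 -> phi t = 0) -> (forall t, T <= t -> phi t = 1) ->
  exists2 g : R -> R, mu.-integrable setT (EFin \o g) &
    forall s t, s <= t -> phi t - phi s = \int[mu]_(x in `]s, t]) g x.
Proof.
move=> K0 T0 phiK phi0 phi1.
have nd : {homo phi : s t / s <= t}.
  by move=> s t /phiK /andP[h _]; rewrite -subr_ge0.
have phic : continuous phi.
  move=> x; apply/cvgrPdist_le => e e0; near=> y.
  have yx : `|x - y| <= e / K.
    by near: y; apply: cvgr_dist_le; [exact: cvg_id|rewrite divr_gt0].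
  rewrite ler_pdivlMr // in yx; apply: le_trans yx.
  have [xy|yx] := leP x y.
    have /andP[h1 h2] := phiK _ _ xy.
    by rewrite distrC ger0_norm // [`|x - y|]distrC ger0_norm ?subr_ge0 // mulrC.
  have /andP[h1 h2] := phiK _ _ (ltW yx).
  by rewrite ger0_norm // ger0_norm ?subr_ge0 ?(ltW yx) // mulrC.
pose F0 : cumulative R R := HB.pack phi (isCumulative.Build R _ R phi nd (right_continuousW phic)).
have Ny : phi @ -oo --> (0 : R).
  apply: cvg_near_cst; exists 0; split; first exact: num_real.
  by move=> t /ltW /phi0.
have yy : phi @ +oo --> (1 : R).
  apply: cvg_near_cst; exists T; split; first exact: num_real.
  by move=> t /ltW /phi1.
pose F : cumulativeBounded (0 : R) 1 := HB.pack phi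
  (isCumulative.Build R _ R phi nd (right_continuousW phic))
  (isCumulativeBounded.Build R 0 1 phi Ny yy).
pose nu : probability _ R := lebesgue_stieltjes_measure F.
have dom : charge_of_finite_measure nu `<< mu.
  by apply: (@stieltjes_dominated F K) => // s t /phiK /andP[].
have [g [gfin gint gE]] : exists g : R -> \bar R, [/\ (forall x, g x \is a fin_num),
    mu.-integrable [set: R] g & forall A, measurable A -> nu A = (\int[mu]_(x in A) g x)%E].
  exists (Radon_Nikodym (charge_of_finite_measure nu) mu); split.
  - by move=> x; exact: Radon_Nikodym_fin_num.
  - exact: Radon_Nikodym_integrable.
  - by move=> A mA; rewrite -Radon_Nikodym_integral.
exists (fine \o g).
  by apply: eq_integrable gint => // x _ /=; rewrite fineK.
move=> s t st; rewrite /Rintegral.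
under eq_integral do rewrite /= fineK //.
rewrite -gE // /nu /= /lebesgue_stieltjes_measure /measure_extension.
by rewrite measurable_mu_extE /= ?wlength_itv_bnd //; exact: is_ocitv.
Unshelve. all: by end_near. Qed.
End stieltjes_density.

Section clamp.
Variables (R : realType).

(** The retraction of the line onto [[a, b]]. Composition with [clamp 0 T] extends a function on
    [[0, T]] by constants, which avoids working in the subspace topology. *)
Definition clamp (a b t : R) := Num.max a (Num.min t b).

Lemma clamp_itv a b t : a <= b -> a <= clamp a b t <= b.
Proof. by move=> ab; rewrite /clamp le_max lexx ge_max ab ge_min lexx orbT. Qed.

Lemma clamp_id a b t : a <= t -> t <= b -> clamp a b t = t.
Proof. by move=> a_t tb; rewrite /clamp min_l // max_r. Qed.

Lemma clamp_lo a b t : t <= a -> clamp a b t = a.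
Proof. by move=> ta; rewrite /clamp max_l // ge_min ta. Qed.

Lemma clamp_hi a b t : a <= b -> b <= t -> clamp a b t = b.
Proof. by move=> ab bt; rewrite /clamp min_r // max_r. Qed.

Lemma clamp_dist a b s t : s <= t -> 0 <= clamp a b t - clamp a b s <= t - s.
Proof.
move=> st; rewrite /clamp !maxEle !minEle.
by case: (leP t b) => h1; case: (leP s b) => h2; case: (leP a t) => h3;
  case: (leP a s) => h4; case: (leP a b) => h5; apply/andP; split; lra.
Qed.

Lemma clamp_continuous a b : continuous (clamp a b).
Proof.
move=> x; apply: (@continuous_max _ _ (cst a) (fun t => Num.min t b)); first exact: cst_continuous.
by apply: (@continuous_min _ _ id (cst b)) => //; exact: cst_continuous.
Qed.
End clamp.

Section acd.
Variables (R : realType).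
Notation mu := (@lebesgue_measure R).

(* Absolute continuity of f on [0, T], in integral form with density G. *)
Definition acd (T : R) (f G : R -> R) := mu.-integrable setT (EFin \o G) /\
  forall s t, 0 <= s -> s <= t -> t <= T -> f t - f s = \int[mu]_(x in `]s, t]) G x.

Lemma Rintegral_cst_itv (c s t : R) : s <= t -> \int[mu]_(x in `]s, t]) c = c * (t - s).
Proof.
move=> st; rewrite Rintegral_cst //.
rewrite [X in fine X](lebesgue_measure_itv `]s, t]) /= lte_fin.
by case: ltP => //= ts; rewrite (_ : t = s) ?subrr ?mulr0 //; apply/eqP; rewrite eq_le ts.
Qed.

Lemma integrable_cst_itv (c s t : R) : mu.-integrable `]s, t] (EFin \o (fun _ => c)).
Proof.
apply: measurable_bounded_integrable => //; last exact: bounded_cst.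
rewrite [ltLHS](lebesgue_measure_itv `]s, t]) /=.
by case: ifP => // _; rewrite -EFinB ltry.
Qed.

Lemma ae_imply (P Q : R -> Prop) : (forall x, P x -> Q x) ->
  {ae mu, forall x, P x} -> {ae mu, forall x, Q x}.
Proof. by move=> PQ; apply: filterS; [exact: (ae_filter_ringOfSetsType mu)|exact: PQ]. Qed.

Lemma ae_and (P Q : R -> Prop) : {ae mu, forall x, P x} -> {ae mu, forall x, Q x} ->
  {ae mu, forall x, P x /\ Q x}.
Proof. by move=> hP hQ; apply: filterI => //; exact: (ae_filter_ringOfSetsType mu). Qed.

Lemma ae_neq (T : R) : {ae mu, forall x, x != T}.
Proof.
exists [set T]; split => //; first exact: lebesgue_measure_set1.
by move=> x /= /negP; rewrite negbK => /eqP.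
Qed.

(** Rademacher's theorem on an interval: a Radon-Nikodym density gives the integral form, and
    Lebesgue differentiation through [FTC1] identifies it with the derivative almost everywhere.
    Only right difference quotients are recorded. *)
Lemma lipschitz_acd (T L : R) (f : R -> R) : 0 < T -> 0 <= L ->
    (forall s t, 0 <= s -> s <= t -> t <= T -> `|f t - f s| <= L * (t - s)) ->
  exists G : R -> R, [/\ acd T f G, measurable_fun setT G, forall x, `|G x| <= L,
    forall x, ~~ (0 < x < T) -> G x = 0 &
    {ae mu, forall x, 0 < x < T -> forall eta, 0 < eta ->
       exists2 d, 0 < d & forall e, 0 < e -> e < d -> `|e^-1 * (f (x + e) - f x) - G x| <= eta}].
Proof.
move=> T0 L0 fL; have T0' := ltW T0.
(* f + (L + 1) id is increasing; normalised, it is a cumulative function. *)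
pose Z := f T - f 0 + (L + 1) * T.
have Z0 : 0 < Z.
  have := fL 0 T (lexx _) T0' (lexx _); rewrite subr0 ler_norml => /andP[h _].
  by rewrite /Z; lra.
pose c := clamp 0 T.
pose phi t := (f (c t) - f 0 + (L + 1) * c t) / Z.
pose K := (2 * L + 1) / Z.
have K0 : 0 < K by rewrite divr_gt0 //; lra.
have phi_lip s t : s <= t -> 0 <= phi t - phi s <= K * (t - s).
  move=> st; have /andP[c1 c2] := clamp_dist 0 T st.
  have /andP[s1 s2] := clamp_itv s T0'; have /andP[t1 t2] := clamp_itv t T0'.
  rewrite -/(c s) -/(c t) in c1 c2 s1 s2 t1 t2.
  have cst' : c s <= c t by rewrite -subr_ge0.
  have := fL _ _ s1 cst' t2; rewrite ler_norml => /andP[h1 h2].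
  have -> : phi t - phi s = (f (c t) - f (c s) + (L + 1) * (c t - c s)) / Z by rewrite /phi; field; rewrite gt_eqF.
  rewrite divr_ge0 ?(ltW Z0) //=; last by lra.
  rewrite /K mulrAC ler_pM2r ?invr_gt0 //.
  have := ler_wpM2l L0 c2; lra.
have [|t Tt|g gint gE] := cumulative_density K0 T0 phi_lip.
- by move=> t t0; rewrite /phi /c clamp_lo // subrr mulr0 addr0 mul0r.
- by rewrite /phi /c clamp_hi // divff // gt_eqF.
pose g1 x := Z * g x - (L + 1).
have mg : measurable_fun setT g by apply/measurable_EFinP; exact: measurable_int gint.
have mg1 : measurable_fun setT g1.
  by apply: measurable_funB => //; exact: measurable_funM.
have gint_itv s t : mu.-integrable `]s, t] (EFin \o g) by apply: integrableS gint.
have fE s t : 0 <= s -> s <= t -> t <= T -> f t - f s = \int[mu]_(x in `]s, t]) g1 x.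
  move=> s0 st tT.
  rewrite /g1 RintegralB //; last exact: integrable_cst_itv; last first.
    have h : mu.-integrable `]s, t] (fun x => (Z%:E * (EFin \o g) x)%E) by apply: integrableZl.
    by [].
  rewrite RintegralZl // -gE // Rintegral_cst_itv // /phi /c !clamp_id //; try lra.
  by field; rewrite gt_eqF.
(* The difference quotients are bounded by [L], so clamping changes the density on a null set only,
   while making the bound hold everywhere. *)
pose G := fun x => if 0 < x < T then clamp (- L) L (g1 x) else 0.
have deriv : {ae mu, forall x, 0 < x < T -> forall eta, 0 < eta ->
       exists2 d, 0 < d & forall e, 0 < e -> e < d -> `|e^-1 * (f (x + e) - f x) - g1 x| <= eta}.
  have locg : locally_integrable setT g by apply: open_integrable_locally => //; exact: openT.
  have := @FTC1 R g (BRight 0) (fun y => gint_itv 0 y) locg.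
  apply: ae_imply => x hx /andP[x0 xT] eta eta0.
  have [//|dF FE] := hx _.
  have eZ : 0 < eta / Z by rewrite divr_gt0.
  have := dF => /cvgrPdist_le /(_ _ eZ); rewrite -/(derive _ _ _) -derive1E FE.
  move=> /nbhs_ballP[d /= d0 dP].
  exists (Num.min d (T - x)); first by rewrite lt_min d0 subr_gt0.
  move=> e e0; rewrite lt_min => /andP[ed eT].
  have := dP e; rewrite /ball /= sub0r normrN gtr0_norm // => /(_ ed (lt0r_neq0 e0)).
  rewrite -!gE; [|lra|by rewrite scaler1; lra].
  rewrite [e *: 1](_ : _ = e); last by rewrite /GRing.scale /= mulr1.
  have -> : phi (e + x) - phi 0 - (phi x - phi 0) = phi (x + e) - phi x.
    by rewrite (addrC e); ring.
  move=> h.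
  have : Z * `|g x - e^-1 * (phi (x + e) - phi x)| <= eta.
    by rewrite mulrC -ler_pdivlMr.
  rewrite -{1}(gtr0_norm Z0) -normrM distrC.
  congr (`|_| <= _); rewrite /phi /c !clamp_id; try by clear -x0 xT e0 eT; lra.
  by rewrite /g1; field; rewrite !gt_eqF.
have g1_bound : {ae mu, forall x, 0 < x < T -> G x = g1 x}.
  apply: ae_imply deriv => x hx x0T; rewrite /G x0T.
  have /andP[x0 xT] := x0T.
  have : `|g1 x| <= L.
    apply/ler_addgt0Pr => eta eta0; have [d d0 dP] := hx x0T eta eta0.
    pose e := Num.min (d / 2) ((T - x) / 2).
    have e0 : 0 < e by rewrite lt_min !divr_gt0 // subr_gt0.
    have e1 : e <= d / 2 by rewrite ge_min lexx.
    have e2 : e <= (T - x) / 2 by rewrite ge_min lexx orbT.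
    have := dP e e0 ltac:(lra).
    have h : `|f (x + e) - f x| <= L * (x + e - x) by apply: fL; lra.
    have {}h : `|e^-1 * (f (x + e) - f x)| <= L.
      rewrite normrM (gtr0_norm (_ : 0 < e^-1)) ?invr_gt0 // mulrC ler_pdivrMr //.
      by apply: (le_trans h); rewrite addrAC subrr add0r.
    have := ler_distD 0 (g1 x) (e^-1 * (f (x + e) - f x)).
    move=> _ h2; have := ler_normB (e^-1 * (f (x + e) - f x)) (e^-1 * (f (x + e) - f x) - g1 x).
    by rewrite opprB addrC subrK; lra.
  by rewrite ler_norml => /andP[h1 h2]; rewrite clamp_id.
have GL x : `|G x| <= L.
  rewrite /G; case: ifP => _; last by rewrite normr0.
  by rewrite ler_norml clamp_itv //; lra.
have GE : G = (fun x => clamp (- L) L (g1 x)) \_ `]0, T[.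
  apply/funext => x; rewrite patchE /G; have -> : (x \in `]0, T[%classic) = (0 < x < T).
    by apply/idP/idP; rewrite inE /= in_itv.
  by [].
have mclamp : measurable_fun setT (fun x => clamp (- L) L (g1 x)).
  apply: (@measurableT_comp _ _ _ _ _ _ (clamp (- L) L) _ g1) => //.
  by apply: continuous_measurable_fun; exact: clamp_continuous.
have mG : measurable_fun setT G.
  by rewrite GE; apply/(measurable_restrictT _ _).1 => //; exact: measurable_funTS.
have Gint : mu.-integrable setT (EFin \o G).
  rewrite GE -restrict_EFin -integrable_mkcond //.
  apply: measurable_bounded_integrable => //.
  - rewrite [ltLHS](lebesgue_measure_itv `]0, T[) /=; case: ifP => // _; rewrite -EFinB ltry //.
  - exact: measurable_funTS.
  - exists L; split; first exact: num_real.
    move=> y Ly x _ /=; apply: le_trans (ltW Ly).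
    by rewrite ler_norml clamp_itv //; lra.
exists G; split => //.
- split=> // s t s0 st tT; rewrite fE //; congr fine.
  apply: ae_eq_integral => //.
  + by apply/measurable_EFinP; exact: measurable_funTS.
  + by apply/measurable_EFinP; exact: measurable_funTS.
  + apply: ae_imply (ae_and g1_bound (ae_neq T)) => x [h1 xT] /=.
    rewrite in_itv /= => /andP[sx xt]; rewrite h1 // (le_lt_trans s0 sx) /=.
    by rewrite lt_neqAle xT (le_trans xt).
- by move=> x; rewrite /G => /negbTE ->.
- apply: ae_imply (ae_and deriv g1_bound) => x [h1 h2] x0T.
  by rewrite h2 //; exact: h1.
Qed.
End acd.

Section acd_theory.
Variables (R : realType).
Notation mu := (@lebesgue_measure R).

Lemma integrableD_fun (D : set (measurableTypeR R)) (f g : R -> R) : measurable D ->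
  mu.-integrable D (EFin \o f) -> mu.-integrable D (EFin \o g) ->
  mu.-integrable D (EFin \o (fun x => f x + g x)).
Proof.
move=> mD fi gi; have := integrableD mD fi gi.
by apply: eq_integrable => // x _ /=; rewrite EFinD.
Qed.

Lemma integrableB_fun (D : set (measurableTypeR R)) (f g : R -> R) : measurable D ->
  mu.-integrable D (EFin \o f) -> mu.-integrable D (EFin \o g) ->
  mu.-integrable D (EFin \o (fun x => f x - g x)).
Proof.
move=> mD fi gi; have := integrableB mD fi gi.
by apply: eq_integrable => // x _ /=; rewrite EFinB.
Qed.

Lemma integrableZ_fun (D : set (measurableTypeR R)) (c : R) (f : R -> R) : measurable D ->
  mu.-integrable D (EFin \o f) -> mu.-integrable D (EFin \o (fun x => c * f x)).
Proof.
move=> mD fi; have := integrableZl mD c fi.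
by apply: eq_integrable => // x _ /=; rewrite EFinM.
Qed.

Lemma integrable_norm_fun (D : set (measurableTypeR R)) (f : R -> R) : measurable D ->
  mu.-integrable D (EFin \o f) -> mu.-integrable D (EFin \o (fun x => `|f x|)).
Proof.
move=> mD /integrable_norm fi; move: fi.
by apply: eq_integrable => // x _ /=.
Qed.

Lemma Rintegral_itv_split (h : R -> R) (s t : R) : mu.-integrable setT (EFin \o h) -> 0 <= s -> s <= t ->
  \int[mu]_(x in `]0, t]) h x - \int[mu]_(x in `]0, s]) h x = \int[mu]_(x in `]s, t]) h x.
Proof.
move=> hint s0 st; apply: Rintegral_itvB.
- by apply: integrableS hint.
- by rewrite bnd_simp.
- by rewrite bnd_simp.
Qed.

Lemma integrable_bounded_mul (f G : R -> R) (M : R) : mu.-integrable setT (EFin \o G) ->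
  measurable_fun setT f -> (forall x, `|f x| <= M) ->
  mu.-integrable setT (EFin \o (fun x => f x * G x)).
Proof.
move=> Gint mf fM.
have h : mu.-integrable setT ((EFin \o f) \* (EFin \o G))%E.
  apply: integrableMr => //.
  exists M; split; first exact: num_real.
  by move=> y My x _ /=; apply: le_trans (ltW My).
by apply: eq_integrable h => // x _ /=; rewrite EFinM.
Qed.

Lemma acd_equicontinuous (T e : R) (f G : R -> R) : acd T f G -> 0 < e ->
  exists2 d, 0 < d & forall s t, 0 <= s -> s <= t -> t <= T -> t - s < d -> `|f t - f s| <= e.
Proof.
move=> [Gint fE] e0; have [d [d0 dP]] := integral_normr_continuous Gint e0.
exists d => // s t s0 st tT std; rewrite fE //.
apply: le_trans (le_normr_Rintegral _ _) (ltW (dP _ _ _)) => //.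
- by apply: integrableS Gint.
- rewrite [ltLHS](lebesgue_measure_itv `]s, t]) /= lte_fin.
  by case: ifP => _; rewrite ?lte_fin // -EFinB lte_fin.
Qed.

(** Integration by parts, with defect [Phi]. On a short interval, freezing [f] and [g] at the ends
    changes the integrand by at most [e * k x], so [Phi] varies by at most [e] times the increment
    of [m]. A fine subdivision gives [|Phi T| <= e * m T] for every [e]. *)
Lemma acd_product (T : R) (f g F G : R -> R) (M : R) : 0 < T -> acd T f F -> acd T g G ->
  measurable_fun setT f -> measurable_fun setT g ->
  (forall x, `|f x| <= M) -> (forall x, `|g x| <= M) ->
  f T * g T - f 0 * g 0 = \int[mu]_(x in `]0, T]) (f x * G x + g x * F x).
Proof.
move=> T0 acf acg mf mg fM gM.
have [Fint fE] := acf; have [Gint gE] := acg.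
have fGint := integrable_bounded_mul Gint mf fM.
have gFint := integrable_bounded_mul Fint mg gM.
pose h x := f x * G x + g x * F x.
have hint : mu.-integrable setT (EFin \o h).
  exact: integrableD_fun.
have nFint := integrable_norm_fun measurableT Fint; have nGint := integrable_norm_fun measurableT Gint.
pose k x := `|F x| + `|G x|.
have kint : mu.-integrable setT (EFin \o k).
  exact: integrableD_fun.
pose Phi t := f t * g t - f 0 * g 0 - \int[mu]_(x in `]0, t]) h x.
pose m t := \int[mu]_(x in `]0, t]) k x.
have ms s t : 0 <= s -> s <= t -> m t - m s = \int[mu]_(x in `]s, t]) k x.
  by move=> s0 st; exact: Rintegral_itv_split.
suff H e : 0 < e -> `|Phi T| <= e * m T.
  have : `|Phi T| <= 0.
    apply/ler_addgt0Pr => e e0; rewrite add0r.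
    have mT0 : 0 <= m T by apply: Rintegral_ge0 => x _; rewrite addr_ge0.
    have e1 : 0 < e / (m T + 1) by rewrite divr_gt0 // ltr_wpDl.
    apply: (le_trans (H _ e1)); rewrite mulrAC ler_pdivrMr ?ltr_wpDl // ler_pM2l //.
    by rewrite lerDl.
  by rewrite normr_le0 /Phi subr_eq0 => /eqP.
move=> e0.
have [d1 d10 fd] := acd_equicontinuous acf e0.
have [d2 d20 gd] := acd_equicontinuous acg e0.
have step s t : 0 <= s -> s <= t -> t <= T -> t - s < d1 -> t - s < d2 ->
    `|Phi t - Phi s| <= e * (m t - m s).
  move=> s0 st tT std1 std2.
  have iS u : mu.-integrable setT (EFin \o u) -> mu.-integrable `]s, t] (EFin \o u).
    by move=> ui; apply: integrableS ui.
  have iZ c u : mu.-integrable setT (EFin \o u) -> mu.-integrable `]s, t] (EFin \o (fun x => c * u x)).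
    by move=> /iS; exact: integrableZ_fun.
  have -> : Phi t - Phi s = f t * (g t - g s) + g s * (f t - f s) - \int[mu]_(x in `]s, t]) h x.
    by rewrite -Rintegral_itv_split // /Phi; ring.
  rewrite fE // gE // -!RintegralZl //; try exact: iS.
  rewrite -RintegralD //; try exact: iZ.
  have iA : mu.-integrable `]s, t] (EFin \o (fun x => f t * G x + g s * F x)).
    by apply: integrableD_fun; [exact: measurable_itv|exact: iZ|exact: iZ].
  rewrite -RintegralB //; last exact: iS.
  have iB : mu.-integrable `]s, t] (EFin \o (fun x => f t * G x + g s * F x - h x)).
    by apply: integrableB_fun; [exact: measurable_itv|exact: iA|exact: iS].
  apply: (le_trans (le_normr_Rintegral _ iB)) => //.
  rewrite ms // -RintegralZl //; last exact: iS.
  apply: le_Rintegral => //.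
  - by apply: integrable_norm_fun; [exact: measurable_itv|exact: iB].
  - exact: iZ.
  move=> x; rewrite /= in_itv /= => /andP[sx xt].
  have x0 : 0 <= x by rewrite (le_trans s0) // ltW.
  have -> : f t * G x + g s * F x - h x = (f t - f x) * G x + (g s - g x) * F x by rewrite /h; ring.
  have h1 : `|f t - f x| <= e by apply: fd => //; lra.
  have h2 : `|g s - g x| <= e.
    by rewrite distrC; apply: gd => //; [exact: ltW|exact: le_trans xt tT|lra].
  rewrite (le_trans (ler_normD _ _)) // !normrM /k mulrDr addrC.
  by rewrite lerD // ler_wpM2r.
pose n := (Num.truncn (T / Num.min d1 d2)).+1.
have dd : 0 < Num.min d1 d2 by rewrite lt_min d10.
pose eta := T / n%:R.
have n0 : 0 < n%:R :> R by rewrite ltr0n.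
have eta0 : 0 < eta by rewrite divr_gt0.
have etan : eta * n%:R = T by rewrite divfK // gt_eqF.
have etad : eta < Num.min d1 d2.
  by rewrite ltr_pdivrMr // mulrC -ltr_pdivrMr // truncnS_gt.
have Phi0 : Phi 0 = 0 by rewrite /Phi set_itvoc0 Rintegral_set0 !subrr.
have m0 : m 0 = 0 by rewrite /m set_itvoc0 Rintegral_set0.
have ind j : (j <= n)%N -> `|Phi (eta * j%:R)| <= e * m (eta * j%:R).
  elim: j => [|j IH] jn; first by rewrite mulr0 Phi0 m0 normr0 mulr0.
  have e1 : eta * j.+1%:R - eta * j%:R = eta by rewrite -natr1; ring.
  have := step (eta * j%:R) (eta * j.+1%:R).
  rewrite e1 => hstep.
  have {}hstep : `|Phi (eta * j.+1%:R) - Phi (eta * j%:R)| <= e * (m (eta * j.+1%:R) - m (eta * j%:R)).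
    apply: hstep.
    - by rewrite mulr_ge0 // ltW.
    - by rewrite ler_pM2l // ler_nat.
    - by rewrite -etan ler_pM2l // ler_nat.
    - by apply: (lt_le_trans etad); rewrite ge_min lexx.
    - by apply: (lt_le_trans etad); rewrite ge_min lexx orbT.
  have := ler_normD (Phi (eta * j.+1%:R) - Phi (eta * j%:R)) (Phi (eta * j%:R)).
  rewrite subrK; have := IH (ltnW jn); clear -hstep; lra.
by have := ind n (leqnn n); rewrite etan.
Qed.
End acd_theory.

(** * Weak derivatives *)

Section smooth_step.
Variables (R : realType).
Notation mu := (@lebesgue_measure R).

Lemma is_derive_quadratic_error (f : R -> R) (x l K : R) : 0 <= K ->
  (forall h, `|f (x + h) - f x - l * h| <= K * h ^+ 2) -> is_derive x 1 f l.
Proof.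
move=> K0 fK.
have cv : (fun h => h^-1 *: (f (h *: 1 + x) - f x)) @ 0^' --> l.
  apply/cvgrPdist_le => e e0.
  near=> h.
  have h0 : h != 0 by near: h; exact: nbhs_dnbhs_neq.
  have hn : 0 < `|h| by rewrite normr_gt0.
  have -> : l - h^-1 *: (f (h *: 1 + x) - f x) = - (h^-1 * (f (x + h) - f x - l * h)).
    rewrite [h *: 1](_ : _ = h); last by rewrite /GRing.scale /= mulr1.
    by rewrite (addrC h) /GRing.scale /=; field.
  rewrite normrN normrM normfV ler_pdivrMl //.
  apply: (le_trans (fK h)); rewrite -normr_id -(real_normK (num_real h)) expr2 normr_id.
  rewrite mulrA mulrC ler_pM2l //.
  have hK : `|h| <= e / (K + 1).
    near: h; apply: dnbhs0_le; rewrite divr_gt0 // ltr_wpDl //.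
  have := hK; rewrite ler_pdivlMr ?ltr_wpDl //; nra.
apply: DeriveDef; first by apply/cvg_ex; exists l.
by rewrite /derive; apply: cvg_lim.
Unshelve. all: by end_near.
Qed.

Definition pospart (x : R) := Num.max x 0.

(* A C^1 step from 0 to 1 on [s - d, s + d], whose derivative is the hat below. *)
Definition smooth_step (s d x : R) :=
  (pospart (x - s + d) ^+ 2 - 2 * pospart (x - s) ^+ 2 + pospart (x - s - d) ^+ 2) / (2 * d ^+ 2).

Definition hat (s d x : R) :=
  (pospart (x - s + d) - 2 * pospart (x - s) + pospart (x - s - d)) / d ^+ 2.

Lemma pospart_sqr_error (x h : R) :
  `|pospart (x + h) ^+ 2 - pospart x ^+ 2 - 2 * pospart x * h| <= h ^+ 2.
Proof.
rewrite /pospart !maxEle ler_norml.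
by case: (leP (x + h) 0) => h1; case: (leP x 0) => h2; apply/andP; split; nra.
Qed.

Lemma smooth_step_derive (s d x : R) : 0 < d -> is_derive x 1 (smooth_step s d) (hat s d x).
Proof.
move=> d0; have d2 : 0 < d ^+ 2 by rewrite exprn_gt0.
apply: (@is_derive_quadratic_error _ _ _ (2 / d ^+ 2)); first by rewrite divr_ge0 ?ltW.
move=> h; rewrite /smooth_step /hat.
have e1 := pospart_sqr_error (x - s + d) h.
have e2 := pospart_sqr_error (x - s) h.
have e3 := pospart_sqr_error (x - s - d) h.
have -> : x + h - s + d = x - s + d + h by ring.
have -> : x + h - s - d = x - s - d + h by ring.
have -> : x + h - s = x - s + h by ring.
set a := pospart _ in e1 *; set b := pospart _ in e1 *.
set a' := pospart _ in e2 *; set b' := pospart _ in e2 *.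
set a2 := pospart _ in e3 *; set b2 := pospart _ in e3 *.
rewrite [X in `|X|](_ : _ = ((a ^+ 2 - b ^+ 2 - 2 * b * h) - 2 * (a' ^+ 2 - b' ^+ 2 - 2 * b' * h)
   + (a2 ^+ 2 - b2 ^+ 2 - 2 * b2 * h)) / (2 * d ^+ 2)); last by field; rewrite gt_eqF.
rewrite normrM normfV (gtr0_norm (mulr_gt0 _ d2)) // ler_pdivrMr ?mulr_gt0 //.
rewrite (_ : 2 / d ^+ 2 * h ^+ 2 * (2 * d ^+ 2) = 4 * h ^+ 2); last by field; rewrite gt_eqF.
by move: e1 e2 e3; rewrite !ler_norml => /andP[? ?] /andP[? ?] /andP[? ?]; apply/andP; split; lra.
Qed.

Lemma hat_ge0 (s d x : R) : 0 < d -> 0 <= hat s d x.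
Proof.
move=> d0; rewrite /hat divr_ge0 ?sqr_ge0 // /pospart !maxEle.
by case: (leP (x - s + d) 0) => ?; case: (leP (x - s) 0) => ?; case: (leP (x - s - d) 0) => ?; lra.
Qed.

Lemma hat_out (s d x : R) : 0 < d -> ~~ (s - d <= x <= s + d) -> hat s d x = 0.
Proof.
move=> d0; rewrite negb_and -!ltNge /hat /pospart => /orP[h|h].
  by rewrite !max_r; lra.
by rewrite !max_l; last (by lra); last (by lra); last (by lra);
  rewrite (_ : _ + _ = 0) ?mul0r //; ring.
Qed.

Lemma smooth_step_lo (s d x : R) : 0 < d -> x <= s - d -> smooth_step s d x = 0.
Proof.
move=> d0 h; rewrite /smooth_step /pospart !max_r; try lra.
Qed.

Lemma smooth_step_hi (s d x : R) : 0 < d -> s + d <= x -> smooth_step s d x = 1.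
Proof.
move=> d0 h; rewrite /smooth_step /pospart !max_l; try lra.
by field; rewrite gt_eqF.
Qed.

Lemma hat_continuous (s d : R) : continuous (hat s d).
Proof.
have cp c : continuous (fun x => pospart (x - s + c)).
  move=> x; apply: (@continuous_max _ _ (fun x => x - s + c) (cst 0)); last exact: cst_continuous.
  by apply: cvgD; [apply: cvgB; [exact: cvg_id|exact: cvg_cst]|exact: cvg_cst].
have cp0 : continuous (fun x => pospart (x - s)).
  move=> x; apply: (@continuous_max _ _ (fun x => x - s) (cst 0)); last exact: cst_continuous.
  by apply: cvgB; [exact: cvg_id|exact: cvg_cst].
move=> x; apply: cvgM; last exact: cvg_cst.
apply: cvgD; last exact: (cp (- d)).
by apply: cvgB; [exact: cp|apply: cvgM; [exact: cvg_cst|exact: cp0]].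
Qed.

(** To the left of both transitions the two steps are 0 and to the right of both they are 1, so
    their difference has compact support. *)
Lemma test_function_step (T s t d : R) : 0 < d -> 0 < s - d -> s + d < T -> 0 < t - d -> t + d < T ->
  test_function T (fun x => smooth_step s d x - smooth_step t d x).
Proof.
move=> d0 s1 s2 t1 t2.
pose a := Num.min (s - d) (t - d); pose b := Num.max (s + d) (t + d).
have hD (x : R) : is_derive x 1 (fun x => smooth_step s d x - smooth_step t d x) (hat s d x - hat t d x).
  by apply: is_deriveB; exact: smooth_step_derive.
have sub : closure [set x | smooth_step s d x - smooth_step t d x != 0] `<=` `[a, b].
  have cl : (`[a, b]%classic : set R) = closure `[a, b] by apply/closure_id/interval_closed.
  rewrite cl; apply: closure_subset => x /=; rewrite in_itv /=; apply: contraR.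
  rewrite negb_and -!ltNge => /orP[h|h].
    rewrite !smooth_step_lo ?subrr //; apply/ltW/(lt_le_trans h); by rewrite ge_min lexx ?orbT.
  rewrite !smooth_step_hi ?subrr //; apply/ltW/(le_lt_trans _ h); by rewrite le_max lexx ?orbT.
split.
- by move=> x; have [] := hD x.
- rewrite (_ : derive1 _ = (fun x => hat s d x - hat t d x)).
    by move=> x; apply: cvgB; exact: hat_continuous.
  by apply/funext => x; rewrite derive1E; have [_] := hD x.
- by apply: (subclosed_compact _ (@segment_compact _ a b)) => //; exact: closed_closure.
- apply: (subset_trans sub) => x /=; rewrite !in_itv /= => /andP[h1 h2]; apply/andP; split.
    by apply: lt_le_trans h1; rewrite lt_min s1.
  by apply: (le_lt_trans h2); rewrite gt_max s2.
Qed.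

Lemma derive1_step (s t d x : R) : 0 < d ->
  derive1 (fun x => smooth_step s d x - smooth_step t d x) x = hat s d x - hat t d x.
Proof.
move=> d0; rewrite derive1E.
have h : is_derive x 1 (fun x => smooth_step s d x - smooth_step t d x) (hat s d x - hat t d x).
  by apply: is_deriveB; exact: smooth_step_derive.
by have [_] := h.
Qed.

(** The derivative is cut off outside [[0, T]] because [acd] asks for a density that is integrable
    on the whole line. *)
Lemma C1_acd (T : R) (phi dphi : R -> R) : 0 < T -> (forall x : R, is_derive x 1 phi (dphi x)) -> continuous dphi ->
  acd T phi (dphi \_ `[0, T]).
Proof.
move=> T0 hd cd; have T0' := ltW T0.
have ci (a b : R) : mu.-integrable `[a, b] (EFin \o dphi).
  apply: continuous_compact_integrable; first exact: segment_compact.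
  exact: continuous_subspaceT.
split.
  have mI : measurable (`[0, T]%classic : set (measurableTypeR R)) by exact: measurable_itv.
  have := ci 0 T => /(integrable_mkcond _ mI).
  by apply: eq_integrable => // x _; rewrite /patch /=; case: ifP.
move=> s t s0; rewrite le_eqVlt => /predU1P[->|st] tT.
  by rewrite subrr set_itvoc0 Rintegral_set0.
have F2 := @continuous_FTC2 R dphi phi s t st (continuous_subspaceT cd).
have cphi : continuous phi.
  by move=> x; apply: differentiable_continuous; apply/derivable1_diffP; have [] := hd x.
have -> : \int[mu]_(x in `]s, t]) (dphi \_ `[0, T]) x = \int[mu]_(x in `]s, t]) dphi x.
  apply: eq_Rintegral => x; rewrite inE /= in_itv /= => /andP[sx xt].
  by rewrite /patch mem_set //= in_itv /= (le_trans s0 (ltW sx)) (le_trans xt).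
rewrite /Rintegral integral_itv_obnd_cbnd; last first.
  by apply/measurable_EFinP/measurable_funTS; exact: continuous_measurable_fun.
rewrite F2 // => //.
- split; first by move=> x _; have [] := hd x.
    by apply: cvg_at_right_filter; exact: cphi.
  by apply: cvg_at_left_filter; exact: cphi.
- by move=> x _; rewrite derive1E; have [_] := hd x.
Qed.

End smooth_step.

Section weak.
Variables (R : realType).
Notation mu := (@lebesgue_measure R).
Implicit Types (f g G : R -> R).

Lemma integrable_patch (D : set (measurableTypeR R)) (f : R -> R) : measurable D ->
  mu.-integrable D (EFin \o f) <-> mu.-integrable setT (EFin \o (f \_ D)).
Proof.
move=> mD; split.
  move=> /(integrable_mkcond _ mD).
  by apply: eq_integrable => // x _; rewrite /patch /=; case: ifP.
move=> h; apply/(integrable_mkcond _ mD); move: h.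
by apply: eq_integrable => // x _; rewrite /patch /=; case: ifP.
Qed.

Lemma Rintegral_oc_oo (h : R -> R) (s t : R) : mu.-integrable setT (EFin \o h) ->
  \int[mu]_(x in `]s, t]) h x = \int[mu]_(x in `]s, t[) h x.
Proof.
move=> hint; rewrite -Rintegral_itv_bndo_bndc //.
by apply: integrableS hint => //; exact: measurable_itv.
Qed.

Lemma integrable_bounded_itv (T M : R) (f : R -> R) : measurable_fun `]0, T[ f ->
  (forall x, x \in `]0, T[ -> `|f x| <= M) ->
  mu.-integrable setT (EFin \o (f \_ `]0, T[)).
Proof.
move=> mf fM.
have mI : measurable (`]0, T[%classic : set (measurableTypeR R)) by exact: measurable_itv.
apply/(integrable_patch _ mI); apply: measurable_bounded_integrable => //.
- rewrite [ltLHS](lebesgue_measure_itv `]0, T[) /=.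
  by case: ifP => // _; rewrite -EFinB ltry.
- exists M; split; first exact: num_real.
  by move=> y My x /= xI; apply: le_trans (ltW My); exact: fM.
Qed.

Lemma L2_bounded (T M : R) (f : R -> R) : measurable_fun `]0, T[ f ->
  (forall x, x \in `]0, T[ -> `|f x| <= M) -> L2 T f.
Proof.
move=> mf fM; have fint := integrable_bounded_itv mf fM.
have mp : measurable_fun setT (f \_ `]0, T[) by apply/measurable_EFinP; exact: measurable_int fint.
have pM x : `|(f \_ `]0, T[) x| <= `|M|.
  rewrite /patch; case: ifPn => h; last by rewrite normr0.
  by rewrite (le_trans _ (ler_norm M)) // fM // -inE.
have := integrable_bounded_mul fint mp pM => sint.
rewrite /L2 inE; apply/andP; split; rewrite inE //=.
rewrite /finite_norm unlock poweR_lty //.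
apply: le_lt_trans (integrable_lty measurableT sint).
under eq_integral => x _ /= do rewrite powR_mulrn // real_normK ?num_real // expr2.
exact: lexx.
Qed.

Lemma L2_integrable (T : R) (f : R -> R) : L2 T f -> mu.-integrable setT (EFin \o (f \_ `]0, T[)).
Proof.
move=> hf; apply/Lfun1_integrable.
have h1 : L2 T (cst 1).
    have mc : measurable_fun `]0, T[ (cst 1 : R -> R) by exact: measurable_cst.
    by apply: (L2_bounded (M := 1) mc) => x _; rewrite /= normr1.
rewrite (_ : f \_ _ = f \_ `]0, T[ \* (cst 1 : R -> R) \_ `]0, T[); first exact: Lfun2_mul_Lfun1.
apply/funext => x.
by rewrite /patch /=; case: ifP => _; rewrite ?mulr1 ?mul0r.
Qed.

Lemma clamp_continuous_comp (T : R) (V : topologicalType) (f : R -> V) : 0 < T ->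
  {within `[0, T], continuous f} -> continuous (f \o clamp 0 T).
Proof.
move=> T_gt0 cf x; have := clamp_itv x (ltW T_gt0) => cI.
have {}cI : `[0, T]%classic (clamp 0 T x) by rewrite /= in_itv.
move=> A /cf hA.
have {}hA : within `[0, T] (nbhs (clamp 0 T x)) (f @^-1` A) by rewrite nbhs_subspace_in.
have hx : nbhs x (clamp 0 T @^-1` [set y | `[0, T]%classic y -> A (f y)]) by exact: clamp_continuous hA.
apply: filterS hx => y /= hy; apply: hy.
by have := clamp_itv y (ltW T_gt0); rewrite in_itv.
Qed.

Lemma clamp_bounded (T : R) (f : R -> R) : 0 < T -> {within `[0, T], continuous f} ->
  continuous (f \o clamp 0 T) /\ exists M, forall x, `|f (clamp 0 T x)| <= M.
Proof.
move=> T0 cf; split; first exact: clamp_continuous_comp.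
have := compact_bounded (continuous_compact cf (@segment_compact _ 0 T)).
move=> /pinfty_ex_gt0[M M0 hM]; exists M => x; apply: hM => /=.
by exists (clamp 0 T x) => //; rewrite /= in_itv; exact: clamp_itv (ltW T0).
Qed.

Lemma test_function0 (T : R) (phi : R -> R) x : test_function T phi -> ~~ (0 < x < T) -> phi x = 0.
Proof.
move=> [_ _ _ sub]; apply: contraNeq => /= phix.
have : closure [set t | phi t != 0] x by apply: subset_closure.
by move=> /sub; rewrite /= in_itv.
Qed.

Lemma test_function_bounded (T : R) (phi : R -> R) : 0 < T -> test_function T phi ->
  [/\ continuous phi, measurable_fun setT phi & exists M, forall x, `|phi x| <= M].
Proof.
move=> T0 tphi; have [dphi cphi' _ _] := tphi.
have cphi : continuous phi.
  by move=> x; apply: differentiable_continuous; apply/derivable1_diffP; exact: dphi.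
split => //; first exact: continuous_measurable_fun.
have [_ [M hM]] := clamp_bounded T0 (continuous_subspaceT cphi).
exists M => x; case: (boolP (0 < x < T)) => [/andP[x0 xT]|h].
  by have := hM x; rewrite clamp_id // ltW.
by rewrite (test_function0 tphi h) normr0 (le_trans _ (hM 0)).
Qed.

Lemma test_acd (T : R) (phi : R -> R) : 0 < T -> test_function T phi ->
  acd T phi (derive1 phi \_ `[0, T]).
Proof.
move=> T0 [dphi cphi' _ _]; apply: C1_acd => // x.
by rewrite derive1E; apply/derivableP.
Qed.

Lemma acd_test_product (T M : R) (f G phi : R -> R) : 0 < T -> acd T f G -> measurable_fun setT f ->
  (forall x, `|f x| <= M) -> test_function T phi ->
  [/\ mu.-integrable setT (EFin \o (fun x => f x * (derive1 phi \_ `[0, T]) x)),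
    mu.-integrable setT (EFin \o (fun x => phi x * G x)) &
   \int[mu]_(x in `]0, T[) (f x * derive1 phi x) = - \int[mu]_(x in `]0, T[) (G x * phi x)].
Proof.
move=> T0 acf mf fM tphi.
have [cphi mphi [M' phiM]] := test_function_bounded T0 tphi.
have acphi := test_acd T0 tphi.
have i1 := integrable_bounded_mul acphi.1 mf fM.
have i2 := integrable_bounded_mul acf.1 mphi phiM.
split => //.
have fM1 x : `|f x| <= Num.max M M' by rewrite le_max fM.
have phiM1 x : `|phi x| <= Num.max M M' by rewrite le_max phiM orbT.
have := acd_product T0 acf acphi mf mphi fM1 phiM1.
rewrite (test_function0 tphi (x := T)); last by rewrite ltxx andbF.
rewrite (test_function0 tphi (x := 0)); last by rewrite ltxx.
rewrite !mulr0 subrr RintegralD //; first last.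
- by apply: integrableS i2 => //; exact: measurable_itv.
- by apply: integrableS i1 => //; exact: measurable_itv.
move=> /esym/eqP; rewrite addr_eq0 => /eqP.
rewrite !Rintegral_oc_oo // => h.
have -> : \int[mu]_(x in `]0, T[) (f x * derive1 phi x) = \int[mu]_(x in `]0, T[) (f x * (derive1 phi \_ `[0, T]) x).
  apply: eq_Rintegral => x; rewrite inE /= in_itv /= => /andP[x0 xT].
  by rewrite /patch mem_set //= in_itv /= !ltW.
by rewrite h; congr (- _); apply: eq_Rintegral => x _; rewrite mulrC.
Qed.

Lemma acd_weak_derivative (T M : R) (f G : R -> R) : 0 < T -> acd T f G -> measurable_fun setT f ->
  (forall x, `|f x| <= M) -> weak_derivative T f G.
Proof. by move=> T0 acf mf fM phi tphi; have [] := acd_test_product T0 acf mf fM tphi. Qed.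

End weak.

(** * The lemma of du Bois-Reymond *)

Section du_bois_reymond.
Variables (R : realType).
Notation mu := (@lebesgue_measure R).
Implicit Types (f g G : R -> R).

(** The hats form an approximate identity: their integral is the increment 1 of [smooth_step], and
    for small [d] they live where [w] is within [e] of [w s]. *)
Lemma hat_mean (T s e : R) (w : R -> R) (M : R) : continuous w -> (forall x, `|w x| <= M) ->
  0 < s -> s < T -> 0 < e ->
  exists2 d0, 0 < d0 & forall d, 0 < d -> d < d0 -> [/\ 0 < s - d, s + d < T,
    mu.-integrable setT (EFin \o (fun x => w x * (hat s d \_ `[0, T]) x)) &
    `|\int[mu]_(x in `]0, T]) (w x * (hat s d \_ `[0, T]) x) - w s| <= e].
Proof.
move=> cw wM s0 sT e0; have T0 : 0 < T by exact: lt_trans sT.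
have mw : measurable_fun setT w by exact: continuous_measurable_fun.
have /cvgrPdist_le /(_ _ e0) /nbhs_ballP[r /= r0 rP] := cw s.
exists (Num.min r (Num.min s (T - s))); first by rewrite !lt_min r0 s0 subr_gt0.
move=> d d0; rewrite !lt_min => /and3P[dr ds dT].
have ac : acd T (smooth_step s d) (hat s d \_ `[0, T]).
  by apply: C1_acd => // [x|]; [exact: smooth_step_derive|exact: hat_continuous].
set k := hat s d \_ `[0, T] in ac *.
have kint := ac.1.
have i1 := integrable_bounded_mul kint mw wM.
split => //; try lra.
have mI : measurable (`]0, T]%classic : set (measurableTypeR R)) by exact: measurable_itv.
have iI u : mu.-integrable setT (EFin \o u) -> mu.-integrable `]0, T] (EFin \o u).
  by move=> ui; apply: integrableS ui.
have k1 : \int[mu]_(x in `]0, T]) k x = 1.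
  by rewrite -ac.2 // ?ltW // smooth_step_hi // ?smooth_step_lo ?subr0 //; lra.
have -> : w s = \int[mu]_(x in `]0, T]) (w s * k x).
  by rewrite RintegralZl ?k1 ?mulr1 //; exact: iI.
have iws : mu.-integrable `]0, T] (EFin \o (fun x => w s * k x)).
  by apply: integrableZ_fun => //; exact: iI.
rewrite -RintegralB //; last exact: iI.
have iB : mu.-integrable `]0, T] (EFin \o (fun x => w x * k x - w s * k x)).
  by apply: integrableB_fun => //; exact: iI.
apply: (le_trans (le_normr_Rintegral _ iB)) => //.
have -> : e = \int[mu]_(x in `]0, T]) (e * k x).
  by rewrite RintegralZl ?k1 ?mulr1 //; exact: iI.
apply: le_Rintegral => //.
- exact: integrable_norm_fun.
- by apply: integrableZ_fun => //; exact: iI.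
move=> x _; rewrite -mulrBl normrM.
have k0 : 0 <= k x by rewrite /k /patch; case: ifP => // _; exact: hat_ge0.
rewrite (ger0_norm k0).
case: (boolP (s - d <= x <= s + d)) => [/andP[h1 h2]|h]; last first.
  suff -> : k x = 0 by rewrite !mulr0.
  by rewrite /k /patch; case: ifP => // _; exact: hat_out.
apply: ler_wpM2r => //; rewrite distrC; apply: rP.
by rewrite /ball /= ltr_norml; apply/andP; split; lra.
Qed.

(** The difference of two smooth steps is a test function whose derivative is the difference of the
    hats at [s] and [t]; letting their width shrink gives [w s = w t] for interior points, and
    continuity adds the end points. *)
Lemma du_bois_reymond (T M : R) (w : R -> R) : 0 < T -> continuous w -> (forall x, `|w x| <= M) ->
  (forall phi, test_function T phi -> \int[mu]_(x in `]0, T[) (w x * derive1 phi x) = 0) ->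
  forall s t, 0 <= s <= T -> 0 <= t <= T -> w s = w t.
Proof.
move=> T0 cw wM wphi.
have inner s t : 0 < s < T -> 0 < t < T -> w s = w t.
  move=> /andP[s0 sT] /andP[t0 tT].
  apply/eqP; rewrite -subr_eq0 -normr_le0; apply/ler_addgt0Pr => e e0; rewrite add0r.
  have e2 : 0 < e / 2 by rewrite divr_gt0.
  have [d1 d10 h1] := hat_mean cw wM s0 sT e2.
  have [d2 d20 h2] := hat_mean cw wM t0 tT e2.
  pose d := Num.min d1 d2 / 2.
  have dd : 0 < Num.min d1 d2 by rewrite lt_min d10.
  have d0 : 0 < d by rewrite divr_gt0.
  have [|s1 s2 is_ hs] := h1 d d0.
    by apply: (@lt_le_trans _ _ (Num.min d1 d2)); [rewrite /d; lra|rewrite ge_min lexx].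
  have [|t1 t2 it_ ht] := h2 d d0.
    by apply: (@lt_le_trans _ _ (Num.min d1 d2)); [rewrite /d; lra|rewrite ge_min lexx orbT].
  have tphi := test_function_step d0 s1 s2 t1 t2.
  have := wphi _ tphi.
  rewrite (_ : \int[mu]_(x in _) _ = \int[mu]_(x in `]0, T]) (w x * (hat s d \_ `[0, T]) x) -
     \int[mu]_(x in `]0, T]) (w x * (hat t d \_ `[0, T]) x)); last first.
    rewrite !Rintegral_oc_oo // -RintegralB //; first last.
    - by apply: integrableS it_ => //; exact: measurable_itv.
    - by apply: integrableS is_ => //; exact: measurable_itv.
    apply: eq_Rintegral => x; rewrite inE /= in_itv /= => /andP[x0 xT].
    rewrite derive1_step // /patch mem_set /=; first by rewrite mulrBr.
    by rewrite in_itv /= !ltW.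
  move: hs ht; rewrite !ler_norml => /andP[a1 a2] /andP[a3 a4] a5.
  by clear -a1 a2 a3 a4 a5; apply/andP; split; lra.
have T2 : 0 < T / 2 < T by apply/andP; split; lra.
suff edge s : 0 <= s <= T -> w s = w (T / 2) by move=> s t hs ht; rewrite !edge.
move=> /andP[s0 sT].
apply/eqP; rewrite -subr_eq0 -normr_le0; apply/ler_addgt0Pr => e e0; rewrite add0r.
have /cvgrPdist_le /(_ _ e0) /nbhs_ballP[r /= r0 rP] := cw s.
pose d := Num.min (r / 2) (T / 4).
have d0 : 0 < d by rewrite lt_min !divr_gt0.
have [dr dT] : d <= r / 2 /\ d <= T / 4 by rewrite !ge_min !lexx orbT.
pose x := if s <= T / 2 then s + d else s - d.
have xT : 0 < x < T by rewrite /x; case: (leP s (T / 2)) => ?; apply/andP; split; lra.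
rewrite -(inner _ _ xT T2); apply: rP.
by rewrite /ball /= /x ltr_norml; case: ifP => _; apply/andP; split; lra.
Qed.

(** The primitive [F] of [g] has the same weak derivative as [f], so [f - F] is constant on
    [[0, T]]. *)
Lemma weak_derivative_acd (T : R) (f g : R -> R) : 0 < T -> {within `[0, T], continuous f} -> L2 T g ->
  weak_derivative T f g -> acd T (f \o clamp 0 T) (g \_ `]0, T[).
Proof.
move=> T0 cf gL2 fg; have T0' := ltW T0.
have Gint := L2_integrable gL2; set G := g \_ _ in Gint *.
have [cfc [M fM]] := clamp_bounded T0 cf.
pose F t := \int[mu]_(x in `]0, clamp 0 T t]) G x.
have acF : acd T F G.
  split => // s t s0 st tT; rewrite /F !clamp_id //; [|exact: le_trans tT|exact: le_trans st].
  exact: Rintegral_itv_split.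
have cF : continuous F.
  move=> x; apply/cvgrPdist_le => e e0.
  have [d d0 dP] := acd_equicontinuous acF e0.
  have FC y : F (clamp 0 T y) = F y.
    by rewrite /F; have /andP[? ?] := clamp_itv y T0'; rewrite (clamp_id (t := clamp 0 T y)).
  have hle s t : s <= t -> t - s < d -> `|F t - F s| <= e.
    move=> st std; rewrite -(FC s) -(FC t).
    have /andP[? ?] := clamp_itv s T0'; have /andP[? ?] := clamp_itv t T0'.
    by have /andP[? ?] := clamp_dist 0 T st; apply: dP => //; lra.
  apply/nbhs_ballP; exists d => // y; rewrite /ball /= => xy.
  case: (leP x y) => h.
    by rewrite distrC; apply: hle => //; apply: le_lt_trans xy; rewrite distrC ler_norm.
  by apply: hle; [exact: ltW|apply: le_lt_trans xy; exact: ler_norm].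
have [_ [M' FM]] := clamp_bounded T0 (continuous_subspaceT cF).
have {}FM x : `|F x| <= M'.
  by have := FM x; rewrite /F; have /andP[? ?] := clamp_itv x T0'; rewrite (clamp_id (t := clamp 0 T x)).
pose w x := f (clamp 0 T x) - F x.
have cw : continuous w by move=> x; apply: cvgB; [exact: cfc|exact: cF].
have wM x : `|w x| <= M + M' by rewrite (le_trans (ler_normB _ _)) // lerD.
have mF : measurable_fun setT F by exact: continuous_measurable_fun.
have mfc : measurable_fun setT (f \o clamp 0 T) by exact: continuous_measurable_fun.
have wphi phi : test_function T phi -> \int[mu]_(x in `]0, T[) (w x * derive1 phi x) = 0.
  move=> tphi; have [iF _ FE] := acd_test_product T0 acF mF FM tphi.
  have acphi := test_acd T0 tphi.
  have ifc := integrable_bounded_mul acphi.1 mfc fM.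
  have := fg _ tphi.
  have -> : \int[mu]_(t in `]0, T[) (f t * derive1 phi t) =
      \int[mu]_(x in `]0, T[) ((f \o clamp 0 T) x * (derive1 phi \_ `[0, T]) x).
    apply: eq_Rintegral => x; rewrite inE /= in_itv /= => /andP[x0 xT].
    by rewrite clamp_id ?(ltW x0) ?(ltW xT) // /patch mem_set //= in_itv /= !ltW.
  have -> : \int[mu]_(t in `]0, T[) (g t * phi t) = \int[mu]_(t in `]0, T[) (G t * phi t).
    by apply: eq_Rintegral => x xI; rewrite /G /patch xI.
  rewrite -FE => h.
  have FE2 : \int[mu]_(x in `]0, T[) (F x * derive1 phi x) =
      \int[mu]_(x in `]0, T[) (F x * (derive1 phi \_ `[0, T]) x).
    apply: eq_Rintegral => x; rewrite inE /= in_itv /= => /andP[x0 xT].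
    by rewrite /patch mem_set //= in_itv /= !ltW.
  have -> : \int[mu]_(x in `]0, T[) (w x * derive1 phi x) =
      \int[mu]_(x in `]0, T[) ((f \o clamp 0 T) x * (derive1 phi \_ `[0, T]) x - F x * (derive1 phi \_ `[0, T]) x).
    apply: eq_Rintegral => x; rewrite inE /= in_itv /= => /andP[x0 xT].
    by rewrite /patch mem_set //= ?in_itv /= ?ltW // mulrBl.
  rewrite RintegralB //; first last.
  - by apply: integrableS iF => //; exact: measurable_itv.
  - by apply: integrableS ifc => //; exact: measurable_itv.
  by rewrite h FE2 subrr.
split => // s t s0 st tT.
have := du_bois_reymond T0 cw wM wphi (s := s) (t := t).
rewrite s0 tT (le_trans st tT) (le_trans s0 st) => /(_ isT isT).
by rewrite -acF.2 // /w /= => h; lra.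
Qed.

End du_bois_reymond.

(** * The functional *)

Section conjugate_measurable.
Variables (R : realType) (d : nat).
Notation mu := (@lebesgue_measure R).

Definition rat_vec (n : nat) : 'rV[R]_d :=
  if @unpickle 'rV[rat]_d n is Some r then map_mx ratr r else 0.

Lemma rat_vec_dense (x : 'rV[R]_d) e : 0 < e -> exists n, `|x - rat_vec n| <= e.
Proof.
move=> e0.
have /choice[f fP] : forall i : 'I_d, exists q : rat, `|x 0 i - ratr q| <= e.
  move=> i; have [|q] := @rat_in_itvoo R (x 0 i - e) (x 0 i + e); first by lra.
  rewrite in_itv /= => /andP[h1 h2]; exists q.
  by rewrite ler_norml; apply/andP; split; lra.
exists (pickle (\row_i f i)); rewrite /rat_vec pickleK.
apply/mx_norm_leP; first exact: ltW.
by move=> i j; rewrite !mxE ord1.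
Qed.

(* A supremum over countably many points, hence measurable in y. *)
Lemma conjugate_esups (F : 'rV[R]_d -> R) y : continuous F ->
  conjugate (@dotv R d) F y = esups (fun n => (dotv (rat_vec n) y - F (rat_vec n))%:E) 0%N.
Proof.
move=> cF; apply/eqP; rewrite eq_le; apply/andP; split; last first.
  by apply: ub_ereal_sup => _ [n _ <-]; apply: ereal_sup_ubound; exists (rat_vec n).
apply: ub_ereal_sup => _ [x _ <-].
apply/lee_addgt0Pr => e e0.
have cg : continuous (fun x => dotv x y - F x).
  move=> z; apply: (@cvgB _ _ _ _ (nbhs_filter z)); last exact: cF.
  by apply: cvg_dotv; [exact: cvg_id|exact: cvg_cst].
have /cvgrPdist_le /(_ _ e0) /nbhs_ballP[r /= r0 rP] := cg x.
have r2 : 0 < r / 2 by rewrite divr_gt0.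
have [n xn] := rat_vec_dense x r2.
have : `|dotv x y - F x - (dotv (rat_vec n) y - F (rat_vec n))| <= e.
  by apply: rP; rewrite -ball_normE /ball_ /=; lra.
rewrite ler_norml => /andP[_ h].
have hn : ((dotv (rat_vec n) y - F (rat_vec n))%:E <=
   esups (fun n => (dotv (rat_vec n) y - F (rat_vec n))%:E) 0%N)%E.
  by apply: ereal_sup_ubound; exists n.
apply: (@le_trans _ _ ((dotv (rat_vec n) y - F (rat_vec n))%:E + e%:E)%E).
  by rewrite -EFinD lee_fin; lra.
exact: leeD2r.
Qed.

Lemma measurable_dotv (D : set (measurableTypeR R)) (a b : R -> 'rV[R]_d) :
  (forall i, measurable_fun D (fun t => a t 0 i)) -> (forall i, measurable_fun D (fun t => b t 0 i)) ->
  measurable_fun D (fun t => dotv (a t) (b t)).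
Proof. by move=> ma mb; apply: measurable_sum => i; exact: measurable_funM. Qed.

Lemma measurable_conjugate (D : set (measurableTypeR R)) (F : 'rV[R]_d -> R) (b : R -> 'rV[R]_d) :
  continuous F -> (forall i, measurable_fun D (fun t => b t 0 i)) ->
  measurable_fun D (fun t => conjugate (@dotv R d) F (b t)).
Proof.
move=> cF mb.
rewrite (_ : (fun t => _) = (fun t => esups (fun n => (dotv (rat_vec n) (b t) - F (rat_vec n))%:E) 0%N)).
  apply: measurable_fun_esups => n; apply/measurable_EFinP; apply: measurable_funB; last exact: measurable_cst.
  by apply: measurable_dotv => // i; exact: measurable_cst.
by apply/funext => t; exact: conjugate_esups.
Qed.

Lemma conjugate_ge (F : 'rV[R]_d -> R) x y : ((dotv x y - F x)%:E <= conjugate (@dotv R d) F y)%E.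
Proof. by apply: ereal_sup_ubound; exists x. Qed.

Lemma conjugate_subdiff (F : 'rV[R]_d -> R) x y : subdiff F x y ->
  conjugate (@dotv R d) F y = (dotv x y - F x)%:E.
Proof.
move=> sF; apply/eqP; rewrite eq_le conjugate_ge andbT.
apply: ub_ereal_sup => _ [z _ <-]; rewrite lee_fin.
by have := sF z; rewrite dotvBr !(dotvC y); lra.
Qed.

End conjugate_measurable.

(** * Sobolev functions on the interval *)

Section W12_theory.
Variables (R : realType) (N : nat) (T : R).
Hypothesis T_gt0 : 0 < T.
Notation mu := (@lebesgue_measure R).
Implicit Types u v : W12 N T.

Lemma W12_coord_cont u i : {within `[0, T], continuous (fun t => u t 0 i)}.
Proof.
move=> x A hA; have := @w_fun_cont R N T u x ((fun y : 'rV[R]_N => y 0 i) @^-1` A).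
apply; exact: (@coord_continuous R 1 N 0 i).
Qed.

Definition coord_acd u i (f := fun t : R => u (clamp 0 T t) 0 i)
    (g := (fun t => w_der u t 0 i) \_ `]0, T[) :=
  [/\ acd T f g, measurable_fun setT f & exists M, forall x, `|f x| <= M].

Lemma W12_acd u i : coord_acd u i.
Proof.
have [cf [M fM]] := clamp_bounded T_gt0 (@W12_coord_cont u i).
split.
- exact: weak_derivative_acd (@W12_coord_cont u i) (w_der_L2 u i) (w_derP u i).
- exact: continuous_measurable_fun.
- by exists M.
Qed.

Lemma measurable_w_der u i : measurable_fun `]0, T[ (fun t => w_der u t 0 i).
Proof.
have [[Gint _] _ _] := W12_acd u i.
apply/measurable_restrictT; first exact: measurable_itv.
by apply/measurable_EFinP; exact: measurable_int Gint.
Qed.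

Lemma measurable_w_fun u i : measurable_fun `]0, T[ (fun t => u t 0 i).
Proof.
have [_ mf _] := W12_acd u i.
apply: (eq_measurable_fun (fun t => u (clamp 0 T t) 0 i)); last exact: measurable_funTS.
by move=> x; rewrite inE /= in_itv /= => /andP[x0 xT]; rewrite clamp_id // ltW.
Qed.

Lemma Rintegral_sum (D : set (measurableTypeR R)) (h : 'I_N -> R -> R) : measurable D ->
  (forall i, mu.-integrable D (EFin \o h i)) ->
  mu.-integrable D (EFin \o (fun x => \sum_i h i x)) /\
  \int[mu]_(x in D) (\sum_i h i x) = \sum_i \int[mu]_(x in D) h i x.
Proof.
move=> mD hi.
elim: (index_enum _) => [|i s [IHi IH]].
  split; last by under eq_Rintegral do rewrite big_nil; rewrite big_nil Rintegral_cst // mul0r.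
  rewrite (_ : EFin \o _ = cst 0%E); first exact: integrable0.
  by apply/funext => x; rewrite /= big_nil.
split; last first.
  under eq_Rintegral do rewrite big_cons.
  by rewrite big_cons RintegralD // IH.
rewrite (_ : EFin \o _ = EFin \o (fun x => h i x + \sum_(j <- s) h j x)); first exact: integrableD_fun.
by apply/funext => x; rewrite /= big_cons.
Qed.

Lemma W12_product u v :
  let h t := dotv (u t) (w_der v t) + dotv (v t) (w_der u t) in
  mu.-integrable `]0, T[ (EFin \o h) /\
  \int[mu]_(t in `]0, T[) h t = dotv (u T) (v T) - dotv (u 0) (v 0).
Proof.
move=> h.
pose k i t := u (clamp 0 T t) 0 i * ((fun t => w_der v t 0 i) \_ `]0, T[) t +
  v (clamp 0 T t) 0 i * ((fun t => w_der u t 0 i) \_ `]0, T[) t.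
have mI : measurable (`]0, T[%classic : set (measurableTypeR R)) by exact: measurable_itv.
have kP i : mu.-integrable setT (EFin \o k i) /\
    \int[mu]_(t in `]0, T]) k i t = u T 0 i * v T 0 i - u 0 0 i * v 0 0 i.
  have [au mu' [M uM]] := W12_acd u i; have [av mv [M' vM]] := W12_acd v i.
  have uM1 x : `|u (clamp 0 T x) 0 i| <= Num.max M M' by rewrite le_max uM.
  have vM1 x : `|v (clamp 0 T x) 0 i| <= Num.max M M' by rewrite le_max vM orbT.
  have iu := integrable_bounded_mul au.1 mv vM.
  have iv := integrable_bounded_mul av.1 mu' uM.
  split; first exact: integrableD_fun.
  have /= := acd_product T_gt0 au av mu' mv uM1 vM1.
  by rewrite !clamp_id // ?(ltW T_gt0) // => ->.
have iS i : mu.-integrable `]0, T[ (EFin \o k i).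
  by have [ki _] := kP i; apply: integrableS ki.
have [si sE] := Rintegral_sum mI iS.
have hE x : x \in `]0, T[%classic -> h x = \sum_i k i x.
  move=> xI; rewrite /h /dotv -big_split /=; apply: eq_bigr => i _.
  move: (xI); rewrite inE /= in_itv /= => /andP[x0 xT].
  by rewrite /k /patch xI clamp_id // ltW.
split; first by apply: eq_integrable si => // x xI; rewrite /= hE // mem_set.
rewrite (_ : \int[mu]_(t in _) h t = \int[mu]_(t in `]0, T[) (\sum_i k i t)); last first.
  by apply: eq_Rintegral => x; exact: hE.
rewrite sE.
rewrite /dotv -sumrB; apply: eq_bigr => i _.
by rewrite -Rintegral_oc_oo; [exact: (kP i).2|exact: (kP i).1].
Qed.

End W12_theory.

(** [H] as a function of one row vector, to which the convex analysis above applies. *)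
Definition joined (R : realType) (N : nat) (H : 'rV[R]_N * 'rV[R]_N -> R) (z : 'rV[R]_(N + N)) : R :=
  H (lsubmx z, rsubmx z).

Section functional.
Variables (R : realType) (N : nat) (T d1 d2 : R).
Variables (H : 'rV[R]_N * 'rV[R]_N -> R) (psi1 psi2 : 'rV[R]_N -> R).
Hypotheses (T_gt0 : 0 < T) (H_cont : continuous (joined H)).
Notation mu := (@lebesgue_measure R).
Notation Hr := (joined H).
Implicit Types u v : W12 N T.

Lemma joinedE p q : Hr (row_mx p q) = H (p, q).
Proof. by rewrite /joined row_mxKl row_mxKr. Qed.

Lemma conjugate_joined p q : conjugate (@dotvv R N) H (p, q) = conjugate (@dotv R _) Hr (row_mx p q).
Proof.
rewrite /conjugate; congr ereal_sup; apply/seteqP; split => [_ [[a b] _ <-]|_ [z _ <-]].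
  by exists (row_mx a b) => //; rewrite joinedE dotv_row_mx.
by exists (lsubmx z, rsubmx z) => //; rewrite /dotvv /= -dotv_row_mx hsubmxK.
Qed.

Lemma continuous_row_mx (S : topologicalType) (f g : S -> 'rV[R]_N) : continuous f -> continuous g ->
  continuous (fun x => row_mx (f x) (g x)).
Proof.
move=> cf cg x; apply/cvgrPdist_le => e e0.
have /cvgrPdist_le /(_ _ e0) := cf x; have /cvgrPdist_le /(_ _ e0) := cg x.
apply: filterS2 => y hg hf; rewrite opp_row_mx add_row_mx; exact: row_mx_norm_le.
Qed.

Lemma measurable_row_mx (D : set (measurableTypeR R)) (a b : R -> 'rV[R]_N) :
  (forall i, measurable_fun D (fun t => a t 0 i)) -> (forall i, measurable_fun D (fun t => b t 0 i)) ->
  forall i, measurable_fun D (fun t => row_mx (a t) (b t) 0 i).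
Proof.
move=> ma mb i; case: (split_ordP i) => j ->.
  by rewrite (_ : (fun t => _) = fun t => a t 0 j) //; apply/funext => t; rewrite row_mxEl.
by rewrite (_ : (fun t => _) = fun t => b t 0 j) //; apply/funext => t; rewrite row_mxEr.
Qed.

Lemma measurable_subZ (D : set (measurableTypeR R)) (a b : R -> 'rV[R]_N) c :
  (forall i, measurable_fun D (fun t => a t 0 i)) -> (forall i, measurable_fun D (fun t => b t 0 i)) ->
  forall i, measurable_fun D (fun t => (a t - c *: b t) 0 i).
Proof.
move=> ma mb i; rewrite (_ : (fun t => _) = fun t => a t 0 i - c * b t 0 i).
  by apply: measurable_funB => //; apply: measurable_funM => //; exact: measurable_cst.
by apply/funext => t; rewrite !mxE.
Qed.

Definition lagrangian u v t : \bar R :=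
  ((H (u t, v t))%:E
      + conjugate (@dotvv R N) H
          (- w_der v t - d2 *: u t, w_der u t - d1 *: v t)%R
      + (d1 * enorm (v t) ^+ 2 + d2 * enorm (u t) ^+ 2
         + 2 * dotv (w_der v t) (u t))%:E)%E.

Let h u v t := dotv (u t) (w_der v t) + dotv (v t) (w_der u t).

Lemma measurable_lagrangian u v : measurable_fun `]0, T[ (lagrangian u v).
Proof.
have mu0 := measurable_w_fun T_gt0 u; have mv := measurable_w_fun T_gt0 v.
have mu' := measurable_w_der T_gt0 u; have mv' := measurable_w_der T_gt0 v.
apply: emeasurable_funD; first apply: emeasurable_funD.
- apply/measurable_EFinP.
  apply: (eq_measurable_fun (fun t => Hr (row_mx (u (clamp 0 T t)) (v (clamp 0 T t))))).
    move=> x; rewrite inE /= in_itv /= => /andP[x0 xT].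
    by rewrite joinedE clamp_id // ltW.
  apply: measurable_funTS; apply: continuous_measurable_fun.
  have cz : continuous (fun t => row_mx (u (clamp 0 T t)) (v (clamp 0 T t))).
    apply: (@continuous_row_mx _ (u \o clamp 0 T) (v \o clamp 0 T)); apply: clamp_continuous_comp => //; exact: w_fun_cont.
  by move=> x; apply: (@continuous_comp _ _ _ _ Hr x (cz x)); exact: H_cont.
- apply: (eq_measurable_fun (fun t => conjugate (@dotv R _) Hr
    (row_mx (- w_der v t - d2 *: u t) (w_der u t - d1 *: v t)))).
    by move=> t _; rewrite conjugate_joined.
  have mb i : measurable_fun `]0, T[ (fun t => (row_mx (- w_der v t - d2 *: u t) (w_der u t - d1 *: v t)) 0 i).
    apply: measurable_row_mx; apply: measurable_subZ => // j.
    rewrite (_ : (fun t => _) = fun t => 0 - w_der v t 0 j).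
      apply: measurable_funB; [exact: measurable_cst|exact: mv'].
    by apply/funext => t; rewrite mxE sub0r.
  exact: measurable_conjugate.
- apply/measurable_EFinP; apply: measurable_funD; first apply: measurable_funD.
  + apply: measurable_funM; first exact: measurable_cst.
    apply: (eq_measurable_fun (fun t => dotv (v t) (v t))); last exact: measurable_dotv.
    by move=> t _; rewrite enorm_sqr.
  + apply: measurable_funM; first exact: measurable_cst.
    apply: (eq_measurable_fun (fun t => dotv (u t) (u t))); last exact: measurable_dotv.
    by move=> t _; rewrite enorm_sqr.
  + by apply: measurable_funM; [exact: measurable_cst|exact: measurable_dotv].
Qed.

(* The Young-Fenchel inequality bounds the integrand below by the derivative of the product of u and v. *)
Lemma lagrangian_ge u v t : ((h u v t)%:E <= lagrangian u v t)%E.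
Proof.
rewrite /lagrangian conjugate_joined -joinedE.
set y := row_mx (- _ - _) _; set z := row_mx (u t) (v t).
apply: (@le_trans _ _ ((Hr z)%:E + (dotv z y - Hr z)%:E + (d1 * enorm (v t) ^+ 2 + d2 * enorm (u t) ^+ 2
         + 2 * dotv (w_der v t) (u t))%:E)%E); last first.
  by apply: leeD2r; apply: leeD2l; exact: conjugate_ge.
rewrite -!EFinD lee_fin /z /y dotv_row_mx !dotvBr !dotvZr dotvNr !enorm_sqr /h (dotvC (w_der v t)).
lra.
Qed.

Lemma lagrangian_subdiff u v t :
  subdiff Hr (row_mx (u t) (v t)) (row_mx (- w_der v t - d2 *: u t) (w_der u t - d1 *: v t)) ->
  lagrangian u v t = (h u v t)%:E.
Proof.
move=> sd; rewrite /lagrangian conjugate_joined -joinedE (conjugate_subdiff sd) -!EFinD; congr EFin.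
by rewrite dotv_row_mx !dotvBr !dotvZr dotvNr !enorm_sqr /h (dotvC (w_der v t)); ring.
Qed.

Lemma functional_IE u v : functional_I d1 d2 H psi1 psi2 u v =
  (\int[mu]_(t in `]0%R, T[) lagrangian u v t + (psi2 (v T))%:E + conjugate (@dotv R N) psi2 (- u T)%R
   + (psi1 (u 0%R))%:E + conjugate (@dotv R N) psi1 (v 0%R))%E.
Proof. by []. Qed.

Let mI : measurable (`]0, T[%classic : set (measurableTypeR R)).
Proof. exact: measurable_itv. Qed.

Let hE u v : (\int[mu]_(t in `]0%R, T[) (h u v t)%:E =
  (dotv (u T) (v T) - dotv (u 0%R) (v 0%R))%:E)%E.
Proof.
have [hi hE] := W12_product T_gt0 u v.
by rewrite -hE /Rintegral fineK //; exact: integrable_fin_num.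
Qed.

Lemma functional_ge0 u v : (0 <= functional_I d1 d2 H psi1 psi2 u v)%E.
Proof.
have [hi _] := W12_product T_gt0 u v.
have mh : measurable_fun `]0, T[ (EFin \o h u v) by exact: measurable_int hi.
have ml := measurable_lagrangian u v.
have hle : (\int[mu]_(t in `]0%R, T[) (h u v t)%:E <= \int[mu]_(t in `]0%R, T[) lagrangian u v t)%E.
  (* The integrand of the functional may take the value +oo and need not be integrable, so the
     integrals are compared through their positive and negative parts. *)
  rewrite integralE [leRHS]integralE; apply: leeB; apply: ge0_le_integral => //.
  - exact: measurable_funepos.
  - exact: measurable_funepos.
  - by move=> t _; rewrite !funeposE; apply: le_max2 => //; exact: lagrangian_ge.
  - exact: measurable_funeneg.
  - exact: measurable_funeneg.
  - by move=> t _; rewrite !funenegE; apply: le_max2 => //; rewrite leeN2; exact: lagrangian_ge.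
rewrite functional_IE.
apply: (@le_trans _ _ ((dotv (u T) (v T) - dotv (u 0) (v 0))%:E + (psi2 (v T))%:E
   + (dotv (v T) (- u T) - psi2 (v T))%:E + (psi1 (u 0))%:E + (dotv (u 0) (v 0) - psi1 (u 0))%:E)%E).
  by rewrite -!EFinD lee_fin dotvNr (dotvC (v T)); lra.
apply: leeD; last exact: conjugate_ge.
apply: leeD => //; apply: leeD; last exact: conjugate_ge.
by apply: leeD => //; rewrite -hE.
Qed.

Lemma functional_eq0 u v :
  {ae mu, forall t, t \in `]0, T[ ->
    subdiff Hr (row_mx (u t) (v t)) (row_mx (- w_der v t - d2 *: u t) (w_der u t - d1 *: v t))} ->
  subdiff psi1 (u 0) (v 0) -> subdiff psi2 (v T) (- u T) ->
  functional_I d1 d2 H psi1 psi2 u v = 0%E.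
Proof.
move=> sH s1 s2; rewrite functional_IE (conjugate_subdiff s1) (conjugate_subdiff s2).
have [hi _] := W12_product T_gt0 u v.
have mh : measurable_fun `]0, T[ (EFin \o h u v) by exact: measurable_int hi.
rewrite (@ae_eq_integral _ _ _ mu `]0, T[ (EFin \o h u v)) //; last first.
- by apply: ae_imply sH => t ht tI; apply: lagrangian_subdiff; exact: ht.
- exact: measurable_lagrangian.
rewrite hE -!EFinD; congr EFin; rewrite dotvNr (dotvC (v T)); ring.
Qed.

End functional.

(** * Existence of a solution *)

(** Outside a ball the limit inferior gives the quadratic bound; inside, the affine lower bound
    does, and the constant pays for both. The strict inequality leaves room for [k' > k]. *)
Lemma liminf_quadratic_growth (R : realType) (N : nat) (psi : 'rV[R]_N -> R) (k : R) :
  convex_real psi -> (k%:E < liminf_quadratic psi)%E ->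
  exists k' C, k < k' /\ forall y, k' * dotv y y - C <= psi y - psi 0.
Proof.
move=> cpsi; rewrite /liminf_quadratic limf_einfE => /ereal_sup_gt[_ [A [M MA] <-]] hA.
have [k' kk' hk'] : exists2 k' : R, k < k' & (k'%:E <=
    ereal_inf [set (psi p / enorm p ^+ 2)%:E | p in A])%E.
  move: hA; case: (ereal_inf _) => [r| |] //.
    by rewrite lte_fin => kr; exists r.
  by move=> _; exists (k + 1); [lra|exact: leey].
have [K K0 KP] := convex_affine_lower cpsi.
pose m := Num.max M 0.
exists k', (`|k'| * m ^+ 2 + K * m + `|psi 0|); split => // y.
have ey : 0 <= enorm y by exact: sqrtr_ge0.
have m0 : 0 <= m by rewrite le_max lexx orbT.
have h1 := ler_norm (psi 0); have h2 := ler_norm k'; have n0 := normr_ge0 k'.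
case: (leP (enorm y) m) => hy.
  have y2 : dotv y y <= m ^+ 2 by rewrite -enorm_sqr ler_pXn2r // nnegrE.
  have nym : `|y| <= m.
    apply: le_trans hy; rewrite -(ler_pXn2r (ltn0Sn 1)) ?nnegrE // enorm_sqr; exact: sqr_norm_le_dotv.
  have y0 := dotv_ge0 y.
  have b1 : k' * dotv y y <= `|k'| * m ^+ 2.
    apply: (@le_trans _ _ (`|k'| * dotv y y)); first by rewrite ler_wpM2r.
    by rewrite ler_wpM2l.
  have b2 : K * `|y| <= K * m by rewrite ler_wpM2l.
  by have := KP y; have := normr_ge0 (psi 0); lra.
have hM : M < enorm y by apply: le_lt_trans hy; rewrite le_max lexx.
have ey0 : 0 < enorm y by exact: le_lt_trans hy.
have : (k'%:E <= (psi y / enorm y ^+ 2)%:E)%E.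
  by apply: le_trans hk' _; apply: ereal_inf_lbound; exists y => //; exact: MA.
rewrite lee_fin ler_pdivlMr ?exprn_gt0 // enorm_sqr => h.
have b1 : 0 <= `|k'| * m ^+ 2 by rewrite mulr_ge0 // sqr_ge0.
have b2 : 0 <= K * m by rewrite mulr_ge0.
lra.
Qed.

(** The inclusion is tested at [u / beta], the maximiser of [u . x - beta / 2 |x|^2]. This is the
    lower bound [|u|^2 / (2 beta) - gamma] for the conjugate, combined with [H >= - alpha]. *)
Lemma subquadratic_growth (R : realType) (N : nat) (H : 'rV[R]_N * 'rV[R]_N -> R) (beta : R) :
  subquadratic beta H -> exists2 C, 0 <= C & forall z u, subdiff (joined H) z u ->
    (2 * beta)^-1 * dotv u u - C <= dotv u z.
Proof.
move=> [b0 [alpha [gamma [a0 g0 hH]]]]; exists (alpha + gamma); first by lra.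
move=> z u /(_ (beta^-1 *: u)).
have HE (w : 'rV[R]_(N + N)) : - alpha <= joined H w <= beta / 2 * dotv w w + gamma.
  have := hH (lsubmx w) (rsubmx w); rewrite !enorm_sqr -dotv_row_mx hsubmxK; exact.
have /andP[h1 _] := HE z; have /andP[_ h2] := HE (beta^-1 *: u).
rewrite dotvZl !dotvZr in h2.
rewrite dotvBr dotvZr => h3.
have e1 : beta / 2 * (beta^-1 * (beta^-1 * dotv u u)) = (2 * beta)^-1 * dotv u u by field; rewrite gt_eqF.
have e2 : beta^-1 * dotv u u = 2 * ((2 * beta)^-1 * dotv u u) by field; rewrite gt_eqF.
rewrite e1 in h2; rewrite e2 in h3; lra.
Qed.

(** Each coordinate of the extension of [f] by constants has a bounded density by [lipschitz_acd].
    The limit from the right matches the forward intervals in [limit_difference_quotient]. *)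
Lemma lipschitz_W12 (R : realType) (N : nat) (T L : R) (f : R -> 'rV[R]_N) : 0 < T -> 0 <= L ->
    (forall s t, 0 <= s -> s <= t -> t <= T -> `|f t - f s| <= L * (t - s)) ->
  exists u : W12 N T, (forall t, 0 <= t -> t <= T -> u t = f t) /\
    {ae (@lebesgue_measure R), forall t, 0 < t < T ->
      e^-1 *: (f (t + e) - f t) @[e --> 0^'+] --> w_der u t}.
Proof.
move=> T0 L0 fL; have T0' := ltW T0.
pose g t := f (clamp 0 T t).
have gL s t : s <= t -> `|g t - g s| <= L * (t - s).
  move=> st; have /andP[s1 s2] := clamp_itv s T0'; have /andP[t1 t2] := clamp_itv t T0'.
  have /andP[c1 c2] := clamp_dist 0 T st.
  apply: (@le_trans _ _ (L * (clamp 0 T t - clamp 0 T s))); last by rewrite ler_wpM2l.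
  by apply: fL => //; rewrite -subr_ge0.
have cg : continuous g.
  apply: (@lipschitz_continuous_dist _ _ _ _ L) => x y.
  case: (leP x y) => xy.
    rewrite distrC (distrC x) (ger0_norm (x := y - x)) ?subr_ge0 //; exact: gL.
  by rewrite (gtr0_norm (x := x - y)) ?subr_gt0 //; apply: gL; exact: ltW.
pose gi i (t : R) : R := g t 0 i.
have cgi i : continuous (gi i).
  move=> x; apply: (@continuous_comp _ _ _ g (fun y : 'rV[R]_N => y 0 i)); first exact: cg.
  exact: (@coord_continuous R 1 N 0 i).
have giL i s t : 0 <= s -> s <= t -> t <= T -> `|gi i t - gi i s| <= L * (t - s).
  move=> _ st _; apply: le_trans (gL _ _ st).
  by have := coord_le_mx_norm (g t - g s) 0 i; rewrite !mxE.
have /choice[G GP] := fun i => lipschitz_acd T0 L0 (giL i).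
pose w t : 'rV[R]_N := \row_i G i t.
have wi i : (fun t => w t 0 i) = G i by apply/funext => t; rewrite mxE.
have bi i : exists M, forall x, `|gi i x| <= M.
  have [_ [M hM]] := clamp_bounded T0 (continuous_subspaceT (cgi i)); exists M => x.
  have := hM x; rewrite /gi /g.
  by have /andP[? ?] := clamp_itv x T0'; rewrite (clamp_id (t := clamp 0 T x)).
have mi i : measurable_fun setT (gi i) by exact: continuous_measurable_fun.
have uL2 i : L2 T (gi i).
  by have [M hM] := bi i; apply: (L2_bounded (M := M)) => //; exact: measurable_funTS.
have wL2 i : L2 T (fun t => w t 0 i).
  rewrite wi; have [_ mG GL _ _] := GP i.
  by apply: (L2_bounded (M := L)) => //; exact: measurable_funTS.
have uw i : weak_derivative T (gi i) (fun t => w t 0 i).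
  rewrite wi; have [aG _ _ _ _] := GP i; have [M hM] := bi i.
  exact: acd_weak_derivative aG (mi i) hM.
exists (Build_W12 (continuous_subspaceT cg) uL2 wL2 uw).
split=> /=; first by move=> t t0 tT; rewrite /g clamp_id.
(* Sets of full measure are intersected over a countable family: the coordinates are indexed through
   [nat], and the statement is vacuous beyond [N]. *)
have key : {ae (@lebesgue_measure R), forall t, forall n : nat, forall i : 'I_N, i = n :> nat -> 0 < t < T ->
     forall eta, 0 < eta -> exists2 d, 0 < d & forall e, 0 < e -> e < d ->
       `|e^-1 * (gi i (t + e) - gi i t) - G i t| <= eta}.
  apply: ae_foralln => n.
  case: (ltnP n N) => nN; last first.
    by apply: (@ae_imply _ (fun x => x != 0)); [move=> x _ i iN; have := ltn_ord i; rewrite iN ltnNge nN|exact: ae_neq].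
  have [_ _ _ _] := GP (Ordinal nN); apply: ae_imply => x hx i iN.
  by rewrite (_ : i = Ordinal nN) //; exact: val_inj.
apply: ae_imply key => t ht t0T; have /andP[t0 tT] := t0T.
apply/cvgrPdist_le => eta eta0.
have : \forall e \near 0^'+, forall i : 'I_N, `|e^-1 * (gi i (t + e) - gi i t) - G i t| <= eta.
  apply: filter_forall => i; have [d d0 dP] := ht i i erefl t0T eta eta0.
  near=> e; apply: dP; near: e; [exact: nbhs_right_gt|exact: nbhs_right_lt].
move=> h; near=> e.
have e0 : 0 < e by near: e; exact: nbhs_right_gt.
have eT : e < T - t by near: e; apply: nbhs_right_lt; rewrite subr_gt0.
apply/mx_norm_leP; first exact: ltW.
move=> j i; rewrite ord1 !mxE distrC.
have : forall i : 'I_N, `|e^-1 * (gi i (t + e) - gi i t) - G i t| <= eta by near: e.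
by move=> /(_ i); rewrite /gi /g !clamp_id //; clear -t0 tT e0 eT; lra.
Unshelve. all: by end_near.
Qed.

Section trajectory.
Variables (R : realType) (N : nat) (T d1 d2 beta : R).
Variables (H : 'rV[R]_N * 'rV[R]_N -> R) (psi1 psi2 : 'rV[R]_N -> R).
Hypotheses (T_gt0 : 0 < T) (beta_gt0 : 0 < beta).
Hypotheses (hd1 : `|d1| < 1 / (2 * T)) (hd2 : `|d2| < 1 / (2 * T)).
Hypotheses (H_convex : convex_real (joined H)).
Hypotheses (psi1_convex : convex_real psi1) (psi2_convex : convex_real psi2).
Hypothesis H_subquadratic : subquadratic beta H.
Hypothesis hbeta : beta < 1 / 4 *
       Num.min
         ((1 - 4 * T ^+ 2 * `|d1| ^+ 2)
            / (Num.max (2 * T ^+ 2) 1 - 2 * d1 * T ^+ 2))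
         ((1 - 4 * T ^+ 2 * `|d2| ^+ 2)
            / (Num.max (2 * T ^+ 2) 1 - 2 * d2 * T ^+ 2)).
Hypothesis psi1_liminf :
       ((T * `|d2| ^+ 2 / beta + 2 * T * (1 - d2))%:E
        < liminf_quadratic psi1)%E.
Hypothesis psi2_liminf :
       ((T * `|d1| ^+ 2 / beta - 2 * T * d1)%:E
        < liminf_quadratic psi2)%E.

Let B := (2 * beta)^-1.
Let B_gt0 : 0 < B. Proof. by rewrite invr_gt0 mulr_gt0. Qed.

Let betaB : beta * B = 1 / 2.
Proof. by have := beta_gt0; rewrite /B => b0; field; rewrite gt_eqF. Qed.

(** Each inequality is multiplied by [beta], and [beta * B = 1 / 2] turns it into one of
    [beta_conditions]. *)
Let B_bounds : [/\ 5 / 3 < B, 2 * T ^+ 2 * (B * d2 ^+ 2 + 1 - d2) < B / 2 &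
  1 + 2 * T ^+ 2 * (B * d1 ^+ 2 - d1) < B / 2].
Proof.
have b0 := beta_gt0; have B0 := B_gt0; have bB := betaB.
have hb1 : beta < 1 / 4 * ((1 - 4 * T ^+ 2 * `|d1| ^+ 2) / (Num.max (2 * T ^+ 2) 1 - 2 * d1 * T ^+ 2)).
  by apply: (lt_le_trans hbeta); rewrite ler_pM2l ?ge_min ?lexx // divr_gt0.
have hb2 : beta < 1 / 4 * ((1 - 4 * T ^+ 2 * `|d2| ^+ 2) / (Num.max (2 * T ^+ 2) 1 - 2 * d2 * T ^+ 2)).
  by apply: (lt_le_trans hbeta); rewrite ler_pM2l ?ge_min ?lexx ?orbT // divr_gt0.
have [_ h2 h3] := beta_conditions T_gt0 beta_gt0 hd1 hb1.
have [g1 _ _] := beta_conditions T_gt0 beta_gt0 hd2 hb2.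
have scale x y : beta * x < beta * y -> x < y by rewrite ltr_pM2l.
have Hq : 1 + 2 * T ^+ 2 * (B * d1 ^+ 2 - d1) < B / 2.
  apply: scale.
  have -> : beta * (1 + 2 * T ^+ 2 * (B * d1 ^+ 2 - d1)) = beta + 2 * T ^+ 2 * ((beta * B) * d1 ^+ 2 - beta * d1) by ring.
  have -> : beta * (B / 2) = beta * B / 2 by ring.
  by rewrite bB; lra.
split => //; last first.
  apply: scale.
  have -> : beta * (2 * T ^+ 2 * (B * d2 ^+ 2 + 1 - d2)) = 2 * T ^+ 2 * ((beta * B) * d2 ^+ 2 + beta * (1 - d2)) by ring.
  have -> : beta * (B / 2) = beta * B / 2 by ring.
  by rewrite bB; lra.
case: (leP 0 d1) => hd.
  by apply: scale; rewrite bB; have := h3 hd; lra.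
(* For negative [d1] this term is nonnegative, and [Hq] alone gives [B > 2]. *)
have c0 : 0 <= 2 * T ^+ 2 * (B * d1 ^+ 2 - d1).
  apply: mulr_ge0; first by apply: mulr_ge0 => //; exact: sqr_ge0.
  rewrite subr_ge0 (le_trans (ltW hd)) //; apply: mulr_ge0; [exact: ltW|exact: sqr_ge0].
by lra.
Qed.

Lemma approximate_solutions : exists C, forall n, (0 < n)%N -> exists p q : nat -> 'rV[R]_N,
  let h := T / n%:R in
  [/\ forall k, (k < n)%N -> subdiff (joined H) (row_mx (p k) (q k.+1))
         (row_mx (h^-1 *: (q k - q k.+1) - d2 *: p k) (h^-1 *: (p k.+1 - p k) - d1 *: q k.+1)),
      subdiff psi1 (p 0%N) (q 0%N), subdiff psi2 (q n) (- p n) &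
      forall k, (k <= n)%N -> dotv (p k) (p k) <= C /\ dotv (q k) (q k) <= C].
Proof.
have [B53 Hp Hq] := B_bounds.
have BE : B = (2 * beta)^-1 by [].
have [C0 _ hH] := subquadratic_growth H_subquadratic.
have [k1 [C1 [hk1 hpsi1]]] := liminf_quadratic_growth psi1_convex psi1_liminf.
have [kappa [C2 [hkappa hpsi2]]] := liminf_quadratic_growth psi2_convex psi2_liminf.
have b0 := beta_gt0; have T0 := T_gt0.
have {}hk1 : 2 * T * (B * d2 ^+ 2 + 1 - d2) < k1.
  apply: le_lt_trans hk1; rewrite real_normK ?num_real // le_eqVlt; apply/orP; left; apply/eqP.
  by rewrite BE; field; rewrite gt_eqF.
have {}hkappa : 0 <= B * d1 ^+ 2 - d1 -> 2 * T * (B * d1 ^+ 2 - d1) < kappa.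
  move=> _; apply: le_lt_trans hkappa; rewrite real_normK ?num_real // le_eqVlt; apply/orP; left; apply/eqP.
  by rewrite BE; field; rewrite gt_eqF.
have [k2 [c [c0 hk2 hcase coer]]] := energy_coercive T_gt0 B53 Hp Hq hk1 hkappa.
have k10 : 0 <= k1.
  apply/ltW/(le_lt_trans _ hk1); rewrite mulr_ge0 ?mulr_ge0 ?(ltW T0) //.
  have : (5 / 3) * d2 ^+ 2 <= B * d2 ^+ 2 by rewrite ler_wpM2r ?sqr_ge0 // ltW.
  by have := sqr_ge0 (5 / 3 * d2 - 1 / 2); nra.
(* If [k2 < 0], completing the square in [K |y| + k2 |y|^2] derives the growth of [psi2] from its
   affine lower bound. *)
have [C2' hpsi2'] : exists C2', forall y, k2 * dotv y y - C2' <= psi2 y - psi2 0.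
  case: hcase => [[_ ->]|[_ k20]]; first by exists C2.
  have [K K0 KP] := convex_affine_lower psi2_convex.
  exists (K ^+ 2 / (4 * - k2)) => y.
  have := KP y; have := sqr_norm_le_dotv y => hy hK.
  have h1 : k2 * dotv y y <= k2 * `|y| ^+ 2 by rewrite ler_wnM2l // ltW.
  suff : K * `|y| + k2 * `|y| ^+ 2 <= K ^+ 2 / (4 * - k2) by lra.
  rewrite ler_pdivlMr ?mulr_gt0 ?oppr_gt0 //.
  by have := sqr_ge0 (K + 2 * k2 * `|y|); nra.
exact: (discrete_solution_bounded T_gt0 (ltW B_gt0) k10 hk2 hd1 hd2 H_convex psi1_convex psi2_convex
  hH hpsi1 hpsi2' c0 coer).
Qed.

Lemma row_mx_norm_ge (a b : 'rV[R]_N) : `|a| <= `|row_mx a b| /\ `|b| <= `|row_mx a b|.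
Proof.
split; apply/mx_norm_leP => // i j; rewrite ord1.
  by rewrite -(row_mxEl a b 0 j) coord_le_mx_norm.
by rewrite -(row_mxEr a b 0 j) coord_le_mx_norm.
Qed.

Lemma norm_le_of_dotv d (x : 'rV[R]_d) C : dotv x x <= C -> `|x| <= `|C| + 1.
Proof.
move=> hx; have h := le_trans (sqr_norm_le_dotv x) hx.
have h1 := ler_norm C; have := normr_ge0 x; have := normr_ge0 C.
case: (leP `|x| (`|C| + 1)) => // hh ? ?; nra.
Qed.

Lemma limit_trajectory : exists (L : R) (P Q : R -> 'rV[R]_N), [/\ 0 <= L,
  forall s t, 0 <= s -> s <= t -> t <= T -> `|P t - P s| <= L * (t - s) /\ `|Q t - Q s| <= L * (t - s),
  subdiff psi1 (P 0) (Q 0), subdiff psi2 (Q T) (- P T) &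
  forall t, 0 <= t -> exists2 K, 0 <= K &
  forall e x, 0 < e -> t + e <= T -> L * e < 1 -> let z := row_mx (P t) (Q t) in
  dotv (row_mx (Q t - Q (t + e) - e *: (d2 *: P t)) (P (t + e) - P t - e *: (d1 *: Q t))) (x - z)
  <= e * (joined H x - joined H z + K * (L * e) * (1 + `|x - z|))].
Proof.
have [C hC] := approximate_solutions.
have /choice[p] := fun n => hC n.+1 isT.
move=> /choice[q pq]; have {hC} pq n := pq n.
pose h n : R := T / n.+1%:R.
have h0 n : h n != 0 by rewrite gt_eqF // divr_gt0 // ltr0n.
pose a n k := (h n)^-1 *: (p n k.+1 - p n k).
pose b n k := (h n)^-1 *: (q n k - q n k.+1).
have p_step n k : (k < n.+1)%N -> p n k.+1 = p n k + h n *: a n k.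
  by move=> _; rewrite /a scalerA mulfV // scale1r addrC subrK.
have q_step n k : (k < n.+1)%N -> q n k = q n k.+1 + h n *: b n k.
  by move=> _; rewrite /b scalerA mulfV // scale1r addrC subrK.
have sub_H n k : (k < n.+1)%N -> subdiff (joined H) (row_mx (p n k) (q n k.+1))
    (row_mx (b n k - d2 *: p n k) (a n k - d1 *: q n k.+1)).
  by move=> kn; have [hH _ _ _] := pq n; exact: hH.
have sub_1 n : subdiff psi1 (p n 0%N) (q n 0%N) by have [] := pq n.
have sub_2 n : subdiff psi2 (q n n.+1) (- p n n.+1) by have [] := pq n.
pose M := `|C| + 1.
have M0 : 0 <= M by rewrite addr_ge0.
have p_bound n k : (k <= n.+1)%N -> `|p n k| <= M.
  by move=> kn; have [_ _ _ /(_ k kn)[? _]] := pq n; exact: norm_le_of_dotv.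
have q_bound n k : (k <= n.+1)%N -> `|q n k| <= M.
  by move=> kn; have [_ _ _ /(_ k kn)[_ ?]] := pq n; exact: norm_le_of_dotv.
have [C0 C00 hH] := subquadratic_growth H_subquadratic.
(* From [B |u|^2 - C0 <= u . z <= B |u|^2 / 2 + |z|^2 / (2 B)] and [|z|^2 <= 2 C]: the bound on the
   nodes becomes a bound on the slopes. *)
pose D := 2 / B * (C0 + C / B).
have u_bound n k : (k < n.+1)%N ->
    `|row_mx (b n k - d2 *: p n k) (a n k - d1 *: q n k.+1)| <= `|D| + 1.
  move=> kn; apply: norm_le_of_dotv; have := sub_H n k kn.
  set u := row_mx (b n k - _) _; set z := row_mx (p n k) _ => /hH; rewrite -/B => hu.
  have zC : dotv z z <= 2 * C.
    have [_ _ _ hb] := pq n; have [hp _] := hb k (ltnW kn); have [_ hq] := hb k.+1 kn.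
    by rewrite dotv_row_mx; lra.
  have B0 := B_gt0.
  have := dotv_AMGM (B *: u) z; rewrite !dotvZl dotvZr => hA.
  have e1 : dotv u z <= B * dotv u u / 2 + C / B.
    have eC : B * (C / B) = C by field; rewrite gt_eqF.
    rewrite -(ler_pM2l B0) mulrDr eC.
    by move: hA zC; set x := dotv u u; set y := dotv u z; set w := dotv z z; nra.
  rewrite /D mulrAC ler_pdivlMr //; lra.
pose L := `|D| + 1 + (`|d1| + `|d2|) * M.
have dM d m (x : 'rV[R]_m) : `|x| <= M -> `|d *: x| <= `|d| * M.
  by move=> xM; rewrite normrZ ler_wpM2l.
have d1M : 0 <= `|d1| * M by rewrite mulr_ge0.
have d2M : 0 <= `|d2| * M by rewrite mulr_ge0.
have a_bound n k : (k < n.+1)%N -> `|a n k| <= L.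
  move=> kn; have [_ h1] := row_mx_norm_ge (b n k - d2 *: p n k) (a n k - d1 *: q n k.+1).
  have h2 := le_trans h1 (u_bound n k kn).
  have h3 := dM d1 _ _ (q_bound n k.+1 kn).
  have := ler_normD (a n k - d1 *: q n k.+1) (d1 *: q n k.+1); rewrite subrK /L; lra.
have b_bound n k : (k < n.+1)%N -> `|b n k| <= L.
  move=> kn; have [h1 _] := row_mx_norm_ge (b n k - d2 *: p n k) (a n k - d1 *: q n k.+1).
  have h2 := le_trans h1 (u_bound n k kn).
  have h3 := dM d2 _ _ (p_bound n k (ltnW kn)).
  have := ler_normD (b n k - d2 *: p n k) (d2 *: p n k); rewrite subrK /L; lra.
have L0 : 0 <= L by rewrite /L; have := normr_ge0 D; lra.
have [U [P [Q [UU hU pP qQ]]]] := step_limits T p_bound q_bound.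
have [s1 s2] := limit_boundary T_gt0 psi1_convex psi2_convex sub_1 sub_2 pP qQ.
exists L, P, Q; split => //.
- exact: (limit_lipschitz T_gt0 L0 p_step q_step a_bound b_bound hU pP qQ).
- exact: (limit_difference_quotient T_gt0 M0 L0 H_convex p_step q_step sub_H p_bound q_bound
    a_bound b_bound hU pP qQ).
Qed.

Lemma limit_solution : exists u v : W12 N T,
  [/\ {ae (@lebesgue_measure R), forall t, t \in `]0, T[ ->
    subdiff (joined H) (row_mx (u t) (v t)) (row_mx (- w_der v t - d2 *: u t) (w_der u t - d1 *: v t))},
    subdiff psi1 (u 0) (v 0) & subdiff psi2 (v T) (- u T)].
Proof.
have [L [P [Q [L0 PQ s1 s2 quot]]]] := limit_trajectory.
have T0 := T_gt0; have T0' := ltW T_gt0.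
have [u [uP du]] := lipschitz_W12 T_gt0 L0 (fun s t s0 st tT => proj1 (PQ s t s0 st tT)).
have [v [vQ dv]] := lipschitz_W12 T_gt0 L0 (fun s t s0 st tT => proj2 (PQ s t s0 st tT)).
exists u, v; split; last 2 first.
- by rewrite uP // vQ.
- by rewrite uP // vQ.
apply: ae_imply (ae_and du dv) => t [hu hv]; rewrite in_itv /= => t0T.
have /andP[t0 tT] := t0T.
rewrite (uP t) ?(ltW t0) ?(ltW tT) // (vQ t) ?(ltW t0) ?(ltW tT) //.
have {}hu := hu t0T; have {}hv := hv t0T.
have [K K0 KP] := quot t (ltW t0).
set z := row_mx (P t) (Q t) => x.
pose w := x - z; rewrite -/w -(hsubmxK w) dotv_row_mx.
(* [l] and [r] are the two sides of the averaged inclusion divided by [e]; as [e] tends to 0 from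
   the right, the quotients become derivatives and the error vanishes. *)
pose l e := dotv (- (e^-1 *: (Q (t + e) - Q t)) - d2 *: P t) (lsubmx w) +
  dotv (e^-1 *: (P (t + e) - P t) - d1 *: Q t) (rsubmx w).
pose r e := joined H x - joined H z + K * (L * e) * (1 + `|w|).
have cl : l e @[e --> 0^'+] --> dotv (- w_der v t - d2 *: P t) (lsubmx w) +
    dotv (w_der u t - d1 *: Q t) (rsubmx w).
  apply: cvgD; apply: cvg_dotv; try exact: cvg_cst.
    by apply: cvgB; [exact: cvgN|exact: cvg_cst].
  by apply: cvgB; [exact: hu|exact: cvg_cst].
have cr : r e @[e --> 0^'+] --> joined H x - joined H z.
  rewrite -[X in _ --> X]addr0; apply: cvgD; first exact: cvg_cst.
  rewrite [X in _ --> X](_ : _ = K * (L * 0) * (1 + `|w|)); last by rewrite mulr0 mulr0 mul0r.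
  apply: cvgM; last exact: cvg_cst.
  apply: cvgM; first exact: cvg_cst.
  apply: cvgM; first exact: cvg_cst.
  exact: cvg_within.
have : dotv (- w_der v t - d2 *: P t) (lsubmx w) + dotv (w_der u t - d1 *: Q t) (rsubmx w)
    <= joined H x - joined H z.
  apply: (ler_cvg_to cl cr); near=> e.
  have e0 : 0 < e by near: e; exact: nbhs_right_gt.
  have eT : e < T - t by near: e; apply: nbhs_right_lt; rewrite subr_gt0.
  have eL : e < (L + 1)^-1 by near: e; apply: nbhs_right_lt; rewrite invr_gt0 ltr_wpDl.
  have Le : L * e < 1.
    have L1 : 0 < L + 1 by rewrite ltr_wpDl.
    have : (L + 1) * e < 1 by rewrite -ltr_pdivlMl // mulr1.
    lra.
  have eTt : t + e <= T by lra.
  have := KP e x e0 eTt Le; rewrite -/z -/w /=.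
  rewrite -ler_pdivrMl // => hq; apply: le_trans hq.
  have -> : x - z = w by [].
  rewrite -dotvZl -(hsubmxK w) scale_row_mx dotv_row_mx /l.
  rewrite le_eqVlt; apply/orP; left; apply/eqP.
  congr (_ + _); congr (dotv _ _).
    by rewrite !scalerBr scalerA mulVf ?gt_eqF // scale1r opprB.
  by rewrite !scalerBr scalerA mulVf ?gt_eqF // scale1r.
by lra.
Unshelve. all: by end_near.
Qed.

End trajectory.

Theorem theorem3 (R : realType) (N : nat) (T delta1 delta2 beta : R)
    (H : 'rV[R]_N * 'rV[R]_N -> R) (psi1 psi2 : 'rV[R]_N -> R)
    (N_ge1 : (1 <= N)%N) (T_gt0 : 0 < T)
    (hdelta1 : `|delta1| < 1 / (2 * T))
    (hdelta2 : `|delta2| < 1 / (2 * T))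
    (H_convex : convex_function [set: 'rV[R]_N * 'rV[R]_N] H)
    (H_lsc : lower_semicontinuous (EFin \o H))
    (beta_gt0 : 0 < beta)
    (H_subquadratic : subquadratic beta H)
    (hbeta : beta < 1 / 4 *
       Num.min
         ((1 - 4 * T ^+ 2 * `|delta1| ^+ 2)
            / (Num.max (2 * T ^+ 2) 1 - 2 * delta1 * T ^+ 2))
         ((1 - 4 * T ^+ 2 * `|delta2| ^+ 2)
            / (Num.max (2 * T ^+ 2) 1 - 2 * delta2 * T ^+ 2)))
    (psi1_convex : convex_function [set: 'rV[R]_N] psi1)
    (psi1_lsc : lower_semicontinuous (EFin \o psi1))
    (psi2_convex : convex_function [set: 'rV[R]_N] psi2)
    (psi2_lsc : lower_semicontinuous (EFin \o psi2))
    (psi1_growth :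
       ((T * `|delta2| ^+ 2 / beta + 2 * T * (1 - delta2))%:E
        < liminf_quadratic psi1)%E)
    (psi2_growth :
       ((T * `|delta1| ^+ 2 / beta - 2 * T * delta1)%:E
        < liminf_quadratic psi2)%E) :
  exists p q : W12 N T,
    [/\ functional_I delta1 delta2 H psi1 psi2 p q = 0%E,
        forall u v : W12 N T,
          (functional_I delta1 delta2 H psi1 psi2 p q
           <= functional_I delta1 delta2 H psi1 psi2 u v)%E &
        hamiltonian_solution delta1 delta2 H psi1 psi2 p q].
Proof.
have cH : convex_real (joined H).
  have hH := convex_functionE H_convex.
  move=> x y t t01; rewrite /joined !linearD !linearZ /=.
  exact: hH (lsubmx x, rsubmx x) (lsubmx y, rsubmx y) t t01.
have c1 := convex_functionE psi1_convex; have c2 := convex_functionE psi2_convex.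
have [p [q [sH s1 s2]]] := limit_solution T_gt0 beta_gt0 hdelta1 hdelta2 cH c1 c2
  H_subquadratic hbeta psi1_growth psi2_growth.
have H_cont := convex_continuous cH.
have I0 := functional_eq0 T_gt0 H_cont sH s1 s2.
exists p, q; split => //; first by move=> u v; rewrite I0; exact: functional_ge0.
(* A subgradient of [joined H] yields the partial ones by varying one block while the other is
   fixed. *)
split => //; apply: ae_imply sH => t ht /ht {}ht; split.
  exists (w_der p t - delta1 *: q t); last by rewrite subrK.
  move=> y; have := ht (row_mx (p t) y).
  by rewrite sub_row_mx dotv_row_mx subrr dotvC dotv0l add0r !joinedE.
exists (- w_der q t - delta2 *: p t); last by rewrite subrK.
move=> y; have := ht (row_mx y (q t)).
by rewrite sub_row_mx dotv_row_mx subrr (dotvC _ 0) dotv0l addr0 !joinedE.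
Qed.
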